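(* Let $f\in\mathbb{H}^{-s}(\Omega)$, let $\mathscr{T}_Y\in\mathbb{T}$, and let $v\in\mathring{H}^1_L(y^\alpha,\mathcal{C}_Y)$ and $V_{\mathscr{T}_Y}\in\mathbb{V}(\mathscr{T}_Y)$ be the solutions of $$\int_{\mathcal{C}_Y}y^\alpha\nabla v\cdot\nabla\phi=d_s\langle f,\mathrm{tr}_\Omega\,\phi\rangle\quad\forall\phi\in\mathring{H}^1_L(y^\alpha,\mathcal{C}_Y),$$ $$\int_{\mathcal{C}_Y}y^\alpha\nabla V_{\mathscr{T}_Y}\cdot\nabla W=d_s\langle f,\mathrm{tr}_\Omega\,W\rangle\quad\forall W\in\mathbb{V}(\mathscr{T}_Y).$$ For each node $z'\in\mathcal{N}(\mathscr{T}_\Omega)$ let $\eta_{z'}\in\mathcal{W}(\mathcal{C}_{z'})$ be the solution of $$\int_{\mathcal{C}_{z'}}y^\alpha\nabla\eta_{z'}\cdot\nabla W=d_s\langle f,\mathrm{tr}_\Omega\,W\rangle-\int_{\mathcal{C}_{z'}}y^\alpha\nabla V_{\mathscr{T}_Y}\cdot\nabla W\quad\forall W\in\mathcal{W}(\mathcal{C}_{z'}),$$ and set $\mathscr{E}_{z'}=\|\nabla\eta_{z'}\|_{L^2(y^\alpha,\mathcal{C}_{z'})}$. Then, for any $z'\in\mathcal{N}(\mathscr{T}_\Omega)$, $$\mathscr{E}_{z'}\le\|\nabla(v-V_{\mathscr{T}_Y})\|_{L^2(y^\alpha,\mathcal{C}_{z'})}.$$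
   Context: Domain and parameters. $\Omega\subset\mathbb{R}^n$ ($n\ge1$) is open, bounded and connected with polyhedral boundary; $s\in(0,1)$, $\alpha=1-2s\in(-1,1)$, $d_s=2^{1-2s}\Gamma(1-s)/\Gamma(s)$. Points of $\mathbb{R}^{n+1}$ are written $(x',y)$. For $Y>0$, $\mathcal{C}_Y=\Omega\times(0,Y)$ and $\partial_L\mathcal{C}_Y$ is its lateral boundary. Spaces. For $D\subset\mathbb{R}^{n+1}$, $\|w\|_{L^2(y^\alpha,D)}^2=\int_D|y|^\alpha w^2$, and $H^1(y^\alpha,D)$ is the space of $w\in L^2(y^\alpha,D)$ with $|\nabla w|\in L^2(y^\alpha,D)$. $\mathring{H}^1_L(y^\alpha,\mathcal{C}_Y)=\{w\in H^1(y^\alpha,\mathcal{C}_Y): w=0\text{ on }\partial_L\mathcal{C}_Y\cup\Omega\times\{Y\}\}$. With $\{\lambda_k,\varphi_k\}$ the Dirichlet eigenpairs of $-\Delta$ on $\Omega$, $\{\varphi_k\}$ orthonormal in $L^2(\Omega)$, $\mathbb{H}^s(\Omega)=\{w=\sum_k w_k\varphi_k:\sum_k\lambda_k^s w_k^2<\infty\}$, $\mathbb{H}^{-s}(\Omega)$ is its dual and $\langle\cdot,\cdot\rangle$ the duality pairing. $\mathrm{tr}_\Omega$ is the trace onto $\Omega\times\{0\}$; it maps $\mathring{H}^1_L(y^\alpha,\mathcal{C}_Y)$ continuously into $\mathbb{H}^s(\Omega)$. Functions on a cylindrical star that vanish on its lateral and top boundary are extended by zero when their trace is taken. Meshes. $\mathscr{T}_\Omega=\{K\}$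 is a conforming, shape regular mesh of $\Omega$, with elements isoparametrically equivalent to the unit cube $[0,1]^n$ or the unit simplex. $\mathcal{I}_Y$ is the partition of $[0,Y]$ with points $y_k=(k/M)^\gamma Y$, $k=0,\dots,M$, where $\gamma>3/(1-\alpha)=3/(2s)$. $\mathscr{T}_Y$ is the tensor product mesh of $\mathcal{C}_Y$ with cells $T=K\times I$, $K\in\mathscr{T}_\Omega$, $I\in\mathcal{I}_Y$. It is assumed that there is a constant $\sigma_Y$ with $|I_1|/|I_2|\le\sigma_Y$ whenever $K_1\times I_1$ and $K_2\times I_2$ in $\mathscr{T}_Y$ intersect. $\mathbb{T}$ is the family of all such meshes (with uniform constants), and the following standing assumption is made: there is a constant $C_{\mathbb{T}}>0$ such that for every $\mathscr{T}_Y\in\mathbb{T}$, $h_Y\le C_{\mathbb{T}}h_{z'}$ for all interior nodes $z'$ of $\mathscr{T}_\Omega$, where $h_Y$ is the largest mesh size in the $y$ direction and $h_{z'}=\min\{h_K:K\ni z'\}$, $h_K$ being the size (diameter) of $K$. Discrete space. $\mathbb{V}(\mathscr{T}_Y)=\{W\in C^0(\overline{\mathcal{C}_Y}): W|_T\in\mathcal{P}_1(K)\otimes\mathbb{P}_1(I)\ \forall T=K\times I\in\mathscr{T}_Y,\ W=0\text{ on }\partial_L\mathcal{C}_Y\cup\Omega\times\{Y\}\}$, where $\mathcal{P}_1(K)$ is the space of polynomials of total degree at most 1 if $K$ is a simplex, and of degree at most 1 in each variable if $K$ is an $n$-rectangle. Stars and discrete local spaces. $\mathcal{N}(\mathscr{T}_\Omega)$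 is the set of all nodes of $\mathscr{T}_\Omega$ (including boundary nodes). For $z'\in\mathcal{N}(\mathscr{T}_\Omega)$, $S_{z'}=\bigcup_{K\ni z'}K$, $\mathcal{C}_{z'}=S_{z'}\times(0,Y)$, and $$\mathcal{W}(\mathcal{C}_{z'})=\{W\in C^0(\overline{\mathcal{C}_{z'}}): W|_T\in\mathcal{P}_2(K)\otimes\mathbb{P}_2(I)\ \forall T=K\times I\subset\mathcal{C}_{z'},\ W=0\text{ on }\partial\mathcal{C}_{z'}\setminus\Omega\times\{0\}\},$$ where $\mathcal{P}_2(K)$ is the space of polynomials of degree at most 2 in each variable if $K$ is a quadrilateral ($n$-rectangle), and $\mathcal{P}_2(K)=\mathbb{P}_2(K)\oplus\mathbb{B}(K)$ if $K$ is a simplex, with $\mathbb{P}_2(K)$ the polynomials of total degree at most 2 and $\mathbb{B}(K)$ the space spanned by a local cubic bubble function on $K$.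
   Formalization: On simplices of dimension n ≥ 3, where no nonzero cubic polynomial vanishes on the whole boundary, the local cubic bubble spanning B(K) is replaced by a bubble of degree at most n+1; for n ≤ 2 the bubble is cubic as stated. *)

(* Defs.v *)
From HB Require Import structures.
From mathcomp Require Import all_boot all_order all_algebra.
From mathcomp Require Import all_classical all_reals all_analysis.

Set Implicit Arguments.
Unset Strict Implicit.
Unset Printing Implicit Defensive.

Import Order.TTheory GRing.Theory Num.Theory.
Import numFieldNormedType.Exports.
Local Open Scope classical_set_scope.
Local Open Scope ring_scope.

(** * Lebesgue measure on ['rV[R]_n] *)

Section row_measurable.
Context {R : realType} (n : nat).

(* inverse images of Borel sets under the coordinate projections *)
Definition row_cylinders : set (set 'rV[R]_n) :=
  [set A | exists i : 'I_n, exists2 B : set R,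
     measurable B & A = (fun x : 'rV[R]_n => x ord0 i) @^-1` B].

Definition row_display : measure_display := sigma_display row_cylinders.

Let rowC A : <<s row_cylinders >> A -> <<s row_cylinders >> (~` A).
Proof. exact: sigma_algebraC. Qed.

HB.instance Definition _ := @isMeasurable.Build row_display
  'rV[R]_n <<s row_cylinders >>
  (@sigma_algebra0 _ setT row_cylinders) rowC
  (@sigma_algebra_bigcup _ setT row_cylinders).

End row_measurable.

Section row_cons.
Context {R : realType} (n : nat).

Definition row_cons (p : measurableTypeR R * 'rV[R]_n) : 'rV[R]_n.+1 :=
  \row_i (if unlift ord0 i is Some j then p.2 ord0 j else p.1).

Lemma measurable_row_coord (m : nat) (i : 'I_m) :
  measurable_fun setT (fun x : 'rV[R]_m => x ord0 i).
Proof.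
by move=> _ B mB; rewrite setTI; apply: sub_sigma_algebra; exists i; exists B.
Qed.

Lemma measurable_row_cons : measurable_fun setT row_cons.
Proof.
apply: (measurability (@row_cylinders R n.+1)) => //.
move=> _ [_ [i [B mB ->]] <-]; rewrite setTI.
case: (unliftP ord0 i) => [j ->|->]; last first.
  rewrite (_ : _ @^-1` _ = fst @^-1` B); last first.
    by apply/seteqP; split=> p /=; rewrite mxE unlift_none.
  by rewrite -[X in measurable X]setTI; exact: measurable_fst.
rewrite (_ : _ @^-1` _ =
    snd @^-1` ((fun x : 'rV[R]_n => x ord0 j) @^-1` B)); last first.
  by apply/seteqP; split=> p /=; rewrite mxE liftK.
rewrite -[X in measurable X]setTI; apply: measurable_snd => //.
by rewrite -[X in measurable X]setTI; exact: measurable_row_coord.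
Qed.

Lemma measurable_row_uncons : measurable_fun setT
  (fun x : 'rV[R]_n.+1 => (x ord0 ord0 : measurableTypeR R,
                           \row_j x ord0 (lift ord0 j) : 'rV[R]_n)).
Proof.
apply/measurable_fun_pair => /=; first exact: measurable_row_coord.
apply: (measurability (@row_cylinders R n)) => //.
move=> _ [_ [i [B mB ->]] <-]; rewrite setTI.
rewrite (_ : _ @^-1` _ = (fun x : 'rV[R]_n.+1 => x ord0 (lift ord0 i)) @^-1` B).
  by rewrite -[X in measurable X]setTI; exact: measurable_row_coord.
by apply/seteqP; split=> x /=; rewrite mxE.
Qed.

HB.instance Definition _ := isMeasurableFun.Build _ _ _ _ row_cons
  measurable_row_cons.

Variable mu : {sigma_finite_measure set 'rV[R]_n -> \bar R}.

Definition lebesgue_rowS : set 'rV[R]_n.+1 -> \bar R :=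
  pushforward (lebesgue_measure \x mu)%E row_cons.

Let lebesgue_rowS0 : lebesgue_rowS set0 = 0%E.
Proof. exact: measure0. Qed.

Let lebesgue_rowS_ge0 A : (0 <= lebesgue_rowS A)%E.
Proof. exact: measure_ge0. Qed.

Let lebesgue_rowS_sigma_additive : semi_sigma_additive lebesgue_rowS.
Proof. exact: measure_semi_sigma_additive. Qed.

HB.instance Definition _ := isMeasure.Build _ _ _ lebesgue_rowS
  lebesgue_rowS0 lebesgue_rowS_ge0 lebesgue_rowS_sigma_additive.

Let lebesgue_rowS_sigma_finite : sigma_finite setT lebesgue_rowS.
Proof.
have /sigma_finiteP[F [TF ndF Foo]] :=
  sigma_finiteT (@lebesgue_measure R : {sigma_finite_measure set _ -> \bar R}).
have /sigma_finiteP[G [TG ndG Goo]] := sigma_finiteT mu.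
pose uncons (x : 'rV[R]_n.+1) :=
  (x ord0 ord0 : measurableTypeR R, \row_j x ord0 (lift ord0 j) : 'rV[R]_n).
have row_consK : cancel row_cons uncons.
  move=> [t x]; rewrite /uncons mxE unlift_none; congr (_, _).
  by apply/rowP => j; rewrite !mxE liftK.
exists (fun k => uncons @^-1` (F k `*` G k)).
  rewrite -preimage_bigcup; apply/seteqP; split=> //= x _.
  have [k _ Fk] : (\bigcup_i F i) (uncons x).1 by rewrite -TF.
  have [l _ Gl] : (\bigcup_i G i) (uncons x).2 by rewrite -TG.
  exists (maxn k l) => //; split=> /=.
  - by move: Fk; exact/subsetPset/ndF/leq_maxl.
  - by move: Gl; exact/subsetPset/ndG/leq_maxr.
move=> k; have [mF Fk] := Foo k; have [mG Gk] := Goo k; split.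
  rewrite -[X in measurable X]setTI.
  by apply: measurable_row_uncons => //; exact: measurableX.
rewrite /lebesgue_rowS /pushforward (_ : _ @^-1` _ = F k `*` G k).
  by rewrite product_measure1E// lte_mul_pinfty// ge0_fin_numE.
by apply/seteqP; split=> p; rewrite /preimage /mkset row_consK.
Qed.

HB.instance Definition _ := Measure_isSigmaFinite.Build _ _ _ lebesgue_rowS
  lebesgue_rowS_sigma_finite.

End row_cons.

Fixpoint lebesgue_row (R : realType) (n : nat) :
    {sigma_finite_measure set 'rV[R]_n -> \bar R} :=
  match n with
  | 0 => \d_(0 : 'rV[R]_0)
  | n.+1 => lebesgue_rowS (lebesgue_row R n)
  end.

(** * Weighted Sobolev spaces *)

Section euclid.
Context {R : realType} {m : nat}.
Implicit Types x y : 'rV[R]_m.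

Definition dotv x y : R := \sum_i x ord0 i * y ord0 i.

(* the norm [`|x|] of ['rV[R]_m] is the sup norm *)
Definition enorm x : R := Num.sqrt (dotv x x).

Definition diam (A : set 'rV[R]_m) : R :=
  sup [set r | exists x y, [/\ A x, A y & r = enorm (x - y)]].

Definition frontier (A : set 'rV[R]_m) : set 'rV[R]_m := closure A `\` A°.

End euclid.

Section sobolev.
Context {R : realType} {m : nat}.
Local Notation mu := (lebesgue_row R m).
Implicit Types (D A G : set 'rV[R]_m) (w g phi om : 'rV[R]_m -> R).

Definition locally_integrable_on D g : Prop :=
  measurable_fun D g /\
  forall K, compact K -> K `<=` D° -> mu.-integrable K (EFin \o g).

Definition partial phi (i : 'I_m) : 'rV[R]_m -> R :=
  fun x => 'D_(delta_mx ord0 i : 'rV[R]_m) phi x.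

(* C^1 functions with compact support in D; the support is required to lie
   in the interior of D since D may be a union of closed cells *)
Definition test_function D : set ('rV[R]_m -> R) :=
  [set phi : 'rV[R]_m -> R | [/\ forall x, differentiable phi x,
     forall i, continuous (partial phi i),
     compact (closure [set x | phi x != 0]) &
     closure [set x | phi x != 0] `<=` D°]].

Definition is_weak_partial D w (i : 'I_m) g : Prop :=
  [/\ locally_integrable_on D w, locally_integrable_on D g &
    forall phi, test_function D phi ->
      \int[mu]_(x in D) (w x * partial phi i x) =
      - \int[mu]_(x in D) (g x * phi x)].

(* determined up to a null subset of the interior of D *)
Definition weak_partial D w (i : 'I_m) : 'rV[R]_m -> R :=
  xget (fun=> 0) [set g | is_weak_partial D w i g].

Definition grad D w : 'rV[R]_m -> 'rV[R]_m :=
  fun x => \row_i weak_partial D w i x.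

Definition L2 om D : set ('rV[R]_m -> R) :=
  [set w : 'rV[R]_m -> R | measurable_fun D w /\
    (\int[mu]_(x in D) (om x * w x ^+ 2)%:E < +oo)%E].

Definition L2dot om D w g : R := \int[mu]_(x in D) (om x * (w x * g x)).

(* the inner product and the norm of L^2(om, D) for vector fields *)
Definition L2vdot om D (p q : 'rV[R]_m -> 'rV[R]_m) : R :=
  \int[mu]_(x in D) (om x * dotv (p x) (q x)).

Definition L2vnorm om D (p : 'rV[R]_m -> 'rV[R]_m) : R :=
  Num.sqrt (\int[mu]_(x in D) (om x * enorm (p x) ^+ 2)).

Definition H1 om D : set ('rV[R]_m -> R) :=
  [set w : 'rV[R]_m -> R | L2 om D w /\
    forall i, (exists g, is_weak_partial D w i g) /\
              L2 om D (weak_partial D w i)].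

Definition H1norm om D w : R :=
  Num.sqrt (L2dot om D w w + L2vnorm om D (grad D w) ^+ 2).

(* members of H^1(om, D) that are continuous on the closure of D and vanish
   pointwise on G *)
Definition C0H1 om D G : set ('rV[R]_m -> R) :=
  [set w : 'rV[R]_m -> R | [/\ H1 om D w, {within closure D, continuous w} &
     forall x, G x -> w x = 0]].

(* the members of H^1(om, D) with zero trace on the part G of the boundary *)
Definition H10 om D G : set ('rV[R]_m -> R) :=
  [set w : 'rV[R]_m -> R | H1 om D w /\
     exists2 u : nat -> 'rV[R]_m -> R, (forall k, C0H1 om D G (u k)) &
       (fun k => H1norm om D (u k \- w)) @ \oo --> (0 : R)].

End sobolev.

(** * The fractional spaces on [Omega] *)

Section fractional.
Context {R : realType} {n : nat}.
Variables (Omega : set 'rV[R]_n) (s : R).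
Implicit Types (lam : nat -> R) (phi : nat -> 'rV[R]_n -> R).

Definition one_weight : 'rV[R]_n -> R := fun=> 1.

Definition H10_Omega : set ('rV[R]_n -> R) :=
  H10 one_weight Omega (frontier Omega).

Definition dirichlet_eigenpairs lam phi : Prop :=
  [/\ forall k, H10_Omega (phi k),
      forall k psi, H10_Omega psi ->
        L2vdot one_weight Omega (grad Omega (phi k)) (grad Omega psi) =
        lam k * L2dot one_weight Omega (phi k) psi,
      forall j k, L2dot one_weight Omega (phi j) (phi k) = (j == k)%:R &
      forall w, L2 one_weight Omega w ->
        (forall k, L2dot one_weight Omega w (phi k) = 0) ->
        L2dot one_weight Omega w w = 0].

Definition Hs_norm2 lam phi (w : 'rV[R]_n -> R) : \bar R :=
  (\sum_(0 <= k <oo)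
    (lam k `^ s * L2dot one_weight Omega w (phi k) ^+ 2)%:E)%E.

Definition Hs lam phi : set ('rV[R]_n -> R) :=
  [set w : 'rV[R]_n -> R | L2 one_weight Omega w /\ (Hs_norm2 lam phi w < +oo)%E].

(* The dual of H^s: bounded linear functionals f, the pairing with w being
   f w. Boundedness makes f w depend only on the class of w modulo null sets;
   the values of f outside H^s are irrelevant. *)
Definition Hs_dual lam phi : set (('rV[R]_n -> R) -> R) :=
  [set f | (forall a w z, Hs lam phi w -> Hs lam phi z ->
              f (fun x => a * w x + z x) = a * f w + f z) /\
           exists C, forall w, Hs lam phi w ->
              `|f w| <= C * Num.sqrt (fine (Hs_norm2 lam phi w))].

End fractional.

Definition Gamma {R : realType} (a : R) : R :=
  \int[lebesgue_measure]_(t in `]0, +oo[) (t `^ (a - 1) * expR (- t)).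

Definition d_s {R : realType} (s : R) : R :=
  2 `^ (1 - 2 * s) * Gamma (1 - s) / Gamma s.

(** * The truncated cylinder *)

Section cylinder.
Context {R : realType} {n : nat}.
Implicit Types (p : 'rV[R]_n.+1) (x : 'rV[R]_n) (y Y s : R).

(* a point (x', y) is stored with y as its last coordinate *)
Definition xpart p : 'rV[R]_n := col' ord_max p.
Definition ypart p : R := p ord0 ord_max.
Definition pt x y : 'rV[R]_n.+1 :=
  \row_i (if unlift ord_max i is Some j then x ord0 j else y).

Definition cylinder (S : set 'rV[R]_n) Y : set 'rV[R]_n.+1 :=
  [set p | S (xpart p) /\ 0 < ypart p < Y].

Definition lateral (S : set 'rV[R]_n) Y : set 'rV[R]_n.+1 :=
  [set p | frontier S (xpart p) /\ 0 < ypart p < Y].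

Definition slice (S : set 'rV[R]_n) y : set 'rV[R]_n.+1 :=
  [set p | S (xpart p) /\ ypart p = y].

(* y^alpha with alpha = 1 - 2 s *)
Definition yweight s p : R := `|ypart p| `^ (1 - 2 * s).

Definition zero_extension (A : set 'rV[R]_n.+1) (W : 'rV[R]_n.+1 -> R) :
    'rV[R]_n.+1 -> R :=
  fun p => if p \in A then W p else 0.

Variables (Omega : set 'rV[R]_n) (s Y : R).
Local Notation CY := (cylinder Omega Y).

Definition zero_part : set 'rV[R]_n.+1 := lateral Omega Y `|` slice Omega Y.

Definition H1L : set ('rV[R]_n.+1 -> R) := H10 (yweight s) CY zero_part.

(* the trace is the continuous extension of the pointwise restriction *)
Definition is_trace (w : 'rV[R]_n.+1 -> R) (g : 'rV[R]_n -> R) : Prop :=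
  L2 one_weight Omega g /\
  exists u : nat -> 'rV[R]_n.+1 -> R,
    [/\ forall k, C0H1 (yweight s) CY zero_part (u k),
        (fun k => H1norm (yweight s) CY (u k \- w)) @ \oo --> (0 : R) &
        (fun k => \int[lebesgue_row R n]_(x in Omega)
           (u k (pt x 0) - g x) ^+ 2) @ \oo --> (0 : R)].

(* determined up to a null subset of Omega *)
Definition tr (w : 'rV[R]_n.+1 -> R) : 'rV[R]_n -> R :=
  xget (fun=> 0) [set g | is_trace w g].

End cylinder.

(** * Polynomial spaces *)

Section polynomials.
Context {R : realType} {n : nat}.

Definition monomial k (e : {ffun 'I_n -> 'I_k.+1}) (x : 'rV[R]_n) : R :=
  \prod_i x ord0 i ^+ e i.

(* degree at most k in each variable *)
Definition Qpoly k : set ('rV[R]_n -> R) :=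
  [set p | exists c : {ffun 'I_n -> 'I_k.+1} -> R,
     p = fun x => \sum_(e : {ffun 'I_n -> 'I_k.+1}) c e * monomial e x].

(* total degree at most k *)
Definition Ppoly k : set ('rV[R]_n -> R) :=
  [set p | exists2 c : {ffun 'I_n -> 'I_k.+1} -> R,
     forall e : {ffun 'I_n -> 'I_k.+1}, (k < \sum_i e i)%N -> c e = 0 &
     p = fun x => \sum_(e : {ffun 'I_n -> 'I_k.+1}) c e * monomial e x].

(* P (x) P_k, where P_k are the polynomials of degree at most k in y *)
Definition tensor_poly (P : set ('rV[R]_n -> R)) k : set ('rV[R]_n -> R -> R) :=
  [set u | exists2 a : 'I_k.+1 -> 'rV[R]_n -> R, forall j, P (a j) &
     u = fun x y => \sum_j a j x * y ^+ j].

End polynomials.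

(** * Meshes *)

Inductive shape := Simplex | Cube.

Section reference.
Context {R : realType} {n : nat}.
Implicit Types (x : 'rV[R]_n) (E : set 'rV[R]_n).

Definition bary x (i : 'I_n.+1) : R :=
  if unlift ord0 i is Some j then x ord0 j else 1 - \sum_j x ord0 j.

Definition ref_element (sh : shape) : set 'rV[R]_n :=
  match sh with
  | Simplex => [set x | forall i, 0 <= bary x i]
  | Cube => [set x | forall i, 0 <= x ord0 i <= 1]
  end.

(* faces of all dimensions, the empty face and the element included *)
Definition ref_face (sh : shape) E : Prop :=
  match sh with
  | Simplex => exists A : {set 'I_n.+1},
      E = ref_element Simplex `&` [set x | forall i, i \in A -> bary x i = 0]
  | Cube => exists A B : {set 'I_n},
      E = ref_element Cube `&` [set x |
        (forall i, i \in A -> x ord0 i = 0) /\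
        (forall i, i \in B -> x ord0 i = 1)]
  end.

Definition ref_P1 (sh : shape) : set ('rV[R]_n -> R) :=
  match sh with Simplex => Ppoly 1 | Cube => Qpoly 1 end.

(* Bubble functions of the reference simplex. For n = 2 these are the nonzero
   multiples of the cubic [\prod_i bary x i]. No cubic vanishes on the boundary
   of a simplex of dimension n >= 3; there the lowest possible degree n + 1
   takes the place of 3. *)
Definition is_bubble (b : 'rV[R]_n -> R) : Prop :=
  [/\ Ppoly (maxn 3 n.+1) b, ~ Ppoly 2 b &
      forall x, ref_element Simplex x -> (exists i, bary x i = 0) -> b x = 0].

(* P_2(K) + B(K) on simplices, with bubble b, and Q_2(K) on cubes *)
Definition ref_P2 (sh : shape) (b : 'rV[R]_n -> R) : set ('rV[R]_n -> R) :=
  match sh with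
  | Simplex => [set p | exists2 q, Ppoly 2 q &
                  exists c : R, p = fun x => q x + c * b x]
  | Cube => Qpoly 2
  end.

End reference.

(* a cell is the image of the reference element under a parametrization *)
Record cell (R : realType) (n : nat) := Cell {
  cell_shape : shape;
  cell_map : 'rV[R]_n -> 'rV[R]_n }.

Record mesh (R : realType) (n : nat) := Mesh {
  ncells : nat;
  cells : 'I_ncells -> cell R n;
  nlayers : nat }.

Arguments ref_element R n sh : clear implicits.

Section mesh.
Context {R : realType} {n : nat}.
Implicit Types (K : cell R n) (T : mesh R n) (z : 'rV[R]_n).

Definition cell_set K : set 'rV[R]_n :=
  cell_map K @` ref_element R n (cell_shape K).

(* isoparametrically equivalent to the reference element: each component of
   the map lies in the first order space of the element (affine for simplices,
   multilinear for cubes) and the map has a Lipschitz inverse *)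
Definition isoparametric K : Prop :=
  (forall i, ref_P1 (cell_shape K) (fun x => cell_map K x ord0 i)) /\
  exists2 c : R, 0 < c &
    forall x y, ref_element R n (cell_shape K) x ->
      ref_element R n (cell_shape K) y ->
      c * enorm (x - y) <= enorm (cell_map K x - cell_map K y).

(* the set of points of the i-th cell of T *)
Definition elt T (i : 'I_(ncells T)) : set 'rV[R]_n := cell_set (cells i).

Definition conforming (Omega : set 'rV[R]_n) T : Prop :=
  [/\ closure Omega = \bigcup_i elt (T := T) i,
      forall i j : 'I_(ncells T), i != j -> (elt i)° `&` (elt j)° = set0 &
      forall i j : 'I_(ncells T), i != j ->
        exists E F, [/\ ref_face (cell_shape (cells i)) E,
          ref_face (cell_shape (cells j)) F,
          elt i `&` elt j = cell_map (cells i) @` E &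
          elt i `&` elt j = cell_map (cells j) @` F]].

Definition shape_regular (sigma : R) T : Prop :=
  forall i : 'I_(ncells T), exists x0 (rho : R), [/\ 0 < rho,
    [set x | enorm (x - x0) <= rho] `<=` elt i & diam (elt i) <= sigma * rho].

Definition is_node T z : Prop :=
  exists i : 'I_(ncells T), exists2 x, ref_face (cell_shape (cells i)) [set x] &
    z = cell_map (cells i) x.

Definition star T z : set 'rV[R]_n :=
  [set x | exists2 i : 'I_(ncells T), elt i z & elt i x].

Definition h_node T z : R :=
  inf [set h | exists2 i : 'I_(ncells T), elt i z & h = diam (elt i)].

Variables (gam Y : R).

Definition ygrid T (k : nat) : R := (k%:R / (nlayers T)%:R) `^ gam * Y.

Definition layer T (k : nat) : set R := `[ygrid T k, ygrid T k.+1].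

Definition layer_size T (k : nat) : R := ygrid T k.+1 - ygrid T k.

Definition h_Y T : R := \big[Num.max/0]_(k < nlayers T) layer_size T k.

(* The family of admissible tensor product meshes of the cylinder
   Omega x (0, Y), with its uniform constants: sigma for the shape regularity,
   sigmaY for the ratio of adjacent layers and CT for the comparison of the
   mesh sizes in the two directions. *)
Definition mesh_family (Omega : set 'rV[R]_n) (sigma sigmaY CT : R) :
    set (mesh R n) :=
  [set T | [/\ (0 < nlayers T)%N,
     conforming Omega T,
     (forall i : 'I_(ncells T), isoparametric (cells i)) /\
       shape_regular sigma T,
     forall (i j : 'I_(ncells T)) (k l : 'I_(nlayers T)),
       elt i `&` elt j !=set0 -> layer T k `&` layer T l !=set0 ->
       layer_size T k / layer_size T l <= sigmaY &
     forall z, is_node T z -> Omega z -> h_Y T <= CT * h_node T z]].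

(* The discrete spaces. The local spaces of a cell K are the images of those
   of the reference element under the parametrization of K; for simplices and
   n-rectangles this gives the polynomials on K. *)
Definition VT (Omega : set 'rV[R]_n) T : set ('rV[R]_n.+1 -> R) :=
  [set W | [/\ {within closure (cylinder Omega Y), continuous W},
     forall (i : 'I_(ncells T)) (k : 'I_(nlayers T)),
       exists2 u, tensor_poly (ref_P1 (cell_shape (cells i))) 1 u &
         forall x y, ref_element R n (cell_shape (cells i)) x -> layer T k y ->
           W (pt (cell_map (cells i) x) y) = u x y &
     forall p, zero_part Omega Y p -> W p = 0]].

Definition Wz (Omega : set 'rV[R]_n) T
    (b : 'I_(ncells T) -> 'rV[R]_n -> R) z : set ('rV[R]_n.+1 -> R) :=
  [set W | [/\ {within closure (cylinder (star T z) Y), continuous W},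
     forall (i : 'I_(ncells T)) (k : 'I_(nlayers T)), elt i z ->
       exists2 u, tensor_poly (ref_P2 (cell_shape (cells i)) (b i)) 2 u &
         forall x y, ref_element R n (cell_shape (cells i)) x -> layer T k y ->
           W (pt (cell_map (cells i) x) y) = u x y &
     forall p, (frontier (cylinder (star T z) Y) `\` slice Omega 0) p ->
       W p = 0]].

End mesh.

Section domain.
Context {R : realType} {n : nat}.

(* closure Omega is a polyhedron, and Omega is its interior *)
Definition polyhedral (Omega : set 'rV[R]_n) : Prop :=
  (exists (N : nat) (K : 'I_N -> cell R n),
    (forall i, isoparametric (K i) /\ cell_shape (K i) = Simplex) /\
    closure Omega = \bigcup_i cell_set (K i)) /\
  (closure Omega)° = Omega.

Definition polyhedral_domain (Omega : set 'rV[R]_n) : Prop :=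
  [/\ Omega !=set0, open Omega, bounded_set Omega, connected Omega &
      polyhedral Omega].

End domain.

(* Main.v *)
Require Import Defs.
From HB Require Import structures.
From mathcomp Require Import all_boot all_order all_algebra.
From mathcomp Require Import all_classical all_reals all_analysis.
From mathcomp Require Import measurable_realfun ring lra zify.

Set Implicit Arguments.
Unset Strict Implicit.
Unset Printing Implicit Defensive.

Import Order.TTheory GRing.Theory Num.Theory.
Import numFieldNormedType.Exports.
Local Open Scope classical_set_scope.
Local Open Scope ring_scope.

(** Extended by zero, the local indicator [eta z] is an admissible test function
    for the continuous problem on the whole cylinder [CY]. With [B] the weighted
    energy product on the star cylinder, the equation of [v] tested with this
    extension and the equation of [eta z] tested with [eta z] itself combine into
    [B(eta, eta) = B(v, eta) - B(V, eta) = B(v - V, eta)], and the estimate is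
    the Cauchy-Schwarz inequality ([energy_le]).

    What has to be justified is that these functions belong to the weighted
    Sobolev space and that their weak gradients, each determined only up to null
    sets and relative to its own domain, can be compared. This rests on three
    facts.

    - A weak gradient is unique almost everywhere in the interior
      ([weak_partial_ae_eq]): a function orthogonal to all test functions has
      zero integral over every box, and a finite measure is determined by its
      values on boxes.

    - A function with Lipschitz bounds along segments whose difference quotients
      converge almost everywhere has a bounded weak gradient
      ([weak_partial_quotients]): integrate by parts at the level of difference
      quotients, by translation invariance of the measure, and pass to the limit
      by dominated convergence.

    - Finite element functions, and extensions by zero of those on a star, are of
      this kind ([piecewise_weak_partial]). They are polynomials read through the
      parametrizations of the mesh prisms. A parametrization with a Lipschitz
      inverse has an invertible differential and maps open sets to open sets
      ([regular_image_open]), so that difference quotients converge in the cores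
      of the prisms ([chart_quotient_cvg]); the boundaries of the prisms are
      Lipschitz images of parts of hyperplanes, hence null
      ([prism_boundary_null]); finally, the Lipschitz bounds on the closed prisms
      chain along segments ([covered_lipschitz]).

    The extension of the indicator is continuous on the closed cylinder and
    vanishes on its lateral and top boundary ([ext_continuous],
    [ext_zero_part]), and the boundedness of its weak gradient together with the
    integrability of the weight puts it in the weighted space ([ext_H1L]). Its
    gradient agrees almost everywhere with that of the indicator on the star and
    with zero elsewhere ([ext_grad]). *)

(** * Boxes and Lebesgue measure on row vectors *)

Lemma coord_le_norm (R : realType) m (x : 'rV[R]_m) i : `|x ord0 i| <= `|x|.
Proof.
rewrite [leRHS]/Num.norm /= mx_normrE; apply/bigmax_geP; right => /=.
by exists (ord0, i).
Qed.

Lemma norm_le_coord (R : realType) m (x : 'rV[R]_m) c :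
  0 <= c -> (forall i, `|x ord0 i| <= c) -> `|x| <= c.
Proof.
move=> c0 xc; rewrite [leLHS]/Num.norm /= mx_normrE.
by apply: bigmax_le => // -[i j] _ /=; rewrite (ord1 i).
Qed.

Lemma norm_delta_le1 (R : realType) m (i : 'I_m) :
  `|delta_mx ord0 i : 'rV[R]_m| <= 1.
Proof.
by apply: norm_le_coord => // j; rewrite mxE eqxx; case: (j == i); rewrite ?normr1 ?normr0.
Qed.

Lemma norm_lt_coord (R : realType) m (x : 'rV[R]_m) c :
  0 < c -> (forall i, `|x ord0 i| < c) -> `|x| < c.
Proof.
move=> c0 xc; rewrite [ltLHS]/Num.norm /= mx_normrE.
by apply: bigmax_lt => // -[i j] _ /=; rewrite (ord1 i).
Qed.

Lemma nbhs_rowP (R : realType) m (x : 'rV[R]_m) (A : set 'rV[R]_m) :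
  nbhs x A <-> exists2 e : R, 0 < e & forall y, `|y - x| < e -> A y.
Proof.
split=> [/nbhs_ballP[e e0 eA]|[e e0 eA]]; last apply/nbhs_ballP; exists e => // y.
  by move=> yx; apply: eA; rewrite -ball_normE /= distrC.
by rewrite -ball_normE /= distrC; exact: eA.
Qed.

Section boxes.
Context {R : realType}.

Definition box m (a b : 'rV[R]_m) : set 'rV[R]_m :=
  [set x | forall i, a ord0 i < x ord0 i < b ord0 i].

Definition boxes m : set (set 'rV[R]_m) :=
  [set B | exists a b, B = box a b].

Arguments boxes m : clear implicits.

Lemma box_empty m (a b : 'rV[R]_m) i : b ord0 i <= a ord0 i -> box a b = set0.
Proof.
move=> ba; apply/seteqP; split => // x /(_ i) /andP[ax xb].
by have := lt_trans ax xb; rewrite ltNge ba.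
Qed.

Lemma measurable_box m (a b : 'rV[R]_m) : measurable (box a b).
Proof.
rewrite (_ : box a b = \bigcap_(i in [set: 'I_m])
    ((fun x : 'rV[R]_m => x ord0 i) @^-1` `]a ord0 i, b ord0 i[%classic)).
  apply: fin_bigcap_measurable => // i _.
  by rewrite -[X in measurable X]setTI; exact: measurable_row_coord.
apply/seteqP; split => x /= xab i; first by move=> _ /=; rewrite in_itv /=.
by have := xab i Logic.I; rewrite /= in_itv.
Qed.

(** Fubini, one coordinate at a time. *)
Lemma lebesgue_row_box m (a b : 'rV[R]_m) :
  (forall i, a ord0 i <= b ord0 i) ->
  lebesgue_row R m (box a b) = (\prod_i (b ord0 i - a ord0 i))%:E.
Proof.
elim: m a b => [a b _|m IH a b ab].
  by rewrite big_ord0 /= diracE mem_set// => -[].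
rewrite /= /lebesgue_rowS /pushforward.
pose a' : 'rV[R]_m := \row_j a ord0 (lift ord0 j).
pose b' : 'rV[R]_m := \row_j b ord0 (lift ord0 j).
rewrite (_ : _ @^-1` _ =
    `]a ord0 ord0, b ord0 ord0[%classic `*` box a' b'); last first.
  apply/seteqP; split => [[t x] /= tx|[t x] /= [t_ x_] i].
    split => [|j]; first by have := tx ord0; rewrite mxE unlift_none in_itv.
    by have := tx (lift ord0 j); rewrite !mxE liftK.
  case: (unliftP ord0 i) => [j ->|->]; last by rewrite mxE unlift_none.
  by have := x_ j; rewrite !mxE liftK.
rewrite product_measure1E//; last exact: measurable_box.
rewrite IH; last by move=> i; rewrite !mxE.
rewrite big_ord_recl EFinM; congr (_ * _)%E; last first.
  by congr EFin; apply: eq_bigr => i _; rewrite !mxE.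
have /= -> := lebesgue_measure_itv `]a ord0 ord0, b ord0 ord0[.
rewrite lte_fin; case: ltP => // ba.
by have /eqP -> : b ord0 ord0 == a ord0 ord0; rewrite ?subrr// eq_le ba ab.
Qed.

Definition cbox m (a b : 'rV[R]_m) : set 'rV[R]_m :=
  [set x | forall i, a ord0 i <= x ord0 i <= b ord0 i].

Lemma sub_box_cbox m (a b : 'rV[R]_m) : box a b `<=` cbox a b.
Proof. by move=> x xab i; have /andP[/ltW -> /ltW ->] := xab i. Qed.

Lemma box_setI m (a b c d : 'rV[R]_m) : exists p q,
  [/\ box a b `&` box c d = box p q,
      cbox p q `<=` cbox a b & cbox p q `<=` cbox c d].
Proof.
exists (\row_i Num.max (a ord0 i) (c ord0 i)), (\row_i Num.min (b ord0 i) (d ord0 i)).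
split.
- apply/seteqP; split => [x [xab xcd] i|x xpq].
    have /andP[h1 h2] := xab i; have /andP[h3 h4] := xcd i.
    by rewrite !mxE gt_max lt_min h1 h2 h3 h4.
  by split => i; have := xpq i; rewrite !mxE gt_max lt_min;
    move=> /andP[/andP[h1 h2] /andP[h3 h4]]; rewrite ?h1 ?h2 ?h3 ?h4.
- move=> x xpq i; have := xpq i; rewrite !mxE ge_max le_min.
  by move=> /andP[/andP[h1 _] /andP[h2 _]]; rewrite h1 h2.
- move=> x xpq i; have := xpq i; rewrite !mxE ge_max le_min.
  by move=> /andP[/andP[_ h1] /andP[_ h2]]; rewrite h1 h2.
Qed.

Lemma boxes_setI m : setI_closed (boxes m).
Proof.
move=> _ _ [a [b ->]] [c [d ->]]; have [p [q [-> _ _]]] := box_setI a b c d.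
by exists p, q.
Qed.

Definition cube m (r : R) : set 'rV[R]_m := box (const_mx (- r)) (const_mx r).

Arguments cube m r : clear implicits.

Lemma cubeP m (r : R) (x : 'rV[R]_m) : 0 < r -> cube m r x <-> `|x| < r.
Proof.
move=> r0; split => [xr|xr i].
  by apply: norm_lt_coord => // i; have := xr i; rewrite !mxE ltr_norml.
by rewrite !mxE -ltr_norml; exact: le_lt_trans (coord_le_norm _ _) xr.
Qed.

Lemma bigcup_cube m : \bigcup_k cube m k.+1%:R = setT.
Proof.
apply/seteqP; split => // x _; exists (Num.truncn `|x|) => //.
by apply/cubeP => //; rewrite truncnS_gt.
Qed.

(** A slab in one coordinate is the union of the boxes cut out of it by growing
    cubes. *)
Lemma boxes_gen m : <<s (boxes m) >> = @measurable _ 'rV[R]_m.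
Proof.
apply/seteqP; split => A.
  apply: smallest_sub; first exact: sigma_algebra_measurable.
  by move=> _ [a [b ->]]; exact: measurable_box.
apply: smallest_sub; first exact: smallest_sigma_algebra.
move=> _ [i [B mB ->]].
have : measurable_fun [set: g_sigma_algebraType (boxes m)]
    (fun x : g_sigma_algebraType (boxes m) =>
       (x : 'rV[R]_m) ord0 i : measurableTypeR R).
  apply: (measurability _ (RGenOpens.measurableE R)).
  move=> _ [_ [u [v ->]] <-]; rewrite setTI.
  rewrite (_ : _ @^-1` _ = \bigcup_k
     box (\row_j if j == i then u else - k.+1%:R : R)
         (\row_j if j == i then v else k.+1%:R : R)).
    apply: bigcupT_measurable => k; apply: sub_sigma_algebra.
    by do 2 eexists; reflexivity.
  apply/seteqP; split => x /=; last first.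
    by move=> [k _ /(_ i)]; rewrite !mxE eqxx in_itv.
  rewrite in_itv /= => xuv.
  have : setT x by []. rewrite -(bigcup_cube m) => -[k _ xk].
  by exists k => // j; rewrite !mxE; case: eqP => [->//|_]; have := xk j; rewrite !mxE.
by move=> /(_ measurableT B mB); rewrite setTI.
Qed.

(** The closed boxes fit in [U] as well, so that test functions on [U] can be
    built over each box; rational corners make the family countable. *)
Lemma open_bigcup_box m (U : set 'rV[R]_m) : open U ->
  exists a b : nat -> 'rV[R]_m, exists2 P : set nat,
    (forall k, P k -> cbox (a k) (b k) `<=` U) &
    U = \bigcup_(k in P) box (a k) (b k).
Proof.
move=> oU.
pose idx k : {ffun 'I_m -> rat * rat} := odflt [ffun=> (0, 0)] (unpickle k).
pose a k : 'rV[R]_m := \row_i ratr (idx k i).1.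
pose b k : 'rV[R]_m := \row_i ratr (idx k i).2.
exists a, b, [set k | cbox (a k) (b k) `<=` U] => //.
apply/seteqP; split => [x Ux|x [k /= kU /sub_box_cbox /kU//]].
have /nbhs_rowP[e e0 eU] : nbhs x U by exact: open_nbhs_nbhs.
have ex i : exists p : rat * rat,
    x ord0 i - e < ratr p.1 < x ord0 i /\ x ord0 i < ratr p.2 < x ord0 i + e.
  have [] := @rat_in_itvoo R (x ord0 i - e) (x ord0 i); first by rewrite ltrBlDr ltrDl.
  move=> p; rewrite in_itv /= => pe.
  have [] := @rat_in_itvoo R (x ord0 i) (x ord0 i + e); first by rewrite ltrDl.
  by move=> q; rewrite in_itv /= => qe; exists (p, q).
have [q qP] := choice ex.
have idxE : idx (pickle (finfun q)) = finfun q by rewrite /idx pickleK.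
exists (pickle (finfun q)) => [y yq|i].
  apply: eU; apply: norm_lt_coord => // i; rewrite !mxE ltr_norml.
  have := yq i; rewrite !mxE idxE !ffunE.
  have [/andP[h1 h2] /andP[h3 h4]] := qP i.
  by move=> /andP[h5 h6]; apply/andP; split; lra.
rewrite !mxE idxE !ffunE.
by have [/andP[_ h2] /andP[h3 _]] := qP i; rewrite h2 h3.
Qed.

Lemma open_row_measurable m (U : set 'rV[R]_m) : open U -> measurable U.
Proof.
move=> /open_bigcup_box[a [b [P _ ->]]].
by apply: bigcup_measurable => k _; exact: measurable_box.
Qed.

Lemma closed_row_measurable m (U : set 'rV[R]_m) : closed U -> measurable U.
Proof.
move=> cU; rewrite -(setCK U); apply: measurableC; apply: open_row_measurable.
exact: closed_openC.
Qed.

Lemma lebesgue_row_cube_fin m r : (lebesgue_row R m (cube m r) < +oo)%E.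
Proof.
have [r0|r0] := leP r 0; last first.
  by rewrite lebesgue_row_box ?ltry// => i; rewrite !mxE; lra.
apply: (@le_lt_trans _ _ (lebesgue_row R m (cube m 1))).
  apply: le_measure; rewrite ?inE; try exact: measurable_box.
  by move=> x xr i; have := xr i; rewrite !mxE; lra.
by rewrite lebesgue_row_box ?ltry// => i; rewrite !mxE; lra.
Qed.

Lemma lebesgue_row_unique m (m1 m2 : {measure set 'rV[R]_m -> \bar R}) :
  (forall a b, m1 (box a b) = m2 (box a b)) ->
  (forall r, (m1 (cube m r) < +oo)%E) ->
  forall A, measurable A -> m1 A = m2 A.
Proof.
move=> m12 m1oo; apply: (measure_unique (boxes m) (fun k => cube m k.+1%:R)) => //.
- by rewrite boxes_gen.
- exact: boxes_setI.
- by move=> k; do 2 eexists; reflexivity.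
- exact: bigcup_cube.
- by move=> _ [a [b ->]].
Qed.

Lemma measurable_row_fun d (T : measurableType d) m (f : T -> 'rV[R]_m) :
  (forall i, measurable_fun setT (fun x => f x ord0 i)) ->
  measurable_fun setT f.
Proof.
move=> mf; apply: (measurability (@row_cylinders R m)) => //.
move=> _ [_ [i [B mB ->]] <-]; rewrite setTI.
by rewrite -[X in measurable X]setTI; exact: mf.
Qed.

Lemma measurable_translate m (c : 'rV[R]_m) :
  measurable_fun setT (fun x : 'rV[R]_m => x + c).
Proof.
apply: measurable_row_fun => i.
rewrite (_ : (fun x : 'rV[R]_m => _) = (fun x => x ord0 i + c ord0 i)).
  by apply: measurable_funD => //; exact: measurable_row_coord.
by apply/funext => x; rewrite mxE.
Qed.

(** Translation maps boxes to boxes of the same volume, and a measure is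
    determined by its values on boxes. *)
Lemma lebesgue_row_translate m (c : 'rV[R]_m) A : measurable A ->
  lebesgue_row R m ((fun x => x + c) @^-1` A) = lebesgue_row R m A.
Proof.
move=> mA.
pose tr : {mfun 'rV[R]_m >-> 'rV[R]_m} :=
  HB.pack (fun x : 'rV[R]_m => x + c)
    (isMeasurableFun.Build _ _ _ _ (fun x : 'rV[R]_m => x + c) (measurable_translate c)).
have box_tr a b : tr @^-1` box a b = box (a - c) (b - c).
  by apply/seteqP; split => x /= xab i; have := xab i; rewrite !mxE; lra.
have mu_tr a b : pushforward (lebesgue_row R m) tr (box a b) = lebesgue_row R m (box a b).
  rewrite /pushforward box_tr.
  have [ab|] := boolP [forall i, a ord0 i <= b ord0 i].
    have {}ab i : a ord0 i <= b ord0 i := forallP ab i.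
    rewrite !lebesgue_row_box// => [|i]; last by rewrite !mxE lerD2r.
    by congr EFin; apply: eq_bigr => i _; rewrite !mxE; ring.
  move=> /forallPn[i]; rewrite -ltNge => ba.
  by rewrite (box_empty (i := i)) ?(box_empty (a := a) (b := b) (i := i)) ?mxE ?lerD2r ?ltW.
apply: (@lebesgue_row_unique m (pushforward (lebesgue_row R m) tr)
   (lebesgue_row R m)) => // r.
rewrite /cube [X in (X < _)%E]mu_tr; exact: lebesgue_row_cube_fin.
Qed.

End boxes.

Arguments cube {R} m r _.
Arguments boxes {R} m _.

(** Negative powers of a coordinate are integrable as long as they decay slower
    than the inverse: on the dyadic layer of height [Y * 2^-k] the integral is
    at most a constant times [(2^-k) `^ b]. *)
Lemma integral_powR_coord_fin (R : realType) m (i : 'I_m) (b Y r : R)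
    (D : set 'rV[R]_m) :
  0 < b -> 0 < Y -> 0 < r -> measurable D -> D `<=` cube m r ->
  (forall x, D x -> 0 < x ord0 i < Y) ->
  (\int[lebesgue_row R m]_(x in D) (`|x ord0 i| `^ (b - 1))%:E < +oo)%E.
Proof.
move=> b0 Y0 r0 mD Dr DY.
pose F k := D `&` [set x : 'rV[R]_m | Y * 2^-1 ^+ k.+1 <= x ord0 i < Y * 2^-1 ^+ k].
have half_gt0 k : 0 < 2^-1 ^+ k :> R by rewrite exprn_gt0.
have half_ge k l : (k <= l)%N -> 2^-1 ^+ l <= 2^-1 ^+ k :> R.
  by move=> kl; rewrite ler_wiXn2l//; lra.
have mf : measurable_fun setT (fun x : 'rV[R]_m => (`|x ord0 i| `^ (b - 1))%:E).
  apply/measurable_EFinP.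
  apply: (measurableT_comp (measurable_powR _)).
  by apply: measurableT_comp => //; exact: measurable_row_coord.
have mF k : measurable (F k).
  apply: measurableI => //.
  rewrite (_ : [set _ | _] =
    (fun x : 'rV[R]_m => x ord0 i) @^-1` `[Y * 2^-1 ^+ k.+1, Y * 2^-1 ^+ k[%classic).
    by rewrite -[X in measurable X]setTI; exact: measurable_row_coord.
  by apply/seteqP; split => x; rewrite /= in_itv.
have -> : D = \bigcup_k F k.
  apply/seteqP; split => [x Dx|x [k _ []]//].
  have /andP[x0 xY] := DY _ Dx.
  have ex : exists k, Y * 2^-1 ^+ k.+1 <= x ord0 i.
    exists (Num.truncn (Y / x ord0 i)).
    set k := Num.truncn _.
    rewrite exprVn ler_pdivrMr ?exprn_gt0// mulrC -ler_pdivrMr//.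
    apply: ltW; apply: lt_le_trans (truncnS_gt _) _.
    by rewrite -natrX ler_nat ltnW// ltn_expl.
  case: (ex_minnP ex) => k kx kmin; exists k => //; split => //=.
  rewrite kx /=; case: k kx kmin => [|k] _ kmin; first by rewrite expr0 mulr1.
  by rewrite ltNge; apply/negP => /kmin; rewrite ltnn.
(* C is the area of the cross section of the cube *)
pose C : R := \prod_(j | j != i) (r - (- r)).
have muF k : (lebesgue_row R m (F k) <= (C * (Y * 2^-1 ^+ k))%:E)%E.
  pose a : 'rV[R]_m := \row_j if j == i then 0 else - r.
  pose c : 'rV[R]_m := \row_j if j == i then Y * 2^-1 ^+ k else r.
  apply: (@le_trans _ _ (lebesgue_row R m (box a c))).
    apply: le_measure; rewrite ?inE//; first exact: measurable_box.
    move=> x [Dx /andP[_ xk]] j; rewrite !mxE; case: eqP => [->|_].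
      by rewrite xk andbT; have /andP[] := DY _ Dx.
    by have := Dr _ Dx j; rewrite !mxE.
  rewrite lebesgue_row_box; last first.
    by move=> j; rewrite !mxE; case: eqP => _; [rewrite mulr_ge0// ltW|lra].
  rewrite (bigD1 i)//= !mxE eqxx subr0 mulrC lee_fin.
  rewrite le_eqVlt; apply/orP; left; apply/eqP; congr (_ * _).
  by apply: eq_bigr => j ji; rewrite !mxE (negbTE ji).
have C0 : 0 <= C by apply: prodr_ge0 => j _; lra.
pose q : R := 2^-1 `^ b.
have q0 : 0 <= q by exact: powR_ge0.
have q1 : q < 1.
  suff : q < 1 `^ b by rewrite powR1.
  by apply: gt0_ltr_powR; rewrite ?nnegrE//; lra.
pose B := 2 * C * Y `^ b.
have B0 : 0 <= B by rewrite !mulr_ge0 ?powR_ge0.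
(* x `^ (b - 1) = x `^ b / x: bound the numerator from the top of the layer
   and the denominator from its bottom *)
have intF k : (\int[lebesgue_row R m]_(x in F k) (`|x ord0 i| `^ (b - 1))%:E
    <= (B * q ^+ k)%:E)%E.
  have yk0 : 0 < Y * 2^-1 ^+ k by rewrite mulr_gt0.
  have yk1 : 0 < Y * 2^-1 ^+ k.+1 by rewrite mulr_gt0.
  apply: (@le_trans _ _ (\int[lebesgue_row R m]_(x in F k)
     cst (((Y * 2^-1 ^+ k) `^ b / (Y * 2^-1 ^+ k.+1))%:E) x)%E).
    apply: ge0_le_integral => //.
    - exact: measurable_funTS.
    move=> x [Dx /= /andP[xk1 xk]]; rewrite lee_fin.
    have x0 := lt_le_trans yk1 xk1.
    rewrite gtr0_norm//.
    have -> : x ord0 i `^ (b - 1) = x ord0 i `^ b / x ord0 i.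
      by rewrite powRB ?powRr1 ?ltW// [x ord0 i == 0]gt_eqF// implybT.
    apply: ler_pM; rewrite ?powR_ge0 ?invr_ge0 ?(ltW x0)//.
      by rewrite ltW// gt0_ltr_powR// nnegrE ltW.
    by rewrite lef_pV2 ?posrE.
  rewrite integral_cst//.
  apply: (@le_trans _ _ (((Y * 2^-1 ^+ k) `^ b / (Y * 2^-1 ^+ k.+1))%:E *
     (C * (Y * 2^-1 ^+ k))%:E)%E).
    apply: lee_wpmul2l; last exact: muF.
    by rewrite lee_fin divr_ge0 ?powR_ge0// ltW.
  rewrite -EFinM lee_fin powRM; [|exact: ltW|exact: ltW].
  rewrite (_ : (2^-1 ^+ k) `^ b = q ^+ k); last first.
    by rewrite -powR_mulrn// -powRrM mulrC powRrM powR_mulrn.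
  rewrite /B exprS.
  have h0 := half_gt0 k.
  by rewrite le_eqVlt; apply/orP; left; apply/eqP; field; rewrite ?gt_eqF.
rewrite ge0_integral_bigcup//.
- apply: (@le_lt_trans _ _ (B / (1 - q))%:E); last exact: ltry.
  apply: lime_le.
    apply: is_cvg_nneseries => k _ _; apply: integral_ge0 => x _.
    by rewrite lee_fin powR_ge0.
  apply: nearW => n /=.
  apply: (@le_trans _ _ (\sum_(0 <= k < n) (B * q ^+ k)%:E)%E); first exact: lee_sum.
  rewrite sumEFin lee_fin big_mkord -mulr_sumr ler_pdivlMr; last lra.
  rewrite -mulrA ler_piMr//.
  have := subrX1 q n; have : 0 <= q ^+ n by rewrite exprn_ge0.
  lra.
- exact: measurable_funTS.
apply/trivIsetP => k l _ _ klN; wlog kl : k l klN / (k < l)%N => [H|].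
  have : (k < l)%N || (l < k)%N by rewrite -neq_ltn.
  by case/orP => ?; [|rewrite setIC]; apply: H; rewrite // eq_sym.
apply/seteqP; split => // x [[_ /= /andP[xk _]] [_ /= /andP[_ xl]]].
have := half_ge _ _ kl; rewrite -(ler_pM2l Y0); lra.
Qed.

(** * Functions with second order expansions *)

Section calculus.
Context {R : realType} {m : nat}.
Implicit Types (x h a : 'rV[R]_m) (f g : 'rV[R]_m -> R).

Lemma dotvDr a x h : dotv a (x + h) = dotv a x + dotv a h.
Proof. by rewrite -big_split; apply: eq_bigr => i _; rewrite mxE mulrDr. Qed.

Lemma dotvDl a x h : dotv (a + x) h = dotv a h + dotv x h.
Proof. by rewrite -big_split; apply: eq_bigr => i _; rewrite mxE mulrDl. Qed.

Lemma dotvZr a x (c : R) : dotv a (c *: x) = c * dotv a x.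
Proof. by rewrite mulr_sumr; apply: eq_bigr => i _; rewrite mxE mulrCA. Qed.

Lemma dotvZl a x (c : R) : dotv (c *: a) x = c * dotv a x.
Proof. by rewrite mulr_sumr; apply: eq_bigr => i _; rewrite mxE mulrA. Qed.

Lemma dotvC a x : dotv a x = dotv x a.
Proof. by apply: eq_bigr => i _; rewrite mulrC. Qed.

Lemma dotv_delta a i : dotv a (delta_mx ord0 i) = a ord0 i.
Proof.
rewrite /dotv (bigD1 i)//= big1 ?addr0 => [|j ji]; rewrite mxE ?eqxx ?mulr1//.
by rewrite (negbTE ji) andbF mulr0.
Qed.

Lemma dotv_ge0 a : 0 <= dotv a a.
Proof. by apply: sumr_ge0 => i _; rewrite -expr2 sqr_ge0. Qed.

Definition norm1 a : R := \sum_i `|a ord0 i|.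

Lemma norm1_ge0 a : 0 <= norm1 a. Proof. exact: sumr_ge0. Qed.

Lemma dotv_le a h : `|dotv a h| <= norm1 a * `|h|.
Proof.
apply: le_trans (ler_norm_sum _ _ _) _; rewrite mulr_suml.
apply: ler_sum => i _; rewrite normrM ler_wpM2l//; exact: coord_le_norm.
Qed.

(** The quadratic remainder, rather than a little-o, keeps the expansions
    stable under products and makes every limit below a squeeze. *)
Definition has_grad f x a : Prop :=
  exists2 C : R, 0 <= C &
    forall h, `|h| <= 1 -> `|f (x + h) - f x - dotv a h| <= C * `|h| ^+ 2.

Lemma has_grad_cst (c : R) x : has_grad (fun=> c) x 0.
Proof.
exists 0 => // h _; rewrite subrr sub0r mul0r normrN /dotv big1 ?normr0//.
by move=> i _; rewrite mxE mul0r.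
Qed.

Lemma has_grad_coord i x : has_grad (fun x => x ord0 i) x (delta_mx ord0 i).
Proof.
exists 0 => // h _; rewrite mul0r dotvC dotv_delta mxE.
by rewrite (_ : _ - _ = 0) ?normr0//; ring.
Qed.

Lemma has_gradD f g x a b : has_grad f x a -> has_grad g x b ->
  has_grad (fun y => f y + g y) x (a + b).
Proof.
move=> [C C0 fC] [D D0 gD]; exists (C + D); first exact: addr_ge0.
move=> h h1; rewrite dotvDl mulrDl.
apply: le_trans (lerD (fC _ h1) (gD _ h1)).
apply: le_trans (ler_normD _ _); rewrite le_eqVlt; apply/orP; left; apply/eqP.
by congr `|_|; ring.
Qed.

Lemma has_grad_lip f x a : has_grad f x a ->
  exists2 C : R, 0 <= C & forall h, `|h| <= 1 -> `|f (x + h) - f x| <= C * `|h|.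
Proof.
move=> [C C0 fC]; exists (C + norm1 a); first by rewrite addr_ge0 ?norm1_ge0.
move=> h h1; rewrite (_ : _ - _ = (f (x + h) - f x - dotv a h) + dotv a h); last ring.
apply: le_trans (ler_normD _ _) _; rewrite mulrDl lerD ?dotv_le//.
apply: le_trans (fC _ h1) _; rewrite ler_wpM2l// expr2 ler_piMr//.
Qed.

Lemma has_gradM f g x a b : has_grad f x a -> has_grad g x b ->
  has_grad (fun y => f y * g y) x (g x *: a + f x *: b).
Proof.
move=> fa gb; have [C C0 fC] := fa; have [D D0 gD] := gb.
have [K K0 fK] := has_grad_lip fa; have [L L0 gL] := has_grad_lip gb.
exists (`|g x| * C + `|f x| * D + K * L).
  by rewrite !addr_ge0 ?mulr_ge0.
move=> h h1; rewrite dotvDl !dotvZl.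
rewrite (_ : _ - _ = g x * (f (x + h) - f x - dotv a h) +
  f x * (g (x + h) - g x - dotv b h) + (f (x + h) - f x) * (g (x + h) - g x)); last ring.
rewrite [leRHS]mulrDl [X in _ <= X + _]mulrDl.
apply: le_trans (ler_normD _ _) _; apply: lerD.
  apply: le_trans (ler_normD _ _) _; apply: lerD; rewrite normrM -mulrA ler_wpM2l//.
    exact: fC.
  exact: gD.
rewrite normrM expr2 mulrACA ler_pM//; [exact: fK|exact: gL].
Qed.

Lemma has_grad_cvg f x a v : has_grad f x a ->
  h^-1 *: ((f \o shift x) (h *: v) - f x) @[h --> (0 : R)^'] --> dotv a v.
Proof.
move=> [C C0 fC]; apply/cvgrPdist_le => e e0.
have d0 : 0 < (`|v| + 1)^-1 by rewrite invr_gt0 ltr_wpDl.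
have d1 : 0 < e / ((C + 1) * (`|v| + 1) ^+ 2).
  by rewrite divr_gt0// mulr_gt0// ?exprn_gt0// ltr_wpDl.
near=> h.
have h0 : h != 0 by near: h; exact: nbhs_dnbhs_neq.
have hd0 : `|h| < (`|v| + 1)^-1 by near: h; exact: dnbhs0_lt.
have hd1 : `|h| < e / ((C + 1) * (`|v| + 1) ^+ 2) by near: h; exact: dnbhs0_lt.
have nh0 : 0 < `|h| by rewrite normr_gt0.
have v1 : 0 < `|v| + 1 by rewrite ltr_wpDl.
have hv1 : `|h *: v| <= 1.
  rewrite normrZ; move: hd0; rewrite -[X in _ < X]mul1r ltr_pdivlMr// => hd0.
  by apply: ltW; apply: le_lt_trans hd0; rewrite ler_wpM2l// lerDl.
have := fC _ hv1; rewrite /= /GRing.scale /= [h *: v + x]addrC dotvZr => fh.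
rewrite -(ler_pM2l nh0) -normrM.
rewrite (_ : _ * _ = - (f (x + h *: v) - f x - h * dotv a v)); last by field.
rewrite normrN; apply: le_trans fh _; rewrite normrZ exprMn expr2 -mulrA mulrCA.
rewrite ler_wpM2l// mulrCA.
move: hd1; rewrite ltr_pdivlMr; last by rewrite mulr_gt0 ?exprn_gt0// ltr_wpDl.
move=> hd1; apply: ltW; apply: le_lt_trans hd1; rewrite ler_wpM2l//.
rewrite ler_pM ?sqr_ge0//; first by rewrite lerDl.
by rewrite ler_pXn2r ?nnegrE ?addr_ge0// lerDl.
Unshelve. all: by end_near. Qed.

Lemma has_grad_derive f x a v : has_grad f x a -> is_derive x v f (dotv a v).
Proof.
move=> fa; have fv := has_grad_cvg (v := v) fa; split.
  by apply/cvg_ex; exists (dotv a v).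
exact: (cvg_lim (@norm_hausdorff _ _) fv).
Qed.

(** Along segments the mean value theorem turns a bound on gradients into a
    Lipschitz bound. *)
Lemma has_grad_MVT f (G : 'rV[R]_m -> 'rV[R]_m) x y :
  (forall z, has_grad f z (G z)) ->
  exists2 t, 0 <= t <= 1 & f y - f x = dotv (G (x + t *: (y - x))) (y - x).
Proof.
move=> fG; pose F (t : R) := f (x + t *: (y - x)).
have dF (t : R) : is_derive t (1 : R) F (dotv (G (x + t *: (y - x))) (y - x)).
  have := has_grad_cvg (v := y - x) (fG (x + t *: (y - x))).
  under eq_fun => h.
    rewrite /= addrCA -scalerDl -[h in (h + t) *: _](@mulr1 R) -/(F _).
    over.
  move=> Fc; split; first by apply/cvg_ex; eexists; exact: Fc.
  exact: (cvg_lim (@norm_hausdorff _ _) Fc).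
have [|t t01] := @MVT R F _ 0 1 ltr01 (fun t _ => dF t).
  by apply: derivable_within_continuous => t _; have [] := dF t.
rewrite subr0 mulr1 /F scale1r scale0r addr0 subrKC => ->.
by exists t => //; move: t01; rewrite in_itv/= => /andP[/ltW -> /ltW ->].
Qed.

End calculus.

(** Uniqueness of the differential identifies any candidate linear part with the
    one that differentiability refers to. *)
Lemma differentiable_expansion (K : realFieldType) (V W : normedModType K)
    (f : V -> W) (x : V) (df : {linear V -> W}) : continuous df ->
  (forall e : K, 0 < e -> \forall h \near (0 : V),
    `|f (x + h) - f x - df h| <= e * `|h|) ->
  differentiable f x.
Proof.
move=> cdf fe.
have fo : f \o shift x = cst (f x) + df +o_ (0 : V) id.
  apply/eqaddoP => e e0; apply: filterS (fe _ e0) => h.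
  suff <- : f (x + h) - f x - df h = (f \o shift x - (cst (f x) + df)) h by [].
  by rewrite -addrA -opprD [x + h]addrC.
by apply/diff_locallyP; rewrite (diff_unique cdf fo).
Qed.

Section smooth.
Context {R : realType} {m : nat}.
Implicit Types (x h a : 'rV[R]_m) (f g : 'rV[R]_m -> R).

Lemma has_grad_near f x a (e : R) : has_grad f x a -> 0 < e ->
  \forall h \near (0 : 'rV[R]_m), `|f (x + h) - f x - dotv a h| <= e * `|h|.
Proof.
move=> [C C0 fC] e0; apply/nbhs_rowP.
exists (Num.min (1 : R) (e / (C + 1))).
  by rewrite lt_min ltr01 divr_gt0// ltr_wpDl.
move=> h; rewrite subr0 lt_min => /andP[/ltW h1].
rewrite ltr_pdivlMr ?ltr_wpDl// => he.
apply: le_trans (fC _ h1) _; rewrite expr2 mulrA ler_wpM2r//.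
by apply: le_trans (ltW he); rewrite mulrC ler_wpM2l// lerDl.
Qed.

Lemma has_grad_continuous f x a : has_grad f x a -> {for x, continuous f}.
Proof.
move=> /has_grad_lip[C C0 fC]; rewrite /prop_for /continuous_at.
apply/(@cvgrPdist_le _ _ _ (nbhs x) _ f (f x)) => e e0; apply/nbhs_rowP.
exists (Num.min (1 : R) (e / (C + 1))).
  by rewrite lt_min ltr01 divr_gt0// ltr_wpDl.
move=> y; rewrite lt_min => /andP[/ltW y1].
rewrite ltr_pdivlMr ?ltr_wpDl// => ye.
have := fC _ y1; rewrite subrKC distrC => /le_trans; apply.
by apply: le_trans (ltW ye); rewrite mulrC ler_wpM2l// lerDl.
Qed.

Lemma has_grad_differentiable f x a : has_grad f x a -> differentiable f x.
Proof.
move=> fa.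
pose W : normedModType R := R.
have lin : linear (dotv a : 'rV[R]_m -> W).
  by move=> c u v; rewrite dotvDr dotvZr.
pose df : {linear 'rV[R]_m -> W} :=
  HB.pack (dotv a : 'rV[R]_m -> W) (GRing.isLinear.Build _ _ _ _ _ lin).
have cdf : continuous df.
  move=> y; apply/(@cvgrPdist_le _ _ _ (nbhs y) _ df (df y)) => e e0; apply/nbhs_rowP.
  have n1 : 0 < norm1 a + 1 by rewrite ltr_wpDl// norm1_ge0.
  exists (e / (norm1 a + 1)); first by rewrite divr_gt0.
  move=> z; rewrite ltr_pdivlMr// => zy.
  rewrite -(linearB df) /=; apply: le_trans (dotv_le _ _) _.
  apply: le_trans (ltW zy); rewrite distrC mulrC ler_wpM2l// lerDl//.
apply: (@differentiable_expansion R _ W f x df cdf) => e e0.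
exact: has_grad_near.
Qed.

(** A class that contains the polynomials and enough cut-off functions, and in
    which continuity, Lipschitz bounds and limits of difference quotients are all
    read off explicit estimates. *)
Definition smooth f := exists G : 'rV[R]_m -> 'rV[R]_m,
  (forall x, has_grad f x (G x)) /\ forall i, continuous (fun x => G x ord0 i).

Lemma smooth_continuous f : smooth f -> continuous f.
Proof. by move=> [G [fG _]] x; exact: has_grad_continuous (fG x). Qed.

Lemma smooth_cst (c : R) : smooth (fun=> c).
Proof.
exists (fun=> 0); split=> [x|i]; first exact: has_grad_cst.
by move=> x; exact: cst_continuous.
Qed.

Lemma smooth_coord i : smooth (fun x => x ord0 i).
Proof.
exists (fun=> delta_mx ord0 i); split=> [x|j]; first exact: has_grad_coord.
by move=> x; exact: cst_continuous.
Qed.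

Lemma smoothD f g : smooth f -> smooth g -> smooth (fun x => f x + g x).
Proof.
move=> [F [fF Fc]] [G [gG Gc]]; exists (fun x => F x + G x); split=> [x|i].
  exact: has_gradD.
rewrite (_ : (fun x => _) = (fun x => F x ord0 i + G x ord0 i)).
  by move=> x; exact: (cvgD (Fc i x) (Gc i x)).
by apply/funext => x; rewrite mxE.
Qed.

Lemma smoothM f g : smooth f -> smooth g -> smooth (fun x => f x * g x).
Proof.
move=> fs gs; have [F [fF Fc]] := fs; have [G [gG Gc]] := gs.
exists (fun x => g x *: F x + f x *: G x); split=> [x|i].
  exact: has_gradM.
rewrite (_ : (fun x => _) = (fun x => g x * F x ord0 i + f x * G x ord0 i)).
  move=> x; have fc := @smooth_continuous _ fs x; have gc := @smooth_continuous _ gs x.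
  exact: (cvgD (cvgM gc (Fc i x)) (cvgM fc (Gc i x))).
by apply/funext => x; rewrite !mxE.
Qed.

Lemma smoothN f : smooth f -> smooth (fun x => - f x).
Proof.
move=> fs; under eq_fun do rewrite -mulN1r.
by apply: smoothM => //; exact: smooth_cst.
Qed.

Lemma smoothB f g : smooth f -> smooth g -> smooth (fun x => f x - g x).
Proof. by move=> fs gs; apply: smoothD => //; exact: smoothN. Qed.

Lemma smoothX f k : smooth f -> smooth (fun x => f x ^+ k).
Proof.
move=> fs; elim: k => [|k IH]; first by under eq_fun do rewrite expr0; exact: smooth_cst.
by under eq_fun do rewrite exprS; exact: smoothM.
Qed.

Lemma smooth_sum (I : Type) (r : seq I) (P : pred I) (F : I -> 'rV[R]_m -> R) :
  (forall i, smooth (F i)) -> smooth (fun x => \sum_(i <- r | P i) F i x).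
Proof.
move=> Fs; elim: r => [|i r IH].
  by under eq_fun do rewrite big_nil; exact: smooth_cst.
under eq_fun do rewrite big_cons.
by case: (P i) => //; exact: smoothD.
Qed.

Lemma smooth_prod (I : Type) (r : seq I) (P : pred I) (F : I -> 'rV[R]_m -> R) :
  (forall i, smooth (F i)) -> smooth (fun x => \prod_(i <- r | P i) F i x).
Proof.
move=> Fs; elim: r => [|i r IH].
  by under eq_fun do rewrite big_nil; exact: smooth_cst.
under eq_fun do rewrite big_cons.
by case: (P i) => //; exact: smoothM.
Qed.

Lemma pos_sqr_expansion (u k : R) :
  `|Num.max 0 (u + k) ^+ 2 - Num.max 0 u ^+ 2 - 2 * Num.max 0 u * k| <= k ^+ 2.
Proof.
rewrite ler_norml.
by case: (lerP 0 (u + k)) => ?; case: (lerP 0 u) => ?; apply/andP; split; nra.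
Qed.

(** Squares of positive parts are the cheapest cut-offs: they vanish on a half
    line and keep a quadratic remainder. *)
Lemma smooth_pos_sqr f : smooth f -> smooth (fun x => Num.max 0 (f x) ^+ 2).
Proof.
move=> fs; have [G [fG Gc]] := fs.
have mc x : {for x, continuous (fun x => Num.max 0 (f x))}.
  by apply: continuous_max; [exact: cst_continuous|exact: (@smooth_continuous _ fs x)].
exists (fun x => (2 * Num.max 0 (f x)) *: G x); split=> [x|i]; last first.
  rewrite (_ : (fun x => _) = (fun x => 2 * Num.max 0 (f x) * G x ord0 i)).
    move=> x; exact: (cvgM (cvgM (cvg_cst _) (mc x)) (Gc i x)).
  by apply/funext => x; rewrite mxE.
have [C C0 fC] := fG x; have [K K0 fK] := has_grad_lip (fG x).
have M0 : 0 <= 2 * Num.max 0 (f x) by rewrite mulr_ge0// le_max lexx.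
exists (K ^+ 2 + 2 * Num.max 0 (f x) * C); first by rewrite addr_ge0 ?sqr_ge0// mulr_ge0.
move=> h h1; set k := f (x + h) - f x.
have -> : f (x + h) = f x + k by rewrite /k subrKC.
rewrite dotvZl; set M := 2 * _.
rewrite (_ : _ - _ = (Num.max 0 (f x + k) ^+ 2 - Num.max 0 (f x) ^+ 2 - M * k) +
  M * (k - dotv (G x) h)); last ring.
apply: le_trans (ler_normD _ _) _; rewrite mulrDl; apply: lerD.
  apply: le_trans (pos_sqr_expansion _ _) _; rewrite -exprMn -real_normK ?num_real//.
  by rewrite ler_pXn2r ?nnegrE ?mulr_ge0//; exact: fK.
by rewrite normrM (ger0_norm M0) -(mulrA M) ler_wpM2l//; exact: fC.
Qed.

Lemma smooth_partial f i : smooth f -> continuous (partial f i).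
Proof.
move=> [G [fG Gc]]; rewrite (_ : partial f i = fun x => G x ord0 i); first exact: Gc.
apply/funext => x; have [_] := has_grad_derive (delta_mx ord0 i) (fG x).
by rewrite dotv_delta.
Qed.

Lemma smooth_differentiable f x : smooth f -> differentiable f x.
Proof. by move=> [G [fG _]]; exact: has_grad_differentiable (fG x). Qed.

(** On a compact ball the gradient is bounded, and a ball contains the segments
    along which the mean value theorem is applied. *)
Lemma smooth_lipschitz f r : smooth f ->
  exists2 L : R, 0 <= L & forall x y, `|x| <= r -> `|y| <= r ->
    `|f y - f x| <= L * `|y - x|.
Proof.
move=> [G [fG Gc]].
have Bc : compact [set x : 'rV[R]_m | `|x| <= r].
  apply: bounded_closed_compact.
    by exists r; split; [exact: num_real|move=> M rM x /le_trans; apply; exact: ltW].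
  apply: (preimage_closed _ (@closed_le R r)) => x _; exact: norm_continuous.
have [r0|r0] := ltP r 0.
  by exists 0 => // x y /(le_trans (normr_ge0 x)); rewrite leNgt r0.
have nc : continuous (fun x => norm1 (G x)).
  apply: continuous_big => [|i _ x]; first exact: add_continuous.
  by apply: continuous_comp; [exact: Gc|exact: norm_continuous].
have [||z _ zmax] := @compact_EVT_max _ R (fun x => norm1 (G x)) _ _ Bc.
- by exists 0; rewrite /= normr0.
- by apply: continuous_subspaceT.
exists (norm1 (G z)); first exact: norm1_ge0.
move=> x y xr yr; have [t /andP[t0 t1] ->] := has_grad_MVT x y fG.
apply: le_trans (dotv_le _ _) _; rewrite ler_wpM2r//; apply: zmax.
rewrite inE /= (_ : x + _ = (1 - t) *: x + t *: y); last first.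
  by rewrite scalerBl scale1r scalerBr -addrA; congr (_ + _); rewrite addrC.
apply: le_trans (ler_normD _ _) _; rewrite !normrZ.
rewrite (ger0_norm t0) ger0_norm ?subr_ge0//.
rewrite (_ : r = (1 - t) * r + t * r); last ring.
by rewrite lerD// ler_wpM2l ?subr_ge0.
Qed.

End smooth.

(** * Uniqueness of weak derivatives *)

Section uniqueness.
Context {R : realType} {m : nat}.
Local Notation mu := (lebesgue_row R m).
Implicit Types (D : set 'rV[R]_m) (w g f : 'rV[R]_m -> R) (a b : 'rV[R]_m).

Lemma cbox_compact a b : compact (cbox a b).
Proof.
have := @rV_compact R m (fun i => `[a ord0 i, b ord0 i]%classic)
  (fun i => @segment_compact R _ _).
by congr compact; apply/seteqP; split => x /= xab i; have := xab i; rewrite /= in_itv.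
Qed.

Lemma compact_row_closed (K : set 'rV[R]_m) : compact K -> closed K.
Proof. by apply: compact_closed; exact: norm_hausdorff. Qed.

Lemma compact_row_measurable (K : set 'rV[R]_m) : compact K -> measurable K.
Proof. by move=> /compact_row_closed; exact: closed_row_measurable. Qed.

Lemma continuous_row_measurable f : continuous f -> measurable_fun setT f.
Proof.
move=> fc; apply: (measurability _ (RGenOInfty.measurableE R)).
move=> _ [_ [x ->] <-]; rewrite setTI; apply: open_row_measurable.
by move/continuousP : fc; apply; rewrite set_itvE; exact: open_gt.
Qed.

(** If [rho] takes values in [[0, 1]] and is positive exactly on the box, then
    [1 - (1 - rho) ^+ k] increases to the indicator of the box. *)
Lemma bump_box a b : (forall i, a ord0 i < b ord0 i) ->
  exists phi : nat -> 'rV[R]_m -> R, [/\ forall k, smooth (phi k),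
    forall k x, `|phi k x| <= 1, forall k x, ~ box a b x -> phi k x = 0 &
    forall x, phi k x @[k --> \oo] --> (\1_(box a b) x : R)].
Proof.
move=> ab.
pose c i : R := (b ord0 i - a ord0 i) ^+ 2.
have c0 i : 0 < c i by rewrite exprn_gt0// subr_gt0.
(* a parabola in the i-th coordinate, positive between the faces and at most 1 *)
pose u i (x : 'rV[R]_m) : R :=
  (x ord0 i - a ord0 i) * (b ord0 i - x ord0 i) / c i.
have u1 i x : u i x <= 1.
  rewrite ler_pdivrMr// mul1r /c.
  have h1 := sqr_ge0 (x ord0 i - a ord0 i + (b ord0 i - x ord0 i) / 2).
  by have h2 := sqr_ge0 (b ord0 i - x ord0 i); nra.
have u_gt0 i x : (0 < u i x) = (a ord0 i < x ord0 i < b ord0 i).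
  rewrite /u pmulr_lgt0 ?invr_gt0//; have abi := ab i.
  apply/idP/idP => [h|/andP[h1 h2]]; last by rewrite mulr_gt0 ?subr_gt0.
  apply/andP; split; rewrite ltNge; apply/negP => h'.
    have := @mulr_ge0 R (a ord0 i - x ord0 i) (b ord0 i - x ord0 i); nra.
  have := @mulr_ge0 R (x ord0 i - a ord0 i) (x ord0 i - b ord0 i); nra.
pose rho x : R := \prod_i Num.max 0 (u i x) ^+ 2.
have v01 i x : 0 <= Num.max 0 (u i x) <= 1.
  by rewrite le_max lexx /= ge_max ler01 u1.
have rho01 x : 0 <= rho x <= 1.
  apply/andP; split; first by apply: prodr_ge0 => i _; rewrite sqr_ge0.
  apply: prodr_ile1 => i _; have /andP[h0 h1] := v01 i x.
  by rewrite exprn_ge0//= exprn_ile1.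
have rho_smooth : smooth rho.
  apply: smooth_prod => i; apply: smooth_pos_sqr; rewrite /u.
  apply: smoothM; last exact: smooth_cst.
  by apply: smoothM; apply: smoothB; by [exact: smooth_coord|exact: smooth_cst].
exists (fun k x => 1 - (1 - rho x) ^+ k); split=> [k|k x|k x xab|x].
- apply: smoothB; first exact: smooth_cst.
  by apply: smoothX; apply: smoothB => //; exact: smooth_cst.
- have /andP[r0 r1] := rho01 x.
  have : 0 <= (1 - rho x) ^+ k <= 1.
    by rewrite exprn_ge0 ?subr_ge0//= exprn_ile1 ?subr_ge0// lerBlDr lerDl.
  by move=> /andP[h0 h1]; rewrite ler_norml; apply/andP; split; lra.
- rewrite (_ : rho x = 0) ?subr0 ?expr1n ?subrr//.
  have /existsNP[i xi] : ~ forall i, a ord0 i < x ord0 i < b ord0 i by [].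
  rewrite /rho (bigD1 i)//= max_l ?expr0n ?mul0r//.
  by rewrite leNgt u_gt0; exact/negP.
- rewrite indicE; have [xab|xab] := asboolP (box a b x).
    rewrite mem_set//= -[X in _ --> X]subr0; apply: cvgB; first exact: cvg_cst.
    apply: cvg_expr; have /andP[r0 r1] := rho01 x.
    rewrite ger0_norm ?subr_ge0// ltrBlDr ltrDl.
    by apply: prodr_gt0 => i _; rewrite exprn_gt0// lt_max u_gt0 xab orbT.
  rewrite memNset//=; under eq_fun => k.
    rewrite (_ : rho x = 0) ?subr0 ?expr1n ?subrr; first over.
    have /existsNP[i xi] : ~ forall i, a ord0 i < x ord0 i < b ord0 i by [].
    rewrite /rho (bigD1 i)//= max_l ?expr0n ?mul0r//.
    by rewrite leNgt u_gt0; exact/negP.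
  exact: cvg_cst.
Qed.

Lemma test_function_measurable D f : test_function D f -> measurable_fun setT f.
Proof.
move=> [df _ _ _]; apply: continuous_row_measurable => x.
exact: differentiable_continuous.
Qed.

Lemma integrable_locally_mul D g f K (C : R) : measurable D ->
  locally_integrable_on D g -> compact K -> K `<=` D° ->
  measurable_fun setT f -> (forall x, `|f x| <= C) -> (forall x, ~ K x -> f x = 0) ->
  mu.-integrable D (fun x => (g x * f x)%:E).
Proof.
move=> mD [mg ig] cK KD mf fC fK.
have mK := compact_row_measurable cK.
have gfK : mu.-integrable K ((EFin \o g) \* (EFin \o f))%E.
  apply: integrableMl => //; first exact: ig.
    exact: measurable_funTS.
  exists C; split; first exact: num_real.
  by move=> M CM x _ /=; apply: le_trans (fC x) (ltW CM).
apply/(integrable_mkcond _ mD).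
move/(integrable_mkcond _ mK) : gfK; apply: eq_integrable => // x _.
rewrite !patchE; case: ifPn => [/set_mem xK|/negP xK].
  by rewrite mem_set//; apply: interior_subset; exact: KD.
case: ifPn => // _; rewrite fK ?mulr0//.
by move=> /mem_set.
Qed.

Lemma closure_supportN0 f x : ~ closure [set x | f x != 0] x -> f x = 0.
Proof. by move=> Kx; case: (eqVneq (f x) 0) => // fx; case: Kx; exact: subset_closure. Qed.

Lemma closure_support_partial0 f i x :
  ~ closure [set x | f x != 0] x -> partial f i x = 0.
Proof.
set K := closure _ => Kx.
have oK : open (~` K) by apply: closed_openC; exact: closed_closure.
have fx : \forall y \near x, f y = 0.
  by apply: filterS (@closure_supportN0 f) _; exact: open_nbhs_nbhs.
rewrite /partial (@near_eq_derive _ _ _ f (fun=> 0) x _ fx).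
exact: derive_cst.
Qed.

Lemma test_function_bounds D f : test_function D f ->
  exists C : R, (forall x, `|f x| <= C) /\ (forall i x, `|partial f i x| <= C).
Proof.
move=> [df pf cK KD]; set K := closure _ in cK KD.
have fN x : ~ K x -> f x = 0 := @closure_supportN0 f x.
have pN i x : ~ K x -> partial f i x = 0 := @closure_support_partial0 f i x.
have bnd (h : 'rV[R]_m -> R) : continuous h -> (forall x, ~ K x -> h x = 0) ->
    exists C : R, 0 <= C /\ forall x, `|h x| <= C.
  move=> hc hN.
  have hK : compact (h @` K).
    by apply: continuous_compact => //; exact: continuous_subspaceT.
  have [M [_ hM]] := compact_bounded hK.
  exists (`|M| + 1); split => [|x]; first by rewrite addr_ge0.
  have [Kx|Kx] := pselect (K x); last by rewrite hN// normr0 addr_ge0.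
  apply: hM; last by exists x.
  by apply: le_lt_trans (ler_norm _) _; rewrite ltrDl.
have [C [C0 fC]] : exists C : R, 0 <= C /\ forall x, `|f x| <= C.
  by apply: bnd => // x; exact: differentiable_continuous.
have [Ci CiP] := choice (fun i => bnd _ (pf i) (pN i)).
exists (C + \sum_i Ci i); split => [x|i x].
  by apply: le_trans (fC x) _; rewrite lerDl; apply: sumr_ge0 => i _; have [] := CiP i.
apply: le_trans (proj2 (CiP i) x) _; rewrite (bigD1 i)//= addrCA lerDl.
by rewrite addr_ge0// sumr_ge0// => j _; have [] := CiP j.
Qed.

End uniqueness.

Section uniqueness_ae.
Context {R : realType} {m : nat}.
Local Notation mu := (lebesgue_row R m).
Implicit Types (D : set 'rV[R]_m) (w g h : 'rV[R]_m -> R) (a b : 'rV[R]_m).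

(** The indicator of the box is a bounded limit of test functions; the closed
    box, a compact subset of the interior, provides the dominating function. *)
Lemma integral_zero_box D h a b : measurable D -> locally_integrable_on D h ->
  (forall phi, test_function D phi -> \int[mu]_(x in D) (h x * phi x) = 0) ->
  cbox a b `<=` D° -> (\int[mu]_(x in box a b) (h x)%:E = 0)%E.
Proof.
move=> mD hloc h0 abD.
have [ab|] := pselect (forall i, a ord0 i < b ord0 i); last first.
  move=> /existsNP[i /negP]; rewrite -leNgt => ba.
  by rewrite (box_empty ba) integral_set0.
have [phi [phis phi1 phiN phicvg]] := bump_box ab.
have mcb : measurable (cbox a b) := compact_row_measurable (@cbox_compact _ _ a b).
have mb := measurable_box a b.
have phiK k x : ~ cbox a b x -> phi k x = 0.
  by move=> xab; apply: phiN => /sub_box_cbox.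
have bD : box a b `<=` D.
  by apply: subset_trans (@interior_subset _ D); apply: subset_trans abD; exact: sub_box_cbox.
have mphi k : measurable_fun setT (phi k).
  by apply: continuous_row_measurable; exact: smooth_continuous.
have iphi k : mu.-integrable D (fun x => (h x * phi k x)%:E).
  by apply: (integrable_locally_mul mD hloc (@cbox_compact _ _ a b) abD (mphi k) (phi1 k) (phiK k)).
have iind : mu.-integrable D (fun x => (h x * \1_(cbox a b) x)%:E).
  apply: (integrable_locally_mul (C := 1) mD hloc (@cbox_compact _ _ a b) abD).
  - exact: measurable_indic.
  - by move=> x; rewrite indicE; case: (x \in _); rewrite ?normr1 ?normr0.
  - by move=> x xab; rewrite indicE memNset.
have phitest k : test_function D (phi k).
  have supp : closure [set x | phi k x != 0] `<=` cbox a b.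
    apply: (@subset_trans _ (closure (cbox a b))).
      apply: closure_subset => x /=; apply: contra_neqP => xab.
      exact: phiK.
    by move=> x; exact: (compact_row_closed (@cbox_compact _ _ a b)).
  split.
  - by move=> x; exact: smooth_differentiable.
  - by move=> i; exact: smooth_partial.
  - apply: (subclosed_compact _ (@cbox_compact _ _ a b)) => //.
    exact: closed_closure.
  - exact: (subset_trans supp abD).
have mh : measurable_fun D h by have [] := hloc.
have [] := @dominated_convergence _ _ _ mu _ mD
  (fun k x => (h x * phi k x)%:E) (fun x => (h x * \1_(box a b) x)%:E)
  (fun x => `|(h x * \1_(cbox a b) x)%:E|)%E.
- by move=> k; apply/measurable_EFinP; apply: measurable_funM => //; exact: measurable_funTS.
- apply/measurable_EFinP; exact: measurable_funM.
- apply: aeW => x _; apply: cvg_EFin; first exact: nearW.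
  by apply: cvgM; [exact: cvg_cst|exact: phicvg].
- exact: integrable_abse.
- apply: aeW => x k _; rewrite lee_fin !normrM ler_wpM2l// indicE.
  have [xab|xab] := asboolP (cbox a b x); last by rewrite phiK// normr0.
  by rewrite mem_set// normr1.
move=> _ _ lim.
have : (\int[mu]_(x in D) (h x * \1_(box a b) x)%:E = 0)%E.
  apply: (cvg_unique _ lim) => //.
  rewrite (_ : [sequence _]_n = fun=> 0%E); first exact: cvg_cst.
  apply/funext => k /=.
  have := h0 _ (phitest k); rewrite /Rintegral => /eqP; rewrite fine_eq0 => [/eqP//|].
  exact: integrable_fin_num.
move=> <-; rewrite [LHS]integral_mkcond [RHS]integral_mkcond.
apply: eq_integral => x _; rewrite !patchE indicE.
case: ifPn => [/set_mem xab|xab]; first by rewrite mem_set ?mulr1//; exact: bD.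
by rewrite mulr0; case: ifPn.
Qed.

(** Since boxes generate the Borel sets, a function whose integral over every
    box vanishes is null: its positive and negative parts are the densities of
    two measures that agree on boxes. *)
Lemma integral_zero_ae (Q : set 'rV[R]_m) h : measurable Q ->
  mu.-integrable Q (EFin \o h) ->
  (forall a b, \int[mu]_(x in box a b `&` Q) (h x)%:E = 0)%E ->
  {ae mu, forall x, Q x -> h x = 0}.
Proof.
move=> mQ ih h0.
pose f := ((EFin \o h) \_ Q).
have fi : mu.-integrable setT f by apply/(integrable_mkcond _ mQ).
have mf : measurable_fun setT f by exact: measurable_int fi.
pose dens (g : 'rV[R]_m -> \bar R) (mg : measurable_fun setT g)
    (g0 : forall x, (0 <= g x)%E) : {measure set 'rV[R]_m -> \bar R} :=
  HB.pack (fun A => (\int[mu]_(x in A) g x)%E) (isMeasure.Build _ _ _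
    (fun A => (\int[mu]_(x in A) g x)%E) (@integral_set0 _ _ _ mu g)
    (fun A => @integral_ge0 _ _ _ mu A g (fun x _ => g0 x))
    (semi_sigma_additive_nng_induced mg g0)).
pose m1 := dens _ (measurable_funepos mf) (funepos_ge0 f).
pose m2 := dens _ (measurable_funeneg mf) (funeneg_ge0 f).
have fiA A : measurable A -> mu.-integrable A f.
  by move=> mA; apply: integrableS fi.
have fE A : measurable A ->
    (\int[mu]_(x in A `&` Q) (h x)%:E = m1 A - m2 A)%E.
  move=> mA; rewrite [RHS](_ : _ = \int[mu]_(x in A) f x)%E; last exact/esym/integralE.
  rewrite [LHS]integral_mkcond [RHS]integral_mkcond; apply: eq_integral => x _.
  by rewrite /f patch_setI.
have fin1 A : measurable A -> (m1 A < +oo)%E.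
  by move=> mA; exact: (integral_funepos_lt_pinfty mA (fiA _ mA)).
have fin2 A : measurable A -> (m2 A < +oo)%E.
  by move=> mA; exact: (integral_funeneg_lt_pinfty mA (fiA _ mA)).
have m12 A : measurable A -> m1 A = m2 A.
  apply: lebesgue_row_unique => [a b|r]; last by apply: fin1; exact: measurable_box.
  have mb := measurable_box a b.
  have e := h0 a b; rewrite (fE _ mb) in e.
  have f1 : m1 (box a b) \is a fin_num by rewrite ge0_fin_numE ?fin1.
  have f2 : m2 (box a b) \is a fin_num by rewrite ge0_fin_numE ?fin2.
  by move: e; rewrite -(fineK f1) -(fineK f2) -EFinB => -[/eqP]; rewrite subr_eq0 => /eqP ->.
have := @integral_ae_eq _ _ _ mu Q mQ (cst 0%E) (EFin \o h) ih (measurable_cst _).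
have -> : (forall E, E `<=` Q -> measurable E ->
    (\int[mu]_(x in E) (EFin \o h) x = \int[mu]_(x in E) cst 0%E x)%E) = True.
  apply/propext; split => // _ E EQ mE.
  rewrite integral_cst// mul0e -(setIidl EQ) (fE _ mE) m12//.
  by rewrite subee// ge0_fin_numE ?fin2.
move=> /(_ Logic.I); apply: filterS => x hx Qx.
by have /= [] := hx Qx.
Qed.

(** The difference of two weak derivatives integrates to zero against all test
    functions, hence over all boxes in the interior, and countably many such
    boxes exhaust it. *)
Lemma weak_partial_ae_eq D w i g1 g2 : measurable D ->
  is_weak_partial D w i g1 -> is_weak_partial D w i g2 ->
  {ae mu, forall x, D° x -> g1 x = g2 x}.
Proof.
move=> mD [_ gl1 gw1] [_ gl2 gw2].
have [a [b [P abD Dab]]] := open_bigcup_box (@open_interior _ D).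
pose h x := g1 x - g2 x.
have hl : locally_integrable_on D h.
  split; first by apply: measurable_funB; [exact: (proj1 gl1)|exact: (proj1 gl2)].
  move=> K cK KD; have mK := compact_row_measurable cK.
  have := integrableB mK (proj2 gl1 _ cK KD) (proj2 gl2 _ cK KD).
  by apply: eq_integrable.
have h0 phi : test_function D phi -> \int[mu]_(x in D) (h x * phi x) = 0.
  move=> tphi; have [C [phiC _]] := test_function_bounds tphi.
  have [_ _ cK KD] := tphi.
  have mphi := test_function_measurable tphi.
  have i1 := integrable_locally_mul mD gl1 cK KD mphi phiC (@closure_supportN0 _ _ phi).
  have i2 := integrable_locally_mul mD gl2 cK KD mphi phiC (@closure_supportN0 _ _ phi).
  under eq_Rintegral do rewrite mulrBl.
  rewrite RintegralB//; apply/eqP; rewrite subr_eq0 -eqr_opp; apply/eqP.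
  by rewrite -gw1// -gw2.
have hk k : P k -> {ae mu, forall x, box (a k) (b k) x -> h x = 0}.
  move=> Pk; apply: integral_zero_ae; first exact: measurable_box.
    apply: (@integrableS _ _ _ mu (cbox (a k) (b k))).
    - by apply: compact_row_measurable; exact: cbox_compact.
    - exact: measurable_box.
    - exact: sub_box_cbox.
    - by apply: (proj2 hl); [exact: cbox_compact|exact: abD].
  move=> c d; have [p [q [-> _ pqab]]] := box_setI c d (a k) (b k).
  exact: (integral_zero_box mD hl h0 (subset_trans pqab (abD _ Pk))).
have hP k : {ae mu, forall x, P k -> box (a k) (b k) x -> h x = 0}.
  have [Pk|Pk] := pselect (P k); last first.
    by apply: aeW => x /Pk.
  by apply: filterS (hk _ Pk) => x hx _; exact: hx.
have : {ae mu, forall x k, P k -> box (a k) (b k) x -> h x = 0}.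
  exact: ae_foralln hP.
apply: filterS => x hx; rewrite Dab => -[k Pk xk].
by apply/eqP; rewrite -subr_eq0; apply/eqP; exact: hx xk.
Qed.

End uniqueness_ae.

(** * Weak derivatives of Lipschitz functions from difference quotients *)

Section existence.
Context {R : realType} {m : nat}.
Local Notation mu := (lebesgue_row R m).
Implicit Types (D : set 'rV[R]_m) (w g f : 'rV[R]_m -> R).

Lemma integral_translate (f : 'rV[R]_m -> \bar R) (c : 'rV[R]_m) :
  measurable_fun setT f ->
  (\int[mu]_x f (x + c)%R = \int[mu]_x f x)%E.
Proof.
move=> mf.
have mt := @measurable_translate R m c.
pose tr : {mfun 'rV[R]_m >-> 'rV[R]_m} :=
  HB.pack (fun x : 'rV[R]_m => x + c) (isMeasurableFun.Build _ _ _ _ _ mt).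
have ge0E (h : 'rV[R]_m -> \bar R) : measurable_fun setT h -> (forall x, 0 <= h x)%E ->
    (\int[mu]_x h (x + c)%R = \int[mu]_x h x)%E.
  move=> mh h0.
  have := @ge0_integral_pushforward _ _ _ _ R tr mt mu setT h measurableT mh (fun y _ => h0 y).
  rewrite preimage_setT => <-; apply: eq_measure_integral => A mA _.
  exact: lebesgue_row_translate.
rewrite [LHS]integralE [RHS]integralE; congr (_ - _)%E.
  rewrite -[RHS](ge0E _ (measurable_funepos mf) (funepos_ge0 f)).
  by apply: eq_integral => x _; rewrite !funeposE.
rewrite -[RHS](ge0E _ (measurable_funeneg mf) (funeneg_ge0 f)).
by apply: eq_integral => x _; rewrite !funenegE.
Qed.

Lemma integrable_cube f r B : measurable_fun setT f -> (forall x, `|f x| <= B) ->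
  (forall x, ~ cube m r x -> f x = 0) -> mu.-integrable setT (EFin \o f).
Proof.
move=> mf fB fr; have mr : measurable (cube m r) by exact: measurable_box.
have : mu.-integrable (cube m r) (EFin \o f).
  apply: measurable_bounded_integrable => //.
  - exact: lebesgue_row_cube_fin.
  - exact: measurable_funTS.
  - exists B; split; first exact: num_real.
    by move=> M BM x _ /=; apply: le_trans (fB x) (ltW BM).
move/(integrable_mkcond _ mr); apply: eq_integrable => // x _.
by rewrite patchE; case: ifPn => // /negP xr; rewrite /= fr// => /mem_set.
Qed.

(** A cube has finite measure, so that a common bound dominates. *)
Lemma dct_cube (f_ : nat -> 'rV[R]_m -> R) f r B :
  (forall k, measurable_fun setT (f_ k)) -> measurable_fun setT f ->
  (forall k x, `|f_ k x| <= B) -> (forall k x, ~ cube m r x -> f_ k x = 0) ->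
  {ae mu, forall x, f_ k x @[k --> \oo] --> f x} ->
  \int[mu]_x f_ k x @[k --> \oo] --> \int[mu]_x f x.
Proof.
move=> mf_ mf fB fr fcvg.
have mr : measurable (cube m r) by exact: measurable_box.
pose G : 'rV[R]_m -> R := fun x => B * \1_(cube m r) x.
have mG : measurable_fun setT G.
  by apply: measurable_funM => //; exact: measurable_indic.
have fG k x : `|f_ k x| <= G x.
  rewrite /G indicE; case: (boolP (x \in cube m r)) => [_|/negP xr].
    by rewrite mulr1.
  by rewrite fr ?normr0 ?mulr0// => /mem_set.
have iG : mu.-integrable setT (EFin \o G).
  apply: (integrable_cube (r := r) (B := `|B|)) => // x.
    by rewrite /G indicE normrM; case: (_ \in _); rewrite ?normr1 ?normr0 ?mulr1 ?mulr0.
  by move=> xr; rewrite /G indicE memNset// mulr0.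
have [] := @dominated_convergence _ _ _ mu _ measurableT
  (fun k => EFin \o f_ k) (EFin \o f) (EFin \o G).
- by move=> k; apply/measurable_EFinP.
- by apply/measurable_EFinP.
- apply: filterS fcvg => x fx _; apply: cvg_EFin; first exact: nearW.
  exact: fx.
- exact: iG.
- by apply: aeW => x k _; rewrite lee_fin.
move=> iF _ lim; apply: fine_cvg.
by rewrite fineK//; exact: integrable_fin_num.
Qed.

(** The mean value theorem on the line through [x] in the i-th direction. *)
Lemma partial_lipschitz D f i C : test_function D f ->
  (forall x, `|partial f i x| <= C) ->
  forall x (t : R), `|f (x + t *: delta_mx ord0 i) - f x| <= C * `|t|.
Proof.
move=> [df _ _ _] fC x; set e := delta_mx _ _.
pose F (t : R) := f (x + t *: e).
have dF (t : R) : is_derive t (1 : R) F (partial f i (x + t *: e)).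
  have := @diff_derivable _ _ _ f (x + t *: e) e (df _).
  rewrite /derivable => /cvg_ex[l fl].
  have <- : l = partial f i (x + t *: e).
    by apply/esym; exact: (cvg_lim (@norm_hausdorff _ _) fl).
  have Fl : h^-1 *: ((F \o shift t) (h *: (1 : R)) - F t) @[h --> (0 : R)^'] --> l.
    under eq_fun => h.
      rewrite /= /F [h *: 1]mulr1 scalerDl addrCA.
      over.
    exact: fl.
  split; first by apply/cvg_ex; exists l.
  exact: (cvg_lim (@norm_hausdorff _ _) Fl).
have cF a b : {within `[a, b], continuous F}.
  by apply: derivable_within_continuous => s _; have [] := dF s.
have lip (a b : R) : a < b -> `|F b - F a| <= C * (b - a).
  move=> ab; have [c _ ->] := MVT ab (fun s _ => dF s) (cF a b).
  by rewrite normrM [X in _ * X]gtr0_norm ?subr_gt0// ler_wpM2r// subr_ge0 ltW.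
move=> t; have -> : f x = F 0 by rewrite /F scale0r addr0.
rewrite -/(F t); have [t0|t0|->] := ltgtP t 0.
- by rewrite distrC; apply: le_trans (lip _ _ t0) _; rewrite sub0r ltr0_norm.
- by apply: le_trans (lip _ _ t0) _; rewrite subr0 gtr0_norm.
- by rewrite subrr normr0 mulr0.
Qed.

Lemma partial_quotient_cvg D f i x : test_function D f ->
  k.+1%:R * (f (x + k.+1%:R^-1 *: delta_mx ord0 i) - f x) @[k --> \oo] -->
    partial f i x.
Proof.
move=> [df _ _ _]; set e := delta_mx _ _.
have /cvg_ex[l fl] := @diff_derivable _ _ _ f x e (df x).
have <- : l = partial f i x by apply/esym; exact: (cvg_lim (@norm_hausdorff _ _) fl).
have uP : (forall k, (k.+1%:R^-1 : R) != 0) /\ (k.+1%:R^-1 : R) @[k --> \oo] --> (0 : R).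
  by split; [move=> k; rewrite invr_eq0 pnatr_eq0|exact: cvg_harmonic].
move/cvgr_dnbhsP : fl => /(_ _ uP).
rewrite (_ : (fun k => k.+1%:R * (f _ - f x)) = (fun k => k.+1%:R^-1^-1 *:
    ((f \o shift x) (k.+1%:R^-1 *: e) - f x)))//.
by apply/funext => k; rewrite invrK /= [_ + x]addrC.
Qed.

(** Applied to the support of a test function, which can then be shifted by a
    small step without leaving the domain. *)
Lemma compact_open_dist (K U : set 'rV[R]_m) : compact K -> open U -> K `<=` U ->
  exists2 d : R, 0 < d & forall x y, K x -> `|y - x| < d -> U y.
Proof.
move=> cK oU KU.
have /compact_near_coveringP/(_ R (0 : R)^'+ (fun d x => forall y, `|y - x| < d -> U y)) := cK.
have H x : K x -> \forall x' \near x & d \near (0 : R)^'+,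
    forall y, `|y - x'| < d -> U y.
  move=> Kx; have /nbhs_rowP[e e0 eU] : nbhs x U.
    by apply: open_nbhs_nbhs; split => //; exact: KU.
  exists ([set x' | `|x' - x| < e / 2], [set d | d < e / 2]).
    split => /=; last by apply: nbhs_right_lt; rewrite divr_gt0.
    by apply/nbhs_rowP; exists (e / 2) => //; rewrite divr_gt0.
  move=> [x' d] /= [x'x de] y yx'; apply: eU.
  rewrite (_ : y - x = (y - x') + (x' - x)); last by rewrite addrA subrK.
  apply: le_lt_trans (ler_normD _ _) _.
  by rewrite (splitr e) ltrD// (lt_trans yx').
move=> /(_ _ H) Kd.
near (0 : R)^'+ => d; exists d; first by near: d; exact: nbhs_right_gt.
by move=> x y Kx; apply: (near Kd d).
Unshelve. all: by end_near. Qed.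

End existence.

(** Integration by parts for difference quotients is translation invariance of
    the measure; dominated convergence passes to the limit on both sides. The
    Lipschitz bound is required only along segments that stay in the interior,
    as [D] need not be convex and [w] may jump across its boundary. *)
Lemma weak_partial_quotients (R : realType) m (D : set 'rV[R]_m)
    (w : 'rV[R]_m -> R) (i : 'I_m) (L M : R) :
  measurable D -> measurable_fun D w -> 0 <= L -> (forall x, D x -> `|w x| <= M) ->
  (forall x (t : R), (forall u : R, 0 <= u <= 1 -> D° (x + (u * t) *: delta_mx ord0 i)) ->
     `|w (x + t *: delta_mx ord0 i) - w x| <= L * `|t|) ->
  {ae lebesgue_row R m, forall x, D° x -> cvgn (fun k =>
     k.+1%:R * (w x - w (x - k.+1%:R^-1 *: delta_mx ord0 i)))} ->
  exists g : 'rV[R]_m -> R, [/\ measurable_fun setT g, forall x, `|g x| <= L & is_weak_partial D w i g].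
Proof.
set mu := lebesgue_row R m; set e := delta_mx _ _.
move=> mD mw L0 wM wL wcvg.
pose wt := w \_ D.
have mwt : measurable_fun setT wt by apply/(measurable_restrictT _ mD).
have wtE x : D x -> wt x = w x by move=> Dx; rewrite /wt patchE mem_set.
have wtM x : `|wt x| <= `|M|.
  have [Dx|Dx] := pselect (D x); first by rewrite wtE// (le_trans (wM _ Dx))// ler_norm.
  by rewrite /wt patchE memNset// normr0.
pose q (k : nat) x : R := k.+1%:R * (wt x - wt (x - k.+1%:R^-1 *: e)).
have mtr (f : 'rV[R]_m -> R) (c : 'rV[R]_m) : measurable_fun setT f ->
    measurable_fun setT (fun x : 'rV[R]_m => f (x + c)).
  by move=> mf; apply: measurableT_comp => //; exact: measurable_translate.
have mq k : measurable_fun setT (q k).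
  apply: measurable_funM => //; apply: measurable_funB => //.
  exact: mtr.
(* the limit of the quotients where they converge, truncated so as to be bounded
   by L everywhere *)
pose g x : R := Num.max (- L) (Num.min L (fine (limn_esup (fun k => (q k x)%:E)))).
have mg : measurable_fun setT g.
  apply: measurable_maxr => //; apply: measurable_minr => //.
  apply: measurableT_comp; first exact: fine_measurable.
  apply: measurable_fun_limn_esup => k; exact/measurable_EFinP.
have gL x : `|g x| <= L.
  by rewrite /g ler_norml le_max lexx /= ge_max ge_min lexx /= -subr_ge0 opprK addr_ge0.
have DoD := @interior_subset _ D.
have hk0 k : 0 < k.+1%:R^-1 :> R by rewrite invr_gt0.
have ne : `|e| <= 1 by exact: norm_delta_le1.
have nhe k : `|k.+1%:R^-1 *: e| <= 1.
  rewrite normrZ gtr0_norm//; apply: mulr_ile1 => //.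
  by rewrite invf_le1// ler1n.
(* at distance d from the boundary, the quotients of step less than d see only
   interior values of w *)
have seg (d : R) x k : (forall y, `|y - x| < d -> D° y) -> k.+1%:R^-1 < d ->
    D° x /\ D° (x - k.+1%:R^-1 *: e) /\ `|q k x| <= L.
  move=> xd kd; have d0 := lt_trans (hk0 k) kd.
  have nd u : 0 <= u <= 1 -> `|- (u * k.+1%:R^-1) *: e| < d.
    move=> /andP[u0 u1]; rewrite normrZ normrN ger0_norm ?mulr_ge0//.
    apply: le_lt_trans kd; rewrite -[leRHS]mulr1 ler_pM ?mulr_ge0//.
    by rewrite ler_piMl.
  have Du u : 0 <= u <= 1 -> D° (x - (u * k.+1%:R^-1) *: e).
    by move=> u01; apply: xd; rewrite addrAC subrr add0r -scaleNr nd.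
  have D0 : D° x by have := Du 0; rewrite mul0r scale0r subr0; apply; rewrite lexx ler01.
  have D1 : D° (x - k.+1%:R^-1 *: e) by have := Du 1; rewrite mul1r; apply; rewrite lexx ler01.
  split => //; split => //; rewrite /q !wtE; try exact: DoD.
  have := wL x (- k.+1%:R^-1); rewrite scaleNr => wx.
  have {}wx : `|w (x - k.+1%:R^-1 *: e) - w x| <= L * `|- k.+1%:R^-1|.
    by apply: wx => u u01; rewrite mulrN scaleNr; exact: Du.
  rewrite distrC in wx; rewrite normrM gtr0_norm// mulrC -ler_pdivlMr//.
  by apply: le_trans wx _; rewrite normrN gtr0_norm.
have qg : {ae mu, forall x, D° x -> q k x @[k --> \oo] --> g x}.
  apply: filterS wcvg => x xcvg Dx.
  have /nbhs_rowP[d d0 xd] : nbhs x D° by apply: open_nbhs_nbhs; split => //; exact: open_interior.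
  have kd : \forall k \near \oo, k.+1%:R^-1 < d := near_infty_natSinv_lt (PosNum d0).
  have /cvg_ex[l lcvg] := xcvg Dx.
  have ql : q k x @[k --> \oo] --> l.
    apply: cvg_trans lcvg; apply: near_eq_cvg; apply: filterS kd => k kd.
    have [Dx' [Dk _]] := seg _ _ _ xd kd.
    by rewrite /q !wtE//; exact: DoD.
  have lL : `|l| <= L.
    have nl : `|q k x| @[k --> \oo] --> `|l| by exact: cvg_norm.
    rewrite -(cvg_lim (@norm_hausdorff _ _) nl).
    apply: limr_le; first by apply/cvg_ex; exists `|l|.
    by apply: filterS kd => k kd; have [_ []] := seg _ _ _ xd kd.
  suff -> : g x = l by [].
  have eql : (q k x)%:E @[k --> \oo] --> l%:E by apply: cvg_EFin => //; exact: nearW.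
  rewrite /g is_cvg_limn_esupE; last by apply/cvg_ex; exists l%:E.
  rewrite (cvg_lim _ eql)//=; move: lL; rewrite ler_norml => /andP[l1 l2].
  by rewrite min_r// max_r.
have locb (h : 'rV[R]_m -> R) B : measurable_fun D h -> (forall x, D x -> `|h x| <= B) ->
    locally_integrable_on D h.
  move=> mh hB; split => // K cK KD.
  have mK := compact_row_measurable cK.
  have KD' : K `<=` D by apply: subset_trans KD _.
  apply: measurable_bounded_integrable => //.
  - have [N [_ KN]] := compact_bounded cK.
    have N0 : 0 < `|N| + 2 by rewrite ltr_wpDl.
    apply: le_lt_trans (lebesgue_row_cube_fin m (`|N| + 2)).
    apply: le_measure; rewrite ?inE//; first exact: measurable_box.
    move=> x Kx; apply/cubeP => //.
    have : `|x| <= `|N| + 1 by apply: KN => //; rewrite ltr_pwDr// ler_norm.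
    by move=> /le_lt_trans; apply; rewrite ltrD2l ltr1n.
  - exact: measurable_funS mh.
  - exists B; split; first exact: num_real.
    by move=> M' BM x Kx /=; apply: le_trans (hB _ (KD' _ Kx)) (ltW BM).
exists g; split => //; split.
- exact: locb wM.
- by apply: (locb _ L) => //; exact: measurable_funTS.
move=> phi tphi; have [C [phiC dphiC]] := test_function_bounds tphi.
have [dphi cphi cK KD] := tphi.
set K := closure [set x | phi x != 0] in cK KD.
have phiN x : ~ K x -> phi x = 0 := @closure_supportN0 _ _ phi x.
have mphi := test_function_measurable tphi.
have mdphi : measurable_fun setT (partial phi i) by exact: continuous_row_measurable.
have [d d0 Kd] := compact_open_dist cK (@open_interior _ D) KD.
have [r r0 Kr] : exists2 r, 0 < r & forall x, K x -> `|x| < r.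
  have [N [_ KN]] := compact_bounded cK.
  exists (`|N| + 2); first by rewrite ltr_wpDl.
  move=> x Kx; have : `|x| <= `|N| + 1 by apply: KN => //; rewrite ltr_pwDr// ler_norm.
  by move=> /le_lt_trans; apply; rewrite ltrD2l ltr1n.
pose dq k x := k.+1%:R * (phi (x + k.+1%:R^-1 *: e) - phi x).
have mdq k : measurable_fun setT (dq k).
  by apply: measurable_funM => //; apply: measurable_funB => //; exact: mtr.
have dqC k x : `|dq k x| <= C.
  rewrite /dq normrM gtr0_norm// mulrC -ler_pdivlMr//.
  apply: le_trans (partial_lipschitz tphi (dphiC i) _ _) _.
  by rewrite gtr0_norm.
have dq0 k x : ~ cube m (r + 1) x -> dq k x = 0.
  move=> xr; have xr1 : r + 1 <= `|x|.
    by rewrite leNgt; apply/negP => /cubeP xr1; apply: xr; apply: xr1; rewrite ltr_wpDl ?ltW.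
  rewrite /dq !phiN ?subrr ?mulr0// => /Kr xr'.
    by move: xr1; rewrite leNgt (lt_trans xr')// ltrDl.
  have : `|x| < r + 1.
    rewrite (_ : x = (x + k.+1%:R^-1 *: e) - k.+1%:R^-1 *: e); last by rewrite addrK.
    by apply: le_lt_trans (ler_normB _ _) _; exact: ltr_leD.
  by rewrite ltNge xr1.
have lim1 : \int[mu]_x (wt x * dq k x) @[k --> \oo] --> \int[mu]_x (wt x * partial phi i x).
  apply: (dct_cube (r := r + 1) (B := `|M| * C)).
  - by move=> k; exact: measurable_funM.
  - exact: measurable_funM.
  - by move=> k x; rewrite normrM ler_pM.
  - by move=> k x xr; rewrite dq0 ?mulr0.
  - apply: aeW => x.
    exact: (cvgM (cvg_cst _) (@partial_quotient_cvg _ _ D phi i x tphi)).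
have cube0 k x : ~ cube m (r + 1) x -> q k x * phi x = 0.
  move=> xr; rewrite phiN ?mulr0// => /Kr xr'; apply: xr.
  by apply/cubeP; [rewrite ltr_wpDl ?ltW|rewrite (lt_trans xr')// ltrDl].
(* discrete integration by parts: translate the integral by c *)
have shift_int k : \int[mu]_x (wt x * dq k x) = - \int[mu]_x (q k x * phi x).
  pose c := k.+1%:R^-1 *: e.
  have phir x : ~ cube m (r + 1) x -> phi x = 0.
    move=> xr; rewrite phiN// => /Kr xr'; apply: xr.
    by apply/cubeP; [rewrite ltr_wpDl ?ltW|rewrite (lt_trans xr')// ltrDl].
  have phirc x : ~ cube m (r + 1) x -> phi (x + c) = 0.
    move=> xr; have := dq0 k x xr; rewrite /dq (phir x xr) subr0 => /eqP.
    by rewrite mulf_eq0 pnatr_eq0 /= => /eqP.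
  have i1 : mu.-integrable setT (EFin \o (fun x => wt x * phi x)).
    apply: (integrable_cube (r := r + 1) (B := `|M| * C)).
    - exact: measurable_funM.
    - by move=> x; rewrite normrM ler_pM.
    - by move=> x xr; rewrite phir ?mulr0.
  have i2 : mu.-integrable setT (EFin \o (fun x => wt x * phi (x + c))).
    apply: (integrable_cube (r := r + 1) (B := `|M| * C)).
    - by apply: measurable_funM => //; exact: mtr.
    - by move=> x; rewrite normrM ler_pM.
    - by move=> x xr; rewrite phirc ?mulr0.
  have i3 : mu.-integrable setT (EFin \o (fun x => wt (x - c) * phi x)).
    apply: (integrable_cube (r := r + 1) (B := `|M| * C)).
    - by apply: measurable_funM => //; exact: mtr.
    - by move=> x; rewrite normrM ler_pM.
    - by move=> x xr; rewrite phir ?mulr0.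
  have e23 : \int[mu]_x (wt x * phi (x + c)) = \int[mu]_x (wt (x - c) * phi x).
    rewrite /Rintegral -[X in _ = fine X](@integral_translate _ _ _ c).
      by congr fine; apply: eq_integral => x _; rewrite addrK.
    by apply/measurable_EFinP; apply: measurable_funM => //; exact: mtr.
  have -> : (fun x => wt x * dq k x) =
      (fun x => k.+1%:R * (wt x * phi (x + c) - wt x * phi x)).
    by apply/funext => x; rewrite /dq -/c; ring.
  have -> : (fun x => q k x * phi x) =
      (fun x => k.+1%:R * (wt x * phi x - wt (x - c) * phi x)).
    by apply/funext => x; rewrite /q -/c; ring.
  rewrite !RintegralZl//; first 1 last.
  - exact: (integrableB measurableT i1 i3).
  - exact: (integrableB measurableT i2 i1).
  by rewrite !RintegralB// e23; ring.
(* the bound L on the quotients holds on the support from rank N on *)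
have [N Nd] : exists N, forall k, (N <= k)%N -> k.+1%:R^-1 < d.
  have [N _ Nd] := near_infty_natSinv_lt (PosNum d0).
  by exists N => k Nk; exact: Nd.
have lim2 : \int[mu]_x (q (k + N)%N x * phi x) @[k --> \oo] --> \int[mu]_x (g x * phi x).
  apply: (dct_cube (r := r + 1) (B := L * C)).
  - by move=> k; exact: measurable_funM.
  - exact: measurable_funM.
  - move=> k x; have [Kx|Kx] := pselect (K x); last first.
      by rewrite phiN// mulr0 normr0 mulr_ge0// (le_trans _ (phiC x)).
    rewrite normrM ler_pM//.
    by have [_ []] := seg d x (k + N)%N (Kd x^~ Kx) (Nd _ (leq_addl _ _)).
  - by move=> k x; exact: cube0.
  - apply: filterS qg => x qgx.
    have [Kx|Kx] := pselect (K x); last first.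
      by rewrite phiN// mulr0; under eq_fun do rewrite mulr0; exact: cvg_cst.
    apply: cvgM; last exact: cvg_cst.
    by rewrite (cvg_shiftn N (fun k => q k x)); exact: qgx (KD _ Kx).
have lhsE : \int[mu]_(x in D) (w x * partial phi i x) = \int[mu]_x (wt x * partial phi i x).
  rewrite /Rintegral [in LHS]integral_mkcond; congr fine; apply: eq_integral => x _.
  by rewrite /wt !patchE; case: ifPn => // _; rewrite mul0r.
have rhsE : \int[mu]_(x in D) (g x * phi x) = \int[mu]_x (g x * phi x).
  rewrite /Rintegral [in LHS]integral_mkcond; congr fine; apply: eq_integral => x _.
  rewrite !patchE; case: ifPn => // /negP xD; rewrite phiN ?mulr0// => Kx; apply: xD.
  by apply/mem_set; apply: DoD; exact: KD.
rewrite lhsE rhsE.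
have lim1N : \int[mu]_x (wt x * dq (k + N)%N x) @[k --> \oo] -->
    \int[mu]_x (wt x * partial phi i x).
  by rewrite (cvg_shiftn N (fun k => \int[mu]_x (wt x * dq k x))).
apply: (cvg_unique (@norm_hausdorff _ _) lim1N).
rewrite (_ : (fun k => _) = fun k => - \int[mu]_x (q (k + N)%N x * phi x)).
  exact: cvgN lim2.
by apply/funext => k; exact: shift_int.
Qed.

(** * Regular images of open sets *)

Section regular_maps.
Context {R : realType} {m : nat}.
Implicit Types (x h a q : 'rV[R]_m.+1) (f : 'rV[R]_m.+1 -> R)
  (Phi : 'rV[R]_m.+1 -> 'rV[R]_m.+1).

Lemma has_grad_sum (I : Type) (r : seq I) (F : I -> 'rV[R]_m.+1 -> R)
    (G : I -> 'rV[R]_m.+1) x : (forall i, has_grad (F i) x (G i)) ->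
  has_grad (fun y => \sum_(i <- r) F i y) x (\sum_(i <- r) G i).
Proof.
move=> FG; elim: r => [|i r IH].
  by under eq_fun do rewrite big_nil; rewrite big_nil; exact: has_grad_cst.
under eq_fun do rewrite big_cons; rewrite big_cons; exact: has_gradD.
Qed.

(** A small step against a nonzero gradient would decrease the function. *)
Lemma has_grad_min f x a (e : R) : has_grad f x a -> 0 < e ->
  (forall y, `|y - x| < e -> f x <= f y) -> a = 0.
Proof.
move=> [C C0 fC] e0 fmin.
have [->//|a0] := eqVneq a 0.
have na0 : 0 < `|a| by rewrite normr_gt0.
have daa : `|a| ^+ 2 <= dotv a a.
  have [i ai] : exists i, `|a| = `|a ord0 i|.
    have : mx_norm a != 0 by rewrite -[mx_norm a]/(`|a|) gt_eqF.
    by move=> /mx_norm_neq0[[i j] /= E]; exists j; rewrite [LHS]E (ord1 i).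
  rewrite ai real_normK ?num_real// /dotv (bigD1 i)//= -expr2 lerDl.
  by apply: sumr_ge0 => j _; rewrite -expr2 sqr_ge0.
(* a step of length t against the gradient decreases f at first order *)
pose t := Num.min (Num.min (1 / `|a|) (e / (2 * `|a|))) (1 / (2 * (C + 1))).
have t0 : 0 < t.
  by rewrite /t !lt_min !divr_gt0// ?mulr_gt0// ltr_wpDl.
have ta : `|- t *: a| <= 1.
  rewrite normrZ normrN gtr0_norm//.
  have : t <= 1 / `|a| by rewrite /t !ge_min lexx.
  by rewrite ler_pdivlMr.
have te : `|- t *: a| < e.
  rewrite normrZ normrN gtr0_norm//.
  have : t <= e / (2 * `|a|) by rewrite /t !ge_min lexx orbT.
  by rewrite ler_pdivlMr ?mulr_gt0// => h; nra.
have tC : t * (2 * (C + 1)) <= 1.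
  have : t <= 1 / (2 * (C + 1)) by rewrite /t !ge_min lexx !orbT.
  by rewrite ler_pdivlMr// mulr_gt0// ltr_wpDl.
clearbody t.
have := fC _ ta; have := fmin (x - t *: a).
rewrite addrAC subrr add0r -scaleNr => /(_ te) h1.
rewrite dotvZr normrZ normrN (gtr0_norm t0) exprMn ler_norml => /andP[_ h2].
have na2 : 0 < `|a| ^+ 2 by rewrite exprn_gt0.
have h3 : t * dotv a a <= C * (t ^+ 2 * `|a| ^+ 2) by lra.
have h4 : t * `|a| ^+ 2 <= t * dotv a a by rewrite ler_pM2l.
have h5 : t * `|a| ^+ 2 <= t * `|a| ^+ 2 * (C * t).
  by apply: le_trans h4 _; apply: le_trans h3 _; rewrite le_eqVlt; apply/orP; left; apply/eqP; ring.
have h6 : 1 <= C * t by move: h5; rewrite -{1}[t * _]mulr1 ler_pM2l// mulr_gt0.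
by exfalso; nra.
Qed.

Variables (Phi : 'rV[R]_m.+1 -> 'rV[R]_m.+1) (O : set 'rV[R]_m.+1) (c : R).
Hypothesis Phis : forall j, smooth (fun x => Phi x ord0 j).
Hypothesis oO : open O.
Hypothesis c0 : 0 < c.
Hypothesis Phic : forall x y, O x -> O y -> c * `|x - y| <= `|Phi x - Phi y|.

(** The lower Lipschitz bound passes to the differential, which is therefore
    injective, hence invertible. *)
Lemma regular_differential x : O x ->
  exists A C, [/\ A \in unitmx, 0 <= C,
    forall h, `|h| <= 1 -> `|Phi (x + h) - Phi x - h *m A| <= C * `|h| ^+ 2,
    forall h, c * `|h| <= `|h *m A| &
    forall j, has_grad (fun x => Phi x ord0 j) x (\row_i A i j)].
Proof.
move=> Ox.
have [G GP] := choice Phis.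
pose A : 'M[R]_m.+1 := \matrix_(i, j) G j x ord0 i.
have hA h j : (h *m A) ord0 j = dotv (G j x) h.
  by rewrite mxE; apply: eq_bigr => i _; rewrite mxE mulrC.
have gA j : has_grad (fun x => Phi x ord0 j) x (\row_i A i j).
  rewrite (_ : \row_i _ = G j x); first exact: (proj1 (GP j)).
  by apply/rowP => i; rewrite !mxE.
have ex j : exists C, 0 <= C /\ forall h, `|h| <= 1 ->
    `|Phi (x + h) ord0 j - Phi x ord0 j - dotv (G j x) h| <= C * `|h| ^+ 2.
  by have [C C0 CP] := (proj1 (GP j)) x; exists C.
have [C CP] := choice ex.
pose D := \sum_j C j.
have CD j : C j <= D.
  by rewrite /D (bigD1 j)//= lerDl; apply: sumr_ge0 => i _; exact: (proj1 (CP i)).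
have D0 : 0 <= D by apply: sumr_ge0 => i _; exact: (proj1 (CP i)).
have expA h : `|h| <= 1 -> `|Phi (x + h) - Phi x - h *m A| <= D * `|h| ^+ 2.
  move=> h1; apply: norm_le_coord; first by rewrite mulr_ge0// sqr_ge0.
  move=> j; have -> : (Phi (x + h) - Phi x - h *m A) ord0 j =
      Phi (x + h) ord0 j - Phi x ord0 j - dotv (G j x) h by rewrite -hA !mxE.
  by apply: le_trans (proj2 (CP j) _ h1) _; rewrite ler_wpM2r ?sqr_ge0.
have cA h : c * `|h| <= `|h *m A|.
  have [->|h0] := eqVneq h 0; first by rewrite normr0 mulr0.
  have nh : 0 < `|h| by rewrite normr_gt0.
  have /nbhs_rowP[e e0 eO] : nbhs x O by exact: open_nbhs_nbhs.
  apply/ler_addgt0Pr => eps eps0.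
  (* t small enough for x + t h to stay in O and for the remainder to be below t eps *)
  pose t := Num.min (Num.min (1 / `|h|) (e / (2 * `|h|))) (eps / ((D + 1) * `|h| ^+ 2)).
  have t0 : 0 < t.
    by rewrite /t !lt_min !divr_gt0// ?mulr_gt0// ?exprn_gt0// ltr_wpDl.
  have t1 : t * `|h| <= 1.
    have : t <= 1 / `|h| by rewrite /t !ge_min lexx.
    by rewrite ler_pdivlMr.
  have te : t * `|h| < e.
    have : t <= e / (2 * `|h|) by rewrite /t !ge_min lexx orbT.
    by rewrite ler_pdivlMr ?mulr_gt0// => ?; nra.
  have teps : t * ((D + 1) * `|h| ^+ 2) <= eps.
    have : t <= eps / ((D + 1) * `|h| ^+ 2) by rewrite /t !ge_min lexx !orbT.
    by rewrite ler_pdivlMr// mulr_gt0// ?exprn_gt0// ltr_wpDl.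
  clearbody t.
  have nth : `|t *: h| = t * `|h| by rewrite normrZ gtr0_norm.
  have Oth : O (x + t *: h) by apply: eO; rewrite addrAC subrr add0r nth.
  have := Phic Oth Ox; rewrite addrAC subrr add0r nth => l1.
  have := expA (t *: h); rewrite nth => /(_ t1) l2.
  have l3 : `|Phi (x + t *: h) - Phi x| <=
      `|Phi (x + t *: h) - Phi x - (t *: h) *m A| + t * `|h *m A|.
    rewrite -{1}(subrK ((t *: h) *m A) (Phi (x + t *: h) - Phi x)).
    apply: le_trans (ler_normD _ _) _; rewrite lerD2l.
    by rewrite -scalemxAl normrZ gtr0_norm.
  have l4 : D * (t * `|h|) ^+ 2 <= t * eps.
    rewrite (_ : D * _ = t * (t * (D * `|h| ^+ 2))); last by ring.
    rewrite ler_pM2l//; apply: le_trans teps; rewrite ler_pM2l//.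
    by rewrite ler_wpM2r ?sqr_ge0// lerDl.
  by rewrite -(ler_pM2l t0); lra.
exists A, D; split => //.
rewrite -row_free_unit -kermx_eq0; apply/rowV0P => h /sub_kermxP hA0.
have := cA h; rewrite hA0 normr0 pmulr_rle0// => h0.
by apply/normr0_eq0/eqP; rewrite eq_le h0 normr_ge0.
Qed.

(** The inverse function theorem by minimization: given [q] near [Phi x0], the
    squared distance from [Phi] to [q] has a minimum on a small closed ball. The
    lower Lipschitz bound keeps the minimum away from the sphere, so the gradient
    vanishes there, and the differential being onto, so does the distance. *)
Lemma regular_image_open : open (Phi @` O).
Proof.
rewrite openE => _ [x0 Ox0 <-].
have /nbhs_rowP[e e0 eO] : nbhs x0 O by exact: open_nbhs_nbhs.
pose r := e / 2.
have r0 : 0 < r by rewrite divr_gt0.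
have re : r < e by rewrite /r; lra.
pose B := [set x : 'rV[R]_m.+1 | `|x - x0| <= r].
have BO : B `<=` O by move=> x xr; apply: eO; exact: le_lt_trans xr re.
apply/nbhs_rowP; exists (c * r / (m.+1%:R + 1)).
  by rewrite !divr_gt0// ?mulr_gt0// ltr_wpDl.
move=> q qx0.
pose f x := \sum_j (Phi x ord0 j - q ord0 j) * (Phi x ord0 j - q ord0 j).
have fs : smooth f.
  by apply: smooth_sum => j; apply: smoothM; apply: smoothB; by [exact: Phis|exact: smooth_cst].
have Bc : compact B.
  have := @cbox_compact R m.+1 (\row_i (x0 ord0 i - r)) (\row_i (x0 ord0 i + r)).
  congr compact; apply/seteqP; split => x /= xr.
    apply: norm_le_coord => [|i]; first exact: ltW.
    by have := xr i; rewrite !mxE ler_norml => /andP[h1 h2]; apply/andP; split; lra.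
  move=> i; have := le_trans (coord_le_norm _ i) xr; rewrite !mxE ler_norml.
  by move=> /andP[h1 h2]; apply/andP; split; lra.
have [||z /set_mem Bz zmin] := @compact_EVT_min _ R f B _ Bc.
- by exists x0; rewrite /B /= subrr normr0 ltW.
- by apply: continuous_subspaceT; exact: smooth_continuous.
have fdot x : f x = dotv (Phi x - q) (Phi x - q).
  by apply: eq_bigr => j _; rewrite !mxE.
have fge x : `|Phi x - q| ^+ 2 <= f x.
  rewrite fdot; set v := _ - q.
  have [->|v0] := eqVneq v 0; first by rewrite normr0 expr0n dotv_ge0.
  have [i vi] : exists i, `|v| = `|v ord0 i|.
    have : mx_norm v != 0 by rewrite -[mx_norm v]/(`|v|) normr_eq0.
    by move=> /mx_norm_neq0[[i j] /= E]; exists j; rewrite [LHS]E (ord1 i).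
  rewrite vi real_normK ?num_real// /dotv (bigD1 i)//= -expr2 lerDl.
  by apply: sumr_ge0 => j _; rewrite -expr2 sqr_ge0.
have fle x : f x <= m.+1%:R * `|Phi x - q| ^+ 2.
  rewrite fdot /dotv; apply: (@le_trans _ _ (\sum_(i < m.+1) `|Phi x - q| ^+ 2)).
    apply: ler_sum => i _; rewrite -expr2 -real_normK ?num_real//.
    by rewrite ler_pXn2r ?nnegrE//; exact: coord_le_norm.
  by rewrite sumr_const card_ord mulr_natl.
have zint : `|z - x0| < r.
  rewrite lt_neqAle Bz andbT; apply/eqP => zr.
  have h1 : c * r <= `|Phi z - Phi x0|.
    by rewrite -zr; apply: Phic => //; exact: BO.
  have h2 : `|Phi z - Phi x0| <= `|Phi z - q| + `|q - Phi x0|.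
    by rewrite -{1}(subrK q (Phi z)) -addrA; exact: ler_normD.
  move: qx0; rewrite ltr_pdivlMr ?ltr_wpDl// => qx0.
  have Bx0 : B x0 by rewrite /B /= subrr normr0 ltW.
  have h3 := zmin _ (mem_set Bx0).
  have := fle x0; rewrite (distrC (Phi x0)); have := fge z.
  have h4 : 1 <= m.+1%:R :> R by rewrite ler1n.
  have h0 := normr_ge0 (q - Phi x0); have h0' := normr_ge0 (Phi z - q).
  move: h0 h0' h1 h2 qx0; set u := `|q - _|; set v := `|Phi z - q|; set N := m.+1%:R.
  move=> h0 h0' h1 h2 qx0 h5 h6.
  have h7 : N * u < v by nra.
  have h8 : v ^+ 2 <= N * u ^+ 2 by lra.
  have h9 : 0 <= N * u by rewrite mulr_ge0// (le_trans ler01).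
  have h10 : (N * u) ^+ 2 < v ^+ 2 by rewrite ltr_pXn2r ?nnegrE.
  have h11 : N * u ^+ 2 <= (N * u) ^+ 2 by rewrite exprMn ler_wpM2r ?sqr_ge0// expr2 ler_peMr// (le_trans ler01).
  lra.
have Oz : O z by exact: BO.
have [A [C [Au _ _ _ gA]]] := regular_differential Oz.
pose a := \sum_j ((Phi z ord0 j - q ord0 j) *: (\row_i A i j + 0) +
   (Phi z ord0 j - q ord0 j) *: (\row_i A i j + 0)).
have fa : has_grad f z a.
  apply: has_grad_sum => j; apply: has_gradM;
    by apply: has_gradD; [exact: gA|exact: has_grad_cst].
have az : a = 0.
  apply: (has_grad_min (e := r - `|z - x0|) fa); first by rewrite subr_gt0.
  move=> y yz; apply: zmin; apply/mem_set; rewrite /B /=.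
  rewrite (_ : y - x0 = (y - z) + (z - x0)); last by rewrite addrA subrK.
  by apply: le_trans (ler_normD _ _) _; lra.
exists z => //.
apply/eqP; rewrite -subr_eq0; apply/eqP.
have : (Phi z - q) *m A^T = 0.
  apply/rowP => i; rewrite [LHS]mxE [RHS]mxE.
  have h : a ord0 i = 0 by rewrite az mxE.
  rewrite /a summxE in h.
  apply: (@mulfI _ (2 : R)); first by rewrite pnatr_eq0.
  rewrite mulr0 -[RHS]h mulr_sumr; apply: eq_bigr => j _; rewrite !mxE; ring.
move=> /(congr1 (mulmx^~ (invmx A^T))); rewrite mulmxK ?unitmx_tr// mul0mx.
by [].
Qed.

End regular_maps.

Lemma cvg_of_rate (R : realType) (u : nat -> R) (l K : R) N :
  (forall k, (N <= k)%N -> `|u k - l| <= K * k.+1%:R^-1) -> u k @[k --> \oo] --> l.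
Proof.
move=> ul; apply/cvgrPdist_le => e e0.
have d0 : 0 < e / (`|K| + 1) by rewrite divr_gt0// ltr_wpDl.
have [N' _ N'd] := near_infty_natSinv_lt (PosNum d0).
exists (maxn N N') => // k /=; rewrite geq_max => /andP[Nk N'k].
rewrite distrC; apply: le_trans (ul _ Nk) _.
have := N'd _ N'k; rewrite /= ltr_pdivlMr ?ltr_wpDl// => h.
apply: le_trans (ltW h); rewrite mulrC ler_wpM2l ?invr_ge0//.
by apply: le_trans (ler_norm _) _; rewrite lerDl.
Qed.

(** [w] is [U] read through the chart [Phi], whose inverse is Lipschitz: the
    inverse chart applied to [Phi x - e / k] moves at the speed prescribed by
    the inverse of the differential, up to an error of order [1 / k]. *)
Lemma chart_quotient_cvg (R : realType) m (Phi : 'rV[R]_m.+1 -> 'rV[R]_m.+1)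
    (O : set 'rV[R]_m.+1) (c : R) (U w : 'rV[R]_m.+1 -> R) x e :
  (forall j, smooth (fun x => Phi x ord0 j)) -> open O -> 0 < c ->
  (forall x y, O x -> O y -> c * `|x - y| <= `|Phi x - Phi y|) ->
  smooth U -> (forall x, O x -> w (Phi x) = U x) -> O x ->
  cvgn (fun k => k.+1%:R * (w (Phi x) - w (Phi x - k.+1%:R^-1 *: e))).
Proof.
move=> Phis oO c0 Phic [G [UG _]] wU Ox.
have [A [C [Au C0 expA cA _]]] := regular_differential Phis oO c0 Phic Ox.
have [D D0 UD] := UG x.
have /nbhs_rowP[r r0 rO] : nbhs (Phi x) (Phi @` O).
  by apply: open_nbhs_nbhs; split; [exact: (regular_image_open Phis oO c0 Phic)|exists x].
pose E := `|e| / c.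
have E0 : 0 <= E by rewrite divr_ge0// ltW.
(* from rank N on the points stay in Phi @` O, and their preimages within 1 of x *)
have [N Nd] : exists N, forall k, (N <= k)%N ->
    k.+1%:R^-1 * (`|e| + 1) < r /\ E * k.+1%:R^-1 <= 1.
  have d0 : 0 < Num.min (r / (`|e| + 1)) (1 / (E + 1)).
    by rewrite lt_min !divr_gt0// ltr_wpDl.
  have [N _ Nd] := near_infty_natSinv_lt (PosNum d0).
  exists N => k /Nd; rewrite /= lt_min !ltr_pdivlMr ?ltr_wpDl// => /andP[h1 h2].
  split => //; apply: ltW; apply: le_lt_trans h2.
  by rewrite mulrC ler_wpM2l ?invr_ge0// lerDl.
pose v := e *m invmx A.
pose K := norm1 (G x) * (C * E ^+ 2 / c) + D * E ^+ 2.
apply/cvg_ex; exists (dotv (G x) v); apply: (cvg_of_rate (K := K) (N := N)) => k Nk.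
have [kr kE] := Nd _ Nk.
set t := k.+1%:R^-1 in kr kE *.
have t0 : 0 < t by rewrite invr_gt0.
have kt : k.+1%:R = t^-1 by rewrite invrK.
have [xk Oxk Phixk] : (Phi @` O) (Phi x - t *: e).
  apply: rO; rewrite addrAC subrr add0r normrN normrZ gtr0_norm//.
  by apply: le_lt_trans kr; rewrite ler_pM2l// lerDl.
rewrite -Phixk !wU// kt.
pose h := xk - x.
have xkE : xk = x + h by rewrite /h subrKC.
have nh : `|h| <= E * t.
  rewrite /E mulrAC ler_pdivlMr// mulrC.
  apply: le_trans (Phic _ _ Oxk Ox) _.
  by rewrite Phixk addrAC subrr add0r normrN normrZ gtr0_norm// mulrC.
have h1 : `|h| <= 1 := le_trans nh kE.
have eA := expA _ h1; have eU := UD _ h1.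
rewrite -xkE in eA eU.
have dPhi : Phi xk - Phi x = - (t *: e) by rewrite Phixk addrAC subrr add0r.
rewrite dPhi in eA.
have nh2 : `|h| ^+ 2 <= E ^+ 2 * t ^+ 2.
  by rewrite -exprMn ler_pXn2r ?nnegrE// mulr_ge0// ltW.
have hv : `|- h - t *: v| <= C * E ^+ 2 / c * t ^+ 2.
  rewrite -(ler_pM2l c0); apply: le_trans (cA _) _.
  have -> : (- h - t *: v) *m A = - (t *: e) - h *m A.
    by rewrite mulmxBl mulNmx -scalemxAl /v mulmxKV// addrC.
  apply: le_trans eA _; apply: (@le_trans _ _ (C * (E ^+ 2 * t ^+ 2))).
    by rewrite ler_wpM2l.
  by rewrite le_eqVlt; apply/orP; left; apply/eqP; field; rewrite gt_eqF.
have -> : t^-1 * (U x - U xk) - dotv (G x) v =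
    t^-1 * (dotv (G x) (- h - t *: v) - (U xk - U x - dotv (G x) h)).
  have -> : dotv (G x) (- h - t *: v) = - dotv (G x) h - t * dotv (G x) v.
    by rewrite dotvDr -scaleN1r -[- (t *: v)]scaleNr !dotvZr; ring.
  by field; rewrite gt_eqF.
rewrite normrM gtr0_norm ?invr_gt0// mulrC ler_pdivrMr//.
apply: le_trans (ler_normB _ _) _.
apply: (@le_trans _ _ (norm1 (G x) * (C * E ^+ 2 / c * t ^+ 2) + D * (E ^+ 2 * t ^+ 2))).
  apply: lerD.
    by apply: le_trans (dotv_le _ _) _; rewrite ler_wpM2l ?norm1_ge0.
  by apply: le_trans eU _; rewrite ler_wpM2l.
by rewrite le_eqVlt; apply/orP; left; apply/eqP; rewrite /K; ring.
Qed.

Lemma grid_cover (R : realType) (f : nat -> R) N x : (0 < N)%N -> f 0%N <= x <= f N ->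
  exists2 k, (k < N)%N & f k <= x <= f k.+1.
Proof.
elim: N => // N IH _ /andP[f0 fN].
have [xN|Nx] := leP (f N) x; first by exists N; rewrite ?xN.
case: N IH fN Nx => [|N] IH fN Nx; first by rewrite leNgt Nx in f0.
have [//||k kN fk] := IH; first by rewrite f0 ltW.
by exists k => //; exact: ltnW.
Qed.

(** Cut the parameters [pi x] into [N ^ m] cubes of size of order [1 / N]: each
    part of the image fits in a cube of size of order [1 / N] of dimension
    [m + 1], so that the total volume is of order [1 / N]. *)
Lemma lipschitz_image_null (R : realType) m (S : set 'rV[R]_m.+1)
    (Phi : 'rV[R]_m.+1 -> 'rV[R]_m.+1) (pi : 'rV[R]_m.+1 -> 'rV[R]_m) (L r : R) :
  0 < r -> 0 <= L -> (forall x, S x -> `|pi x| <= r) ->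
  (forall x y, S x -> S y -> `|Phi x - Phi y| <= L * `|pi x - pi y|) ->
  (lebesgue_row R m.+1).-negligible (Phi @` S).
Proof.
move=> r0 L0 Sr SL; set mu := lebesgue_row R m.+1.
pose M := 2 * r * L + 1.
have M0 : 0 < M by rewrite /M ltr_wpDl// !mulr_ge0// ltW.
pose grid N (s : nat) : R := - r + 2 * r / N.+1%:R * s%:R.
pose part N (s : {ffun 'I_m -> 'I_N.+1}) : set 'rV[R]_m.+1 :=
  S `&` [set x | forall j, grid N (s j) <= pi x ord0 j <= grid N (s j).+1].
pose cen N s : 'rV[R]_m.+1 := Phi (xget 0 (part N s)).
pose cell N s : set 'rV[R]_m.+1 :=
  box (cen N s - const_mx (M / N.+1%:R)) (cen N s + const_mx (M / N.+1%:R)).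
have cover N : Phi @` S `<=` \big[setU/set0]_(s : {ffun 'I_m -> 'I_N.+1}) cell N s.
  move=> _ [x Sx <-].
  have ex j : exists k : 'I_N.+1, grid N k <= pi x ord0 j <= grid N k.+1.
    have [//||k kN xk] := @grid_cover R (grid N) N.+1 (pi x ord0 j).
      have := le_trans (coord_le_norm (pi x) j) (Sr _ Sx); rewrite ler_norml.
      by rewrite /grid mulr0 addr0 mulfVK ?pnatr_eq0// => /andP[-> h] /=; lra.
    by exists (Ordinal kN).
  have [s sP] := choice ex.
  rewrite -bigcup_seq; exists (finfun s); first by rewrite /= mem_index_enum.
  have xs : part N (finfun s) x by split => //= j; rewrite ffunE.
  have [ys1 ys2] := @xgetPex _ 0 (part N (finfun s)) (ex_intro _ x xs).
  set y := xget 0 _ in ys1 ys2.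
  have piL : `|pi x - pi y| <= 2 * r / N.+1%:R.
    apply: norm_le_coord => [|j]; first by rewrite divr_ge0 ?mulr_ge0 ?ltW.
    have [_ /(_ j)] := xs; have := ys2 j; rewrite /grid !mxE.
    set K := nat_of_ord _; rewrite -[K.+1%:R]natr1 mulrDr mulr1.
    set d := 2 * r / _; set u := d * K%:R; rewrite ler_norml.
    by move=> /andP[? ?] /andP[? ?]; apply/andP; split; lra.
  have PhiL : `|Phi x - Phi y| < M / N.+1%:R.
    apply: le_lt_trans (SL _ _ Sx ys1) _.
    apply: (@le_lt_trans _ _ (L * (2 * r / N.+1%:R))); first by rewrite ler_wpM2l.
    by rewrite mulrA ltr_pM2r ?invr_gt0// /M mulrC ltrDl.
  move=> j; have := le_lt_trans (coord_le_norm _ j) PhiL.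
  rewrite /cen -/y !mxE ltr_norml; set d := M / _.
  by move=> /andP[? ?]; apply/andP; split; lra.
have mcell N s : measurable (cell N s) by exact: measurable_box.
have mucell N s : mu (cell N s) = ((2 * (M / N.+1%:R)) ^+ m.+1)%:E.
  rewrite lebesgue_row_box => [|j]; last first.
    by rewrite !mxE lerD2l ge0_cp// divr_ge0// ltW.
  congr EFin; rewrite -[in RHS](card_ord m.+1) -prodr_const.
  by apply: eq_bigr => j _; rewrite !mxE; ring.
have sub N (l : seq {ffun 'I_m -> 'I_N.+1}) :
    (mu (\big[setU/set0]_(s <- l) cell N s) <=
     ((size l)%:R * (2 * (M / N.+1%:R)) ^+ m.+1)%:E)%E.
  elim: l => [|s l IH]; first by rewrite big_nil measure0 mul0r.
  have ml : measurable (\big[setU/set0]_(s <- l) cell N s).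
    by apply: bigsetU_measurable => i _.
  rewrite big_cons.
  apply: (@le_trans _ _ (mu (cell N s) + mu (\big[setU/set0]_(s <- l) cell N s))%E).
    exact: measureU2.
  rewrite mucell; set X := _ ^+ m.+1.
  have -> : ((size (s :: l))%:R * X)%:E = (X%:E + ((size l)%:R * X)%:E)%E.
    by rewrite -EFinD; congr EFin; rewrite /= -[(size l).+1%:R]natr1; ring.
  exact: leeD2l.
pose U N := \big[setU/set0]_(s : {ffun 'I_m -> 'I_N.+1}) cell N s.
have mU N : measurable (U N) by apply: bigsetU_measurable => i _.
exists (\bigcap_N U N); split.
- exact: bigcapT_measurable.
- apply/eqP; rewrite eq_le measure_ge0 andbT; apply/lee_addgt0Pr => e e0.
  rewrite add0e.
  pose B := (2 * M) ^+ m.+1.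
  have B0 : 0 < B by rewrite exprn_gt0// mulr_gt0.
  have [N _ /(_ N (leqnn _)) /= Ne] := near_infty_natSinv_lt (PosNum (divr_gt0 e0 B0)).
  apply: (@le_trans _ _ (mu (U N))).
    by apply: le_measure; rewrite ?inE//; [exact: bigcapT_measurable|exact: bigcap_inf].
  apply: le_trans (sub N _) _; rewrite lee_fin.
  have -> : size (index_enum {ffun 'I_m -> 'I_N.+1}) = (N.+1 ^ m)%N.
    by rewrite -[X in (X ^ _)%N](card_ord N.+1) -[X in (_ ^ X)%N](card_ord m)
      -card_ffun cardT enumT.
  move: Ne; rewrite ltr_pdivlMr// => Ne; apply: le_trans (ltW Ne).
  rewrite le_eqVlt; apply/orP; left; apply/eqP.
  have a0 : N.+1%:R != 0 :> R by rewrite pnatr_eq0.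
  rewrite natrX /B mulrA exprMn exprVn [N.+1%:R ^+ m.+1]exprS.
  have key (a b d : R) : a != 0 -> d != 0 -> d * (b / (a * d)) = a^-1 * b.
    by move=> a_n0 d_n0; field; rewrite a_n0 d_n0.
  by rewrite key// expf_neq0.
- by move=> x Sx N _; exact: cover.
Qed.

Lemma smooth_map_lipschitz (R : realType) m p (Phi : 'rV[R]_m -> 'rV[R]_p) r :
  (forall j, smooth (fun x => Phi x ord0 j)) ->
  exists2 L : R, 0 <= L & forall x y, `|x| <= r -> `|y| <= r ->
    `|Phi x - Phi y| <= L * `|x - y|.
Proof.
move=> Phis.
have ex j : exists L : R, 0 <= L /\ forall x y, `|x| <= r -> `|y| <= r ->
    `|Phi y ord0 j - Phi x ord0 j| <= L * `|y - x|.
  by have [L L0 LP] := smooth_lipschitz r (Phis j); exists L.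
have [L LP] := choice ex.
exists (\sum_j L j); first by apply: sumr_ge0 => j _; have [] := LP j.
move=> x y xr yr; apply: norm_le_coord => [|j].
  by rewrite mulr_ge0// sumr_ge0// => j _; have [] := LP j.
rewrite !mxE; have [_ /(_ y x yr xr)] := LP j => /le_trans; apply.
rewrite ler_wpM2r// (bigD1 j)//= lerDl; apply: sumr_ge0 => i _.
by have [] := LP i.
Qed.

(** On a hyperplane one coordinate is a Lipschitz function of the others, so
    that [m] parameters suffice. *)
Lemma hyperplane_image_null (R : realType) m (S : set 'rV[R]_m.+1)
    (Phi : 'rV[R]_m.+1 -> 'rV[R]_m.+1) (a : 'rV[R]_m.+1) (b r : R) :
  (forall j, smooth (fun x => Phi x ord0 j)) -> a != 0 ->
  (forall x, S x -> `|x| <= r) -> (forall x, S x -> dotv a x = b) ->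
  (lebesgue_row R m.+1).-negligible (Phi @` S).
Proof.
move=> Phis a0 Sr Sa.
have [i ai] : exists i, a ord0 i != 0.
  have [//|N] := pselect (exists i, a ord0 i != 0).
  case/eqP: a0; apply/rowP => i; rewrite mxE; case: (eqVneq (a ord0 i) 0) => // ai.
  by case: N; exists i.
have [L L0 LP] := smooth_map_lipschitz r Phis.
pose pi (x : 'rV[R]_m.+1) : 'rV[R]_m := \row_j x ord0 (lift i j).
pose K := 1 + norm1 a / `|a ord0 i|.
have K1 : 1 <= K by rewrite /K lerDl divr_ge0// norm1_ge0.
have K0 : 0 <= K := le_trans ler01 K1.
have xpi x y : S x -> S y -> `|x - y| <= K * `|pi x - pi y|.
  move=> Sx Sy; have pij j : `|x ord0 (lift i j) - y ord0 (lift i j)| <= `|pi x - pi y|.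
    by have := coord_le_norm (pi x - pi y) j; rewrite !mxE.
  apply: norm_le_coord => [|k]; first by rewrite mulr_ge0.
  rewrite !mxE; case: (unliftP i k) => [j ->|->].
    by apply: le_trans (pij j) _; rewrite ler_peMl.
  have E : a ord0 i * (x ord0 i - y ord0 i) =
      - \sum_(j < m) a ord0 (lift i j) * (x ord0 (lift i j) - y ord0 (lift i j)).
    have := Sa _ Sx; rewrite -(Sa _ Sy) /dotv !(bigD1_ord i)//= => h.
    under eq_bigr do rewrite mulrBr.
    by rewrite sumrB; lra.
  rewrite mulrDl mul1r; apply: (@le_trans _ _ (norm1 a / `|a ord0 i| * `|pi x - pi y|)); last first.
    by rewrite lerDr.
  rewrite mulrAC ler_pdivlMr ?normr_gt0// mulrC -normrM E normrN.
  apply: le_trans (ler_norm_sum _ _ _) _.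
  rewrite /norm1 (bigD1_ord i)//= mulrDl.
  apply: (@le_trans _ _ ((\sum_(j < m) `|a ord0 (lift i j)|) * `|pi x - pi y|)).
    by rewrite mulr_suml; apply: ler_sum => j _; rewrite normrM ler_wpM2l.
  by rewrite lerDr mulr_ge0.
have r10 : 0 < `|r| + 1 by rewrite ltr_wpDl.
apply: (@lipschitz_image_null R m S Phi pi (L * K) (`|r| + 1)) => //.
- exact: mulr_ge0.
- move=> x Sx; apply: norm_le_coord => [|j]; first exact: ltW.
  rewrite mxE; apply: le_trans (coord_le_norm x _) _.
  by apply: le_trans (Sr _ Sx) _; apply: le_trans (ler_norm _) _; rewrite lerDl.
- move=> x y Sx Sy; apply: le_trans (LP _ _ (Sr _ Sx) (Sr _ Sy)) _.
  by rewrite -mulrA ler_wpM2l//; exact: xpi.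
Qed.

(** Finitely many closed pieces covering an interval necessarily touch, so that
    Lipschitz bounds on the pieces chain together: leave the piece of the left
    end point at its last point, which belongs to another piece. *)
Lemma covered_lipschitz (R : realType) (I : finType) (P : I -> set R) (h : R -> R) L :
  (forall i, closed (P i)) ->
  (forall i s t, P i s -> P i t -> `|h s - h t| <= L * `|s - t|) ->
  forall (A : {set I}) a b, a <= b ->
    (forall t, a <= t <= b -> exists2 i, i \in A & P i t) ->
    `|h b - h a| <= L * (b - a).
Proof.
(* induction on the number of pieces still needed to the right of a *)
move=> cP hP A; move: {2}#|A| (leqnn #|A|) => k; elim: k A => [|k IH] A.
  rewrite leqn0 cards_eq0 => /eqP -> a b ab /(_ a).
  by rewrite lexx ab => /(_ isT)[i]; rewrite inE.
move=> Ak a b ab cov.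
have [|i iA Pa] := cov a; first by rewrite lexx ab.
pose E := [set t | P i t /\ a <= t <= b].
have Ea : E a by split; rewrite ?lexx.
have Eub : has_sup E by split; [exists a|exists b => t [_ /andP[]]].
pose s := sup E.
have Es t : E t -> t <= s by move=> Et; apply: ub_le_sup => //; exact: (proj2 Eub).
have as_ : a <= s by exact: Es.
have sb : s <= b by apply: ge_sup; [exists a|move=> t [_ /andP[]]].
have Ps : P i s.
  apply: (cP i); apply: (@closure_subset _ E); first by move=> t [].
  by apply: closure_sup; [exact: (proj1 Eub)|exact: (proj2 Eub)].
have has : `|h s - h a| <= L * (s - a).
  by have := hP i s a Ps Pa; rewrite (@ger0_norm _ (s - a)) ?subr_ge0.
have [sb'|bs] := ltP s b; last first.
  by have <- : s = b by apply/eqP; rewrite eq_le sb bs.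
pose F := \bigcup_(j in [set` A :\ i]) P j.
have cF : closed F by apply: closed_bigcup => //; exact: finite_finset.
have sF t : s < t <= b -> F t.
  move=> /andP[st tb]; have atb : a <= t <= b by rewrite tb andbT ltW// (le_lt_trans as_).
  have [j jA Pt] := cov t atb; exists j => //=; rewrite !inE jA andbT.
  apply/eqP => ji; move: Pt; rewrite ji => Pt.
  by have := Es t (conj Pt atb); rewrite leNgt st.
have Fs : F s.
  apply: cF => B /nbhs_ballP[e /= e0 eB].
  pose t := Num.min (s + e / 2) b.
  have st : s < t by rewrite /t lt_min sb' andbT ltrDl divr_gt0.
  exists t; split; first by apply: sF; rewrite st ge_min lexx orbT.
  apply: eB; rewrite -ball_normE /= distrC ger0_norm ?subr_ge0 ?ltW//.
  by have : t <= s + e / 2; [rewrite /t ge_min lexx|lra].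
have card : (#|A :\ i| <= k)%N by rewrite -ltnS (leq_trans _ Ak)// [X in (_ < X)%N](cardsD1 i) iA.
have hsb : `|h b - h s| <= L * (b - s).
  apply: (IH (A :\ i)) => // t /andP[st tb].
  have [st'|] := ltP s t; first by have [|j jA Pt] := sF t; [rewrite st' tb|exists j].
  by move=> ts; have -> : t = s; [apply/eqP; rewrite eq_le ts st|have [j jA Pj] := Fs; exists j].
rewrite (_ : h b - h a = (h b - h s) + (h s - h a)); last ring.
by apply: le_trans (ler_normD _ _) _; lra.
Qed.

Lemma segment_lipschitz (R : realType) m (I : finType) (Q : I -> set 'rV[R]_m)
    (D : set 'rV[R]_m) (w : 'rV[R]_m -> R) L x (v : 'rV[R]_m) :
  (forall i, closed (Q i)) -> D `<=` \bigcup_i Q i ->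
  (forall i p q, D p -> D q -> Q i p -> Q i q -> `|w p - w q| <= L * `|p - q|) ->
  (forall u : R, 0 <= u <= 1 -> D (x + u *: v)) ->
  `|w (x + v) - w x| <= L * `|v|.
Proof.
move=> cQ DQ wL xD.
pose P i := [set u : R | 0 <= u <= 1] `&` [set u | Q i (x + u *: v)].
have := @covered_lipschitz R I P (fun u => w (x + u *: v)) (L * `|v|) _ _ [set: I] 0 1.
rewrite scale1r scale0r addr0 subr0 mulr1; apply => //.
- move=> i; apply: closedI.
    rewrite (_ : [set u | _] = `[0, 1]%classic); first exact: interval_closed.
    by apply/seteqP; split => u; rewrite /= in_itv.
  apply: (preimage_closed _ (cQ i)) => u _.
  apply: cvgD; first exact: cvg_cst.
  by apply: cvgZ; [exact: cvg_id|exact: cvg_cst].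
- move=> i s t [s01 Qs] [t01 Qt].
  apply: le_trans (wL i _ _ (xD _ s01) (xD _ t01) Qs Qt) _.
  by rewrite opprD addrACA subrr add0r -scalerBl normrZ (mulrC `|s - t|) mulrA.
- move=> t t01; have [i _ Qi] := DQ _ (xD _ t01).
  by exists i; rewrite ?inE.
Qed.

(** * Space-time prisms over isoparametric cells *)

Section coordinates.
Context {R : realType} {n : nat}.
Implicit Types (p q h : 'rV[R]_n.+1) (x : 'rV[R]_n) (y : R).

Lemma xpart_coord p j : xpart p ord0 j = p ord0 (lift ord_max j).
Proof. by rewrite mxE. Qed.

Lemma xpart_pt x y : xpart (pt x y) = x.
Proof. by apply/rowP => j; rewrite !mxE liftK. Qed.

Lemma ypart_pt x y : ypart (pt x y) = y.
Proof. by rewrite /ypart mxE unlift_none. Qed.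

Lemma pt_parts p : pt (xpart p) (ypart p) = p.
Proof.
apply/rowP => i; rewrite mxE; case: (unliftP ord_max i) => [j ->|->//].
by rewrite mxE.
Qed.

Lemma xpartD p q : xpart (p + q) = xpart p + xpart q.
Proof. by apply/rowP => j; rewrite !mxE. Qed.

Lemma xpartB p q : xpart (p - q) = xpart p - xpart q.
Proof. by apply/rowP => j; rewrite !mxE. Qed.

Lemma ypartB p q : ypart (p - q) = ypart p - ypart q.
Proof. by rewrite /ypart !mxE. Qed.

Lemma xpart_norm p : `|xpart p| <= `|p|.
Proof.
by apply: norm_le_coord => // j; rewrite xpart_coord; exact: coord_le_norm.
Qed.

Lemma ypart_norm p : `|ypart p| <= `|p|. Proof. exact: coord_le_norm. Qed.

Lemma norm_parts p c : 0 <= c -> `|xpart p| <= c -> `|ypart p| <= c -> `|p| <= c.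
Proof.
move=> c0 xc yc; apply: norm_le_coord => // i.
case: (unliftP ord_max i) => [j ->|->//].
by rewrite -xpart_coord; apply: le_trans (coord_le_norm _ _) xc.
Qed.

Lemma ptB x x' y y' : pt x y - pt x' y' = pt (x - x') (y - y').
Proof. by apply/rowP => i; rewrite !mxE; case: unliftP => [j _|_]; rewrite ?mxE. Qed.

Lemma norm_pt_le x y c : 0 <= c -> `|x| <= c -> `|y| <= c -> `|pt x y| <= c.
Proof. by move=> c0 xc yc; apply: norm_parts; rewrite ?xpart_pt ?ypart_pt. Qed.

Lemma norm_pt_x x y : `|x| <= `|pt x y|.
Proof. by rewrite -{1}(xpart_pt x y); exact: xpart_norm. Qed.

Lemma norm_pt_y x y : `|y| <= `|pt x y|.
Proof. by rewrite -{1}(ypart_pt x y); exact: ypart_norm. Qed.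

Lemma xpart_continuous : continuous (@xpart R n).
Proof.
move=> p; apply/(@cvgrPdist_le _ _ _ (nbhs p) _ (@xpart R n) (xpart p)) => e e0.
apply/nbhs_rowP; exists e => // q qp.
rewrite distrC -xpartB; apply: le_trans (xpart_norm _) (ltW qp).
Qed.

Lemma ypart_continuous : continuous (@ypart R n).
Proof. exact: coord_continuous. Qed.

Lemma has_grad_xpart (f : 'rV[R]_n -> R) p a : has_grad f (xpart p) a ->
  has_grad (f \o xpart) p (pt a 0).
Proof.
move=> [C C0 fC]; exists C => // h h1; rewrite /= xpartD.
have -> : dotv (pt a 0) h = dotv a (xpart h).
  rewrite /dotv (bigD1_ord ord_max)//= mxE unlift_none mul0r add0r.
  by apply: eq_bigr => j _; rewrite !mxE liftK.
apply: le_trans (fC _ (le_trans (xpart_norm h) h1)) _.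
by rewrite ler_wpM2l// ler_pXn2r ?nnegrE//; exact: xpart_norm.
Qed.

Lemma smooth_xpart (f : 'rV[R]_n -> R) : smooth f ->
  smooth (fun p => f (xpart p)).
Proof.
move=> [G [fG Gc]]; exists (fun p => pt (G (xpart p)) 0); split=> [p|i].
  exact: has_grad_xpart.
case: (unliftP ord_max i) => [j ->|->].
  rewrite (_ : (fun p => _) = (fun p => G (xpart p) ord0 j)).
    by move=> p; exact: (continuous_comp (@xpart_continuous p) (Gc j (xpart p))).
  by apply/funext => p; rewrite mxE liftK.
rewrite (_ : (fun p => _) = (fun=> 0)); first by move=> p; exact: cst_continuous.
by apply/funext => p; rewrite mxE unlift_none.
Qed.

Lemma smooth_ypart : smooth (@ypart R n).
Proof. exact: smooth_coord. Qed.

Lemma Qpoly_smooth k (f : 'rV[R]_n -> R) : Qpoly k f -> smooth f.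
Proof.
move=> [c ->]; apply: smooth_sum => e; apply: smoothM; first exact: smooth_cst.
by apply: smooth_prod => i; apply: smoothX; exact: smooth_coord.
Qed.

Lemma Ppoly_smooth k (f : 'rV[R]_n -> R) : Ppoly k f -> smooth f.
Proof. by move=> [c _ ->]; apply: (@Qpoly_smooth k); exists c. Qed.

Lemma ref_P1_smooth sh (f : 'rV[R]_n -> R) : ref_P1 sh f -> smooth f.
Proof. by case: sh => /=; [exact: Ppoly_smooth|exact: Qpoly_smooth]. Qed.

Lemma ref_P2_smooth sh (b f : 'rV[R]_n -> R) : (sh = Simplex -> is_bubble b) ->
  ref_P2 sh b f -> smooth f.
Proof.
case: sh => /= bP; last exact: Qpoly_smooth.
move=> [q /Ppoly_smooth qs [c ->]]; have [/Ppoly_smooth bs _ _] := bP erefl.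
by apply: smoothD => //; apply: smoothM => //; exact: smooth_cst.
Qed.

Lemma tensor_poly_smooth (P : set ('rV[R]_n -> R)) k u :
  (forall f, P f -> smooth f) -> tensor_poly P k u ->
  smooth (fun p => u (xpart p) (ypart p)).
Proof.
move=> Ps [a Pa ->]; apply: smooth_sum => j; apply: smoothM.
  by apply: smooth_xpart; exact: Ps.
by apply: smoothX; exact: smooth_ypart.
Qed.

(** Mesh regularity is measured in the Euclidean norm, whereas the topology of
    row vectors comes from the sup norm. *)
Lemma norm_le_enorm x : `|x| <= enorm x.
Proof.
apply: norm_le_coord => [|i]; first exact: sqrtr_ge0.
rewrite -sqrtr_sqr; apply: ler_wsqrtr; rewrite /dotv (bigD1 i)//= expr2 lerDl.
by apply: sumr_ge0 => j _; rewrite -expr2 sqr_ge0.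
Qed.

Lemma enorm_le_norm x : enorm x <= n.+1%:R * `|x|.
Proof.
rewrite -[leRHS]ger0_norm ?mulr_ge0// -sqrtr_sqr; apply: ler_wsqrtr.
apply: (@le_trans _ _ (\sum_(i < n) `|x| ^+ 2)).
  apply: ler_sum => i _; rewrite -expr2 -real_normK ?num_real//.
  by rewrite ler_pXn2r ?nnegrE//; exact: coord_le_norm.
rewrite sumr_const card_ord -[leLHS]mulr_natl exprMn ler_wpM2r ?sqr_ge0//.
by rewrite -natrX ler_nat expnS mulSn expn1; lia.
Qed.

End coordinates.

Lemma smooth_map_continuous (R : realType) m p (Phi : 'rV[R]_m -> 'rV[R]_p) :
  (forall j, smooth (fun x => Phi x ord0 j)) -> continuous Phi.
Proof.
move=> Phis x; have [L L0 LP] := smooth_map_lipschitz (`|x| + 1) Phis.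
apply/(@cvgrPdist_le _ _ _ (nbhs x) _ Phi (Phi x)) => e e0; apply/nbhs_rowP.
exists (Num.min (1 : R) (e / (L + 1))).
  by rewrite lt_min ltr01 divr_gt0// ltr_wpDl.
move=> y; rewrite lt_min => /andP[/ltW y1]; rewrite ltr_pdivlMr ?ltr_wpDl// => ye.
have yx : `|y| <= `|x| + 1.
  rewrite -(subrK x y); apply: le_trans (ler_normD _ _) _.
  by rewrite addrC lerD2l.
apply: le_trans (LP _ _ _ yx) _; first by rewrite lerDl.
rewrite distrC; apply: le_trans (ltW ye).
by rewrite mulrC ler_wpM2l// lerDl.
Qed.

Lemma negligible_finite (R : realType) m (I : finType) (F : I -> set 'rV[R]_m) :
  (forall i, (lebesgue_row R m).-negligible (F i)) ->
  (lebesgue_row R m).-negligible (\bigcup_i F i).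
Proof.
move=> nF.
pose G k := if unpickle k is Some i then F i else set0.
apply: (@negligibleS _ _ _ _ (\bigcup_k G k)).
  by move=> x [i _ Fx]; exists (pickle i) => //; rewrite /G pickleK.
apply: negligible_bigcup => k; rewrite /G; case: unpickle => // .
exact: negligible_set0.
Qed.

Lemma ae_finite (R : realType) m (I : finType) (P : I -> 'rV[R]_m -> Prop) :
  (forall i, {ae lebesgue_row R m, forall x, P i x}) ->
  {ae lebesgue_row R m, forall x i, P i x}.
Proof.
move=> aeP.
have := negligible_finite (F := fun i => ~` [set x | P i x]) aeP.
by apply: negligibleS => x /existsNP[i Nx]; exists i.
Qed.

Section prism.
Context {R : realType} {n : nat}.
Implicit Types (K : cell R n) (x : 'rV[R]_n) (p q : 'rV[R]_n.+1) (y : R).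

(** Strict inequalities rather than the topological interior: the complement in
    the reference element is then visibly contained in finitely many hyperplanes. *)
Definition ref_core (sh : Defs.shape) : set 'rV[R]_n :=
  match sh with
  | Simplex => [set x | forall i, 0 < bary x i]
  | Cube => [set x | forall i, 0 < x ord0 i < 1]
  end.

Definition ref_prism K y0 y1 : set 'rV[R]_n.+1 :=
  [set q | ref_element R n (cell_shape K) (xpart q) /\ y0 <= ypart q <= y1].

Definition ref_prism_core K y0 y1 : set 'rV[R]_n.+1 :=
  [set q | ref_core (cell_shape K) (xpart q) /\ y0 < ypart q < y1].

Definition prism_map K q : 'rV[R]_n.+1 := pt (cell_map K (xpart q)) (ypart q).

Definition prism K y0 y1 := prism_map K @` ref_prism K y0 y1.
Definition prism_core K y0 y1 := prism_map K @` ref_prism_core K y0 y1.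

Lemma prismP K y0 y1 p :
  prism K y0 y1 p <-> cell_set K (xpart p) /\ y0 <= ypart p <= y1.
Proof.
split=> [[q [Eq yq] <-]|[[x Ex xp] yp]].
  by rewrite xpart_pt ypart_pt; split => //; exists (xpart q).
exists (pt x (ypart p)); first by split; rewrite ?xpart_pt ?ypart_pt.
by rewrite /prism_map xpart_pt ypart_pt xp pt_parts.
Qed.

Lemma prism_core_sub K y0 y1 p : prism_core K y0 y1 p ->
  cell_set K (xpart p) /\ y0 < ypart p < y1.
Proof.
move=> [q [Eq yq] <-]; rewrite xpart_pt ypart_pt; split => //; exists (xpart q) => //.
move: Eq; rewrite /ref_core /ref_element; case: (cell_shape K) => Eq i.
  exact: ltW.
by have /andP[/ltW -> /ltW ->] := Eq i.
Qed.

Lemma ref_prism_core_sub K y0 y1 : ref_prism_core K y0 y1 `<=` ref_prism K y0 y1.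
Proof.
move=> q [Eq /andP[/ltW y0q /ltW qy1]]; split; last by rewrite y0q.
move: Eq; rewrite /ref_core /ref_element; case: (cell_shape K) => Eq i.
  exact: ltW.
by have /andP[/ltW -> /ltW ->] := Eq i.
Qed.

Lemma bary_continuous (i : 'I_n.+1) : continuous (fun x => bary x i).
Proof.
rewrite /bary; case: (unlift ord0 i) => [j|]; first exact: coord_continuous.
have s : smooth (fun x : 'rV[R]_n => 1 - \sum_j x ord0 j).
  apply: smoothB; first exact: smooth_cst.
  by apply: smooth_sum => j; exact: smooth_coord.
exact: smooth_continuous.
Qed.

Lemma ref_element_bounded sh x : ref_element R n sh x -> `|x| <= 1.
Proof.
case: sh => /= Ex; apply: norm_le_coord => // i; last first.
  by have /andP[h0 h1] := Ex i; rewrite ger0_norm.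
have pos j : 0 <= x ord0 j by have := Ex (lift ord0 j); rewrite /bary liftK.
rewrite ger0_norm//; have := Ex ord0; rewrite /bary unlift_none subr_ge0.
by apply: le_trans; rewrite (bigD1 i)//= lerDl; exact: sumr_ge0.
Qed.

Lemma ref_element_closed sh : closed (ref_element R n sh).
Proof.
case: sh => /=.
  rewrite [X in closed X](_ : _ = \bigcap_(i in [set: 'I_n.+1]) [set x | 0 <= bary x i]).
    apply: closed_bigI => i _; apply: (preimage_closed _ (@closed_ge R 0)) => x _.
    exact: bary_continuous.
  by apply/seteqP; split => x /= xi i; [move=> _|]; exact: xi.
rewrite [X in closed X](_ : _ =
    \bigcap_(i in [set: 'I_n]) (fun x : 'rV[R]_n => x ord0 i) @^-1` `[0, 1]%classic).
  apply: closed_bigI => i _; apply: preimage_closed; last exact: interval_closed.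
  by move=> x _; exact: coord_continuous.
apply/seteqP; split => x /= xi i; first by move=> _; rewrite /= in_itv; exact: xi.
by have := xi i Logic.I; rewrite /= in_itv.
Qed.

Lemma ref_core_open sh : open (ref_core sh).
Proof.
case: sh => /=.
  rewrite [X in open X](_ : _ = ~` \bigcup_(i in [set: 'I_n.+1]) [set x | bary x i <= 0]).
    apply: closed_openC; apply: closed_bigcup => [|i _]; first exact: finite_finset.
    by apply: (preimage_closed _ (@closed_le R 0)) => x _; exact: bary_continuous.
  apply/seteqP; split => x /= xi.
    by move=> [i _ /=]; rewrite leNgt xi.
  by move=> i; rewrite ltNge; apply/negP => h; apply: xi; exists i.
rewrite [X in open X](_ : _ =
    ~` \bigcup_(i in [set: 'I_n]) (fun x : 'rV[R]_n => x ord0 i) @^-1` ~` `]0, 1[%classic).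
  apply: closed_openC; apply: closed_bigcup => [|i _]; first exact: finite_finset.
  apply: preimage_closed; first by move=> x _; exact: coord_continuous.
  by apply: open_closedC; exact: interval_open.
apply/seteqP; split => x /= xi.
  by move=> [i _ /=]; apply; rewrite in_itv /=; exact: xi.
move=> i; have [//|h] := boolP (0 < x ord0 i < 1).
by case: xi; exists i => //=; rewrite in_itv /=; exact/negP.
Qed.

Lemma ref_prism_core_open K y0 y1 : open (ref_prism_core K y0 y1).
Proof.
rewrite (_ : ref_prism_core _ _ _ = (@xpart R n) @^-1` ref_core (cell_shape K) `&`
    (@ypart R n) @^-1` `]y0, y1[%classic).
  apply: openI.
    by apply: open_comp (@ref_core_open _) => q _; exact: xpart_continuous.
  by apply: open_comp (interval_open _ _) => // q _; exact: ypart_continuous.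
by apply/seteqP; split => q /= [Eq yq]; split => //; move: yq; rewrite /= in_itv.
Qed.

Lemma ref_prism_bounded K y0 y1 q : ref_prism K y0 y1 q ->
  `|q| <= 1 + `|y0| + `|y1|.
Proof.
move=> [Eq /andP[yq1 yq2]]; apply: norm_parts; first by rewrite !addr_ge0.
  by apply: le_trans (ref_element_bounded Eq) _; rewrite -addrA lerDl addr_ge0.
rewrite ler_norml; have := ler_norm y1; have := ler_norm (- y0); rewrite normrN.
have := normr_ge0 y1; have := normr_ge0 y0 => h1 h2 h3 h4.
by apply/andP; split; lra.
Qed.

Lemma ref_prism_compact K y0 y1 : compact (ref_prism K y0 y1).
Proof.
apply: bounded_closed_compact.
  exists (1 + `|y0| + `|y1|); split => [|M yM q /ref_prism_bounded]; first exact: num_real.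
  by move=> /le_trans; apply; exact: ltW.
rewrite (_ : ref_prism _ _ _ = (@xpart R n) @^-1` ref_element R n (cell_shape K) `&`
    (@ypart R n) @^-1` `[y0, y1]%classic).
  apply: closedI.
    by apply: (preimage_closed _ (@ref_element_closed _)) => q _; exact: xpart_continuous.
  by apply: (preimage_closed _ (interval_closed _ _)) => // q _; exact: ypart_continuous.
by apply/seteqP; split => q /= [Eq yq]; split => //; move: yq; rewrite /= in_itv.
Qed.

Lemma prism_map_smooth K : isoparametric K ->
  forall j, smooth (fun q => prism_map K q ord0 j).
Proof.
move=> [FP _] j; case: (unliftP ord_max j) => [i ->|->].
  rewrite (_ : (fun q => _) = (fun q => cell_map K (xpart q) ord0 i)).
    apply: (smooth_xpart (f := fun x => cell_map K x ord0 i)).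
    exact: ref_P1_smooth (FP i).
  by apply/funext => q; rewrite mxE liftK.
rewrite (_ : (fun q => _) = (@ypart R n)); first exact: smooth_ypart.
by apply/funext => q; rewrite mxE unlift_none.
Qed.

Lemma prism_closed K y0 y1 : isoparametric K -> closed (prism K y0 y1).
Proof.
move=> hK; apply: compact_row_closed; apply: continuous_compact.
  by apply: continuous_subspaceT; apply: smooth_map_continuous; exact: prism_map_smooth.
exact: ref_prism_compact.
Qed.

(** Only on the reference prism: nothing is known of the parametrization of a
    cell outside the reference element, where it may fold. *)
Lemma prism_map_lower_lipschitz K y0 y1 : isoparametric K -> exists2 c : R, 0 < c &
  forall p q, ref_prism K y0 y1 p -> ref_prism K y0 y1 q ->
    c * `|p - q| <= `|prism_map K p - prism_map K q|.
Proof.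
move=> [_ [c c0 cP]]; have n0 : 0 < n.+1%:R :> R by rewrite ltr0n.
exists (Num.min (c / n.+1%:R) 1); first by rewrite lt_min divr_gt0/=.
set d := Num.min _ _; have d0 : 0 < d by rewrite lt_min divr_gt0/=.
move=> p q [Ep _] [Eq _]; rewrite -ler_pdivlMl//.
apply: norm_parts; first by rewrite mulr_ge0// invr_ge0 ltW.
  rewrite ler_pdivlMl// xpartB.
  apply: (@le_trans _ _ (c / n.+1%:R * `|xpart p - xpart q|)).
    by rewrite ler_wpM2r// ge_min lexx.
  rewrite mulrAC ler_pdivrMr// mulrC.
  apply: (@le_trans _ _ (c * enorm (xpart p - xpart q))).
    by rewrite mulrC ler_wpM2l ?(ltW c0)// norm_le_enorm.
  apply: le_trans (cP _ _ Ep Eq) _; apply: le_trans (enorm_le_norm _) _.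
  by rewrite mulrC ler_wpM2r// ptB norm_pt_x.
rewrite ler_pdivlMl// ypartB; apply: (@le_trans _ _ `|ypart p - ypart q|).
  by rewrite ler_piMl// ge_min lexx orbT.
by rewrite ptB norm_pt_y.
Qed.

(** The faces of a reference prism lie in hyperplanes. *)
Lemma prism_boundary_null K y0 y1 : (0 < n)%N -> isoparametric K ->
  (lebesgue_row R n.+1).-negligible (prism K y0 y1 `\` prism_core K y0 y1).
Proof.
move=> n0 hK.
pose S := ref_prism K y0 y1 `\` ref_prism_core K y0 y1.
apply: (@negligibleS _ _ _ _ (prism_map K @` S)).
  by move=> _ [[q Eq <-] Nq]; exists q => //; split => // Cq; apply: Nq; exists q.
pose ex (j : 'I_n) : 'rV[R]_n.+1 := delta_mx ord0 (lift ord_max j).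
pose I : finType := ('I_n * bool + bool)%type.
pose a (i : option I) : 'rV[R]_n.+1 :=
  match i with
  | None => pt (const_mx 1) 0
  | Some (inl (j, _)) => ex j
  | Some (inr _) => delta_mx ord0 ord_max
  end.
pose b (i : option I) : R :=
  match i with
  | None => 1
  | Some (inl (_, e)) => e%:R
  | Some (inr e) => if e then y1 else y0
  end.
have delta0 k : delta_mx ord0 k != 0 :> 'rV[R]_n.+1.
  by apply/eqP => /rowP/(_ k); rewrite !mxE !eqxx => /eqP; rewrite oner_eq0.
have a0 i : a i != 0.
  case: i => [[[j e]|e]|]; [exact: delta0|exact: delta0|].
  apply/eqP => /rowP/(_ (lift ord_max (Ordinal n0))); rewrite !mxE liftK mxE => /eqP.
  by rewrite oner_eq0.
apply: (@negligibleS _ _ _ _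
    (\bigcup_i (prism_map K @` (S `&` [set q | dotv (a i) q = b i])))); last first.
  apply: negligible_finite => i.
  apply: (hyperplane_image_null (a := a i) (b := b i) (r := 1 + `|y0| + `|y1|)) => //.
  - exact: prism_map_smooth.
  - by move=> q [[/ref_prism_bounded]].
  - by move=> q [].
move=> _ [q Sq <-].
suff [i qi] : exists i, dotv (a i) q = b i by exists i => //; exists q.
have dx j e : xpart q ord0 j = (e : bool)%:R -> exists i, dotv (a i) q = b i.
  by move=> h; exists (Some (inl (j, e))); rewrite /= dotvC dotv_delta -h mxE.
have dy e : ypart q = (if e then y1 else y0) -> exists i, dotv (a i) q = b i.
  by move=> h; exists (Some (inr e)); rewrite /= dotvC dotv_delta.
have dsum : \sum_j xpart q ord0 j = 1 -> exists i, dotv (a i) q = b i.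
  move=> h; exists None; rewrite /= /dotv (bigD1_ord ord_max)//= mxE unlift_none mul0r add0r.
  by rewrite -[RHS]h; apply: eq_bigr => j _; rewrite !mxE liftK mxE mul1r.
have [[Eq /andP[yq0 yq1]] Nq] := Sq.
have [e0|ne0] := eqVneq (ypart q) y0; first exact: (dy false).
have [e1|ne1] := eqVneq (ypart q) y1; first exact: (dy true).
have yq : y0 < ypart q < y1 by rewrite !lt_neqAle yq0 yq1 eq_sym ne0 ne1.
have {}Nq : ~ ref_core (cell_shape K) (xpart q) by move=> Cq; apply: Nq.
move: Eq Nq; rewrite /ref_core /ref_element; case: (cell_shape K) => Eq /existsNP[i Ni].
  have {Ni} : bary (xpart q) i = 0.
    by apply/eqP; rewrite eq_le Eq andbT leNgt; apply/negP.
  rewrite /bary; case: unliftP => [j _|_ /eqP]; first exact: (dx _ false).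
  by rewrite subr_eq0 eq_sym => /eqP; exact: dsum.
have /andP[h0 h1] := Eq i.
have [e0|ne0'] := eqVneq (xpart q ord0 i) 0; first exact: (dx i false).
have [e1|ne1'] := eqVneq (xpart q ord0 i) 1; first exact: (dx i true).
by case: Ni; rewrite !lt_neqAle h0 h1 eq_sym ne0' ne1'.
Qed.

End prism.

Lemma within_continuous_measurable (R : realType) m (D A : set 'rV[R]_m)
    (w : 'rV[R]_m -> R) : open D -> D `<=` A -> {within A, continuous w} ->
  measurable_fun D w.
Proof.
move=> oD DA /(continuous_subspaceW DA).
rewrite continuous_open_subspace// => cw.
apply: (measurability _ (RGenOInfty.measurableE R)).
move=> _ [_ [a [-> <-]]]; apply: open_row_measurable.
rewrite openE => x [Dx wx].
have : nbhs x (w @^-1` `]a, +oo[%classic).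
  by apply: (cw x (mem_set Dx)); apply: open_nbhs_nbhs; split => //; exact: interval_open.
by move=> ?; apply: filterI => //; exact: open_nbhs_nbhs.
Qed.

(** Each chart gives a Lipschitz bound on its prism, and these bounds chain along
    the segments that stay in [D]. In the cores of the prisms the difference quotients
    converge because [w] is smooth in the chart; the prism boundaries are null.
    The open set [W], where [w] vanishes locally, covers what the prisms leave
    out, and the larger closed set [Z] plays the part of one more prism. *)
Lemma piecewise_weak_partial (R : realType) n (D : set 'rV[R]_n.+1)
    (w : 'rV[R]_n.+1 -> R) (I : finType) (K : I -> cell R n) (y0 y1 : I -> R)
    (U : I -> 'rV[R]_n.+1 -> R) (Z W : set 'rV[R]_n.+1) (i : 'I_n.+1) :
  (0 < n)%N -> open D -> measurable_fun D w ->
  (forall j, isoparametric (K j)) -> (forall j, smooth (U j)) ->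
  (forall j q, ref_prism (K j) (y0 j) (y1 j) q -> w (prism_map (K j) q) = U j q) ->
  closed Z -> open W -> W `<=` Z -> (forall x, D x -> Z x -> w x = 0) ->
  D `<=` (\bigcup_j prism (K j) (y0 j) (y1 j)) `|` W ->
  exists L, exists g : 'rV[R]_n.+1 -> R,
    [/\ measurable_fun setT g, forall x, `|g x| <= L & is_weak_partial D w i g].
Proof.
move=> n0 oD mw isoK Us wU cZ oW WZ wZ Dcov; pose e : 'rV[R]_n.+1 := delta_mx ord0 i.
have exL j : exists L : R, 0 <= L /\ forall p q,
    prism (K j) (y0 j) (y1 j) p -> prism (K j) (y0 j) (y1 j) q ->
    `|w p - w q| <= L * `|p - q|.
  have [c c0 cP] := prism_map_lower_lipschitz (y0 j) (y1 j) (isoK j).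
  have [L L0 LP] := smooth_lipschitz (1 + `|y0 j| + `|y1 j|) (Us j).
  exists (L / c); split; first by rewrite divr_ge0// ltW.
  move=> _ _ [p Ep <-] [q Eq <-]; rewrite !wU//.
  apply: le_trans (LP _ _ (ref_prism_bounded Eq) (ref_prism_bounded Ep)) _.
  rewrite -mulrA ler_wpM2l// mulrC ler_pdivlMr// mulrC; exact: cP.
have [L LP] := choice exL.
have exM j : exists M : R, 0 <= M /\ forall p, prism (K j) (y0 j) (y1 j) p -> `|w p| <= M.
  have /compact_bounded[M [_ MP]] : compact (U j @` ref_prism (K j) (y0 j) (y1 j)).
    apply: continuous_compact; last exact: ref_prism_compact.
    by apply: continuous_subspaceT; exact: smooth_continuous.
  exists (`|M| + 1); split => [|_ [q Eq <-]]; first by rewrite addr_ge0.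
  rewrite wU//; apply: MP; last by exists q.
  by apply: le_lt_trans (ler_norm _) _; rewrite ltrDl.
have [M MP] := choice exM.
pose LL := \sum_j L j; pose MM := \sum_j M j.
have L_le j : L j <= LL.
  by rewrite /LL (bigD1 j)//= lerDl; apply: sumr_ge0 => k _; have [] := LP k.
have LL0 : 0 <= LL by apply: sumr_ge0 => k _; have [] := LP k.
have MM0 : 0 <= MM by apply: sumr_ge0 => k _; have [] := MP k.
exists LL; apply: (weak_partial_quotients (M := MM)) => //.
- exact: open_row_measurable.
- move=> x Dx; have [[j _ xj]|Wx] := Dcov x Dx; last first.
    by rewrite wZ// ?normr0//; exact: WZ.
  apply: le_trans (proj2 (MP j) _ xj) _.
  by rewrite /MM (bigD1 j)//= lerDl; apply: sumr_ge0 => k _; have [] := MP k.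
- move=> x t; rewrite -/e => seg.
  pose Q (j : option I) := if j is Some k then prism (K k) (y0 k) (y1 k) else Z.
  apply: (@le_trans _ _ (LL * `|t *: e|)); last first.
    rewrite ler_wpM2l// normrZ ler_piMr//; exact: norm_delta_le1.
  apply: (@segment_lipschitz _ _ (option I) Q D).
  + by case=> [j|] //=; exact: prism_closed.
  + move=> y Dy; have [[j _ yj]|Wy] := Dcov y Dy; first by exists (Some j).
    by exists None => //; exact: WZ.
  + case=> [j|] p q Dp Dq /= Qp Qq; last by rewrite !wZ// subrr normr0 mulr_ge0.
    by apply: le_trans (proj2 (LP j) _ _ Qp Qq) _; rewrite ler_wpM2r.
  + by move=> u u01; rewrite scalerA; apply: interior_subset; exact: seg.
have nullN : (lebesgue_row R n.+1).-negligible
    (\bigcup_j (prism (K j) (y0 j) (y1 j) `\` prism_core (K j) (y0 j) (y1 j))).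
  by apply: negligible_finite => j; exact: prism_boundary_null.
apply: negligibleS nullN => x /= Nx; apply: contrapT => Nb; apply: Nx => Dx.
have [[j _ xj]|Wx] := Dcov x (interior_subset Dx).
  have [q Cq <-] : prism_core (K j) (y0 j) (y1 j) x.
    by apply: contrapT => Nc; apply: Nb; exists j.
  have [c c0 cP] := prism_map_lower_lipschitz (y0 j) (y1 j) (isoK j).
  apply: (chart_quotient_cvg (O := ref_prism_core (K j) (y0 j) (y1 j)) (c := c) (U := U j)) => //.
  - exact: prism_map_smooth.
  - exact: ref_prism_core_open.
  - by move=> p p' Cp Cp'; apply: cP; exact: ref_prism_core_sub.
  - by move=> p Cp; apply: wU; exact: ref_prism_core_sub.
have /nbhs_rowP[d d0 dP] : nbhs x (D `&` W).
  by apply: open_nbhs_nbhs; split; [exact: openI|split => //; exact: interior_subset].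
have [N _ Nd] := near_infty_natSinv_lt (PosNum d0).
apply/cvg_ex; exists (0 : R); apply: (cvg_of_rate (K := 0) (N := N)) => k /Nd /= kd.
have [Dk Wk] : (D `&` W) (x - k.+1%:R^-1 *: e).
  apply: dP; rewrite addrAC subrr add0r normrN normrZ gtr0_norm ?invr_gt0//.
  by apply: le_lt_trans kd; rewrite ler_piMr ?invr_ge0//; exact: norm_delta_le1.
rewrite (wZ _ Dk (WZ _ Wk)) (wZ x (interior_subset Dx) (WZ _ Wx)).
by rewrite !subrr mulr0 subr0 normr0 mul0r.
Qed.

(** * Calculus of weak gradients *)

Section weak_calculus.
Import HBNNSimple.
Context {R : realType} {m : nat}.
Local Notation mu := (lebesgue_row R m).
Implicit Types (D : set 'rV[R]_m) (v w g om : 'rV[R]_m -> R).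

(** The choice made in the definition of [weak_partial] is legitimate as soon
    as some weak derivative exists. *)
Lemma weak_partialP D w i g : is_weak_partial D w i g ->
  is_weak_partial D w i (weak_partial D w i).
Proof. by move=> wg; apply: (@xgetPex _ _ [set g | is_weak_partial D w i g]); exists g. Qed.

Lemma weak_partial_aeE D w i g : measurable D -> is_weak_partial D w i g ->
  {ae mu, forall x, D° x -> weak_partial D w i x = g x}.
Proof. by move=> mD wg; exact: (weak_partial_ae_eq mD (weak_partialP wg) wg). Qed.

Lemma locally_integrableB D v w : locally_integrable_on D v ->
  locally_integrable_on D w -> locally_integrable_on D (v \- w).
Proof.
move=> [mv iv] [mw iw]; split; first exact: measurable_funB.
move=> K cK KD; have mK := compact_row_measurable cK.
by have := integrableB mK (iv _ cK KD) (iw _ cK KD); apply: eq_integrable.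
Qed.

Lemma is_weak_partialB D v w i gv gw : measurable D ->
  is_weak_partial D v i gv -> is_weak_partial D w i gw ->
  is_weak_partial D (v \- w) i (gv \- gw).
Proof.
move=> mD [lv lgv pv] [lw lgw pw]; split; [exact: locally_integrableB..|].
move=> phi tphi; have [C [phiC dphiC]] := test_function_bounds tphi.
have [dphi cphi cK KD] := tphi.
have mphi := test_function_measurable tphi.
have mdphi : measurable_fun setT (partial phi i) by exact: continuous_row_measurable.
have int h : locally_integrable_on D h -> mu.-integrable D (fun x => (h x * phi x)%:E).
  by move=> lh; exact: (integrable_locally_mul mD lh cK KD mphi phiC (@closure_supportN0 _ _ phi)).
have intp h : locally_integrable_on D h ->
    mu.-integrable D (fun x => (h x * partial phi i x)%:E).
  move=> lh; exact: (integrable_locally_mul mD lh cK KD mdphi (dphiC i)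
    (@closure_support_partial0 _ _ phi i)).
under eq_Rintegral do rewrite mulrBl.
under [in RHS]eq_Rintegral do rewrite mulrBl.
rewrite RintegralB//; [|exact: intp..].
rewrite RintegralB//; [|exact: int..].
by rewrite pv// pw// opprB opprK addrC.
Qed.

Lemma is_weak_partial0 D i : measurable D ->
  is_weak_partial D (fun=> 0) i (fun=> 0).
Proof.
move=> mD; have l0 : locally_integrable_on D (fun=> 0 : R).
  split; first exact: measurable_cst.
  by move=> K cK _; exact: integrable0.
have z (psi : 'rV[R]_m -> R) : \int[mu]_(x in D) (0 * psi x) = 0.
  by under eq_Rintegral do rewrite mul0r; rewrite Rintegral_cst// mul0r.
by split => // phi _; rewrite !z oppr0.
Qed.

(** A test function on the smaller set is one on the larger set. *)
Lemma is_weak_partial_restrict D D' w w' i g : D'° `<=` D ->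
  (forall x, D'° x -> w' x = w x) -> measurable_fun D' w' -> measurable_fun setT g ->
  is_weak_partial D w i g -> is_weak_partial D' w' i g.
Proof.
move=> D'D w'w mw' mg [[_ iw] [_ ig] wg].
have oD'D : D'° `<=` D° by rewrite -(@open_subsetE _ D'°)//; exact: open_interior.
split.
- split => // K cK KD'; have mK := compact_row_measurable cK.
  have := iw _ cK (subset_trans KD' oD'D); apply: eq_integrable => // x /set_mem Kx.
  by rewrite /= w'w//; exact: KD'.
- split; first exact: measurable_funTS.
  by move=> K cK KD'; apply: ig => //; exact: subset_trans oD'D.
move=> phi [dphi cphi cK KD'].
have tphi : test_function D phi by split => //; exact: subset_trans oD'D.
have eqi (h h' psi : 'rV[R]_m -> R) : (forall x, D'° x -> h' x = h x) ->
    (forall x, ~ closure [set x | phi x != 0] x -> psi x = 0) ->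
    \int[mu]_(x in D') (h' x * psi x) = \int[mu]_(x in D) (h x * psi x).
  move=> hh' psi0; rewrite /Rintegral [in LHS]integral_mkcond [in RHS]integral_mkcond.
  congr fine; apply: eq_integral => x _; rewrite !patchE.
  have [Kx|Kx] := pselect (closure [set x | phi x != 0] x).
    have D'x := KD' _ Kx.
    by rewrite !mem_set ?hh'//; [exact: D'D|exact: interior_subset].
  by rewrite psi0// !mulr0; case: ifPn; case: ifPn.
rewrite (eqi w w' _ w'w (@closure_support_partial0 _ _ phi i)) wg//.
by rewrite (eqi g g _ (fun _ _ => erefl) (@closure_supportN0 _ _ phi)).
Qed.

(** Values on a null set do not matter, even non-measurable ones: a simple
    function below [f] on [B] is, almost everywhere, one below [f] on [A]. *)
Lemma ge0_integral_null_ext (A B : set 'rV[R]_m) (f : 'rV[R]_m -> \bar R) :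
  measurable A -> A `<=` B -> mu.-negligible (B `\` A) -> measurable_fun A f ->
  (forall x, 0 <= f x)%E -> (\int[mu]_(x in B) f x = \int[mu]_(x in A) f x)%E.
Proof.
move=> mA AB [N [mN N0 BAN]] mf f0.
have fA0 x : (0 <= (f \_ A) x)%E by rewrite patchE; case: ifP.
have fB0 x : (0 <= (f \_ B) x)%E by rewrite patchE; case: ifP.
have mfA : measurable_fun setT (f \_ A) by exact/(measurable_restrictT _ mA).
have fAB x : ((f \_ A) x <= (f \_ B) x)%E.
  rewrite !patchE; case: ifPn => [/set_mem Ax|_]; first by rewrite mem_set//; exact: AB.
  by case: ifP.
rewrite [LHS]integral_mkcond [RHS]integral_mkcond; apply/eqP; rewrite eq_le; apply/andP; split.
  rewrite [leLHS]ge0_integralTE//; apply: ge_ereal_sup => _ [h hf <-].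
  rewrite -integralT_nnsfun.
  apply: ae_ge0_le_integral => //.
  - by move=> x _; rewrite lee_fin.
  - by apply/measurable_EFinP; exact: measurable_funP.
  exists N; split => // x /= Nx; apply: BAN.
  apply: contrapT => BAx; apply: Nx => _.
  apply: le_trans (hf x) _; rewrite !patchE.
  case: ifPn => [/set_mem Bx|_]; last by case: ifP.
  rewrite ifT//; apply/mem_set; apply: contrapT => Ax; exact: BAx.
rewrite !ge0_integralTE//; apply: ereal_sup_le => _ [h hf <-].
by exists h => // x; apply: le_trans (hf x) _.
Qed.

Lemma Rintegral_null_ext (A B : set 'rV[R]_m) f :
  measurable A -> A `<=` B -> mu.-negligible (B `\` A) -> measurable_fun A f ->
  \int[mu]_(x in B) f x = \int[mu]_(x in A) f x.
Proof.
move=> mA AB nAB mf; rewrite /Rintegral [in LHS]integralE [in RHS]integralE.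
have mf' : measurable_fun A (EFin \o f) by exact/measurable_EFinP.
congr (fine (_ - _)%E); apply: ge0_integral_null_ext => //.
- exact: measurable_funepos.
- exact: measurable_funeneg.
Qed.

Lemma ae_Rintegral (A : set 'rV[R]_m) f g : measurable A ->
  measurable_fun A f -> measurable_fun A g -> {ae mu, forall x, A x -> f x = g x} ->
  \int[mu]_(x in A) f x = \int[mu]_(x in A) g x.
Proof.
move=> mA mf mg fg; rewrite /Rintegral; congr fine; apply: ae_eq_integral => //.
- exact/measurable_EFinP.
- exact/measurable_EFinP.
by apply: filterS fg => x + Ax => /(_ Ax) /= ->.
Qed.

End weak_calculus.

(** * Weighted spaces on cylinders *)

Section cylinder_geometry.
Context {R : realType} {n : nat}.
Implicit Types (S : set 'rV[R]_n) (p q : 'rV[R]_n.+1) (Y : R).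

Lemma cylinder_open S Y : open S -> open (cylinder S Y).
Proof.
move=> oS; rewrite (_ : cylinder S Y = (@xpart R n) @^-1` S `&`
    (@ypart R n) @^-1` `]0, Y[%classic).
  apply: openI; first by apply: open_comp oS => p _; exact: xpart_continuous.
  by apply: open_comp (interval_open _ _) => // p _; exact: ypart_continuous.
by apply/seteqP; split => p /= [Sp yp]; split => //; move: yp; rewrite /= in_itv.
Qed.

Lemma cylinder_measurable S Y : closed S -> measurable (cylinder S Y).
Proof.
move=> cS; rewrite (_ : cylinder S Y = (@xpart R n) @^-1` S `&`
    (@ypart R n) @^-1` `]0, Y[%classic).
  apply: measurableI.
    apply: closed_row_measurable.
    by apply: preimage_closed cS => p _; exact: xpart_continuous.
  apply: open_row_measurable.
  by apply: open_comp (interval_open _ _) => // p _; exact: ypart_continuous.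
by apply/seteqP; split => p /= [Sp yp]; split => //; move: yp; rewrite /= in_itv.
Qed.

Lemma pt_near x y y' e : `|y - y'| < e -> `|pt x y - pt x y' : 'rV[R]_n.+1| < e.
Proof.
move=> yy; apply: le_lt_trans yy; rewrite ptB subrr.
by apply: norm_pt_le => //; rewrite normr0.
Qed.

(** The closed cross section may have empty interior, so that points of the
    closure are approached vertically, towards mid-height. *)
Lemma closure_cylinder S Y p : closed S -> 0 < Y ->
  closure (cylinder S Y) p <-> S (xpart p) /\ 0 <= ypart p <= Y.
Proof.
move=> cS Y0; split => [|[Sp /andP[yp0 ypY]]].
  have cA : closed ((@xpart R n) @^-1` S `&` (@ypart R n) @^-1` `[0, Y]%classic).
    apply: closedI; first by apply: preimage_closed cS => q _; exact: xpart_continuous.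
    by apply: preimage_closed (interval_closed _ _) => // q _; exact: ypart_continuous.
  have sub : cylinder S Y `<=` (@xpart R n) @^-1` S `&` (@ypart R n) @^-1` `[0, Y]%classic.
    by move=> q [Sq /andP[/ltW q0 /ltW qY]]; split => //=; rewrite in_itv /= q0.
  by move=> /(closure_subset sub)/cA[/= Sp]; rewrite in_itv.
move=> B /nbhs_rowP[e e0 eB].
pose t := Num.min (e / 2) (Y / 3).
have t0 : 0 < t by rewrite lt_min !divr_gt0.
have te : t <= e / 2 by rewrite /t ge_min lexx.
have tY : t <= Y / 3 by rewrite /t ge_min lexx orbT.
clearbody t.
pose y' := if ypart p <= Y / 2 then ypart p + t else ypart p - t.
have y'Y : 0 < y' < Y.
  rewrite /y'; case: (leP (ypart p)) => h; apply/andP; split; lra.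
have y'e : `|y' - ypart p| < e.
  by rewrite /y'; case: ifP => _; rewrite addrAC subrr add0r ?normrN gtr0_norm//; lra.
exists (pt (xpart p) y'); split; first by split; rewrite ?xpart_pt ?ypart_pt.
by apply: eB; rewrite -{2}(pt_parts p); exact: pt_near.
Qed.

Lemma cylinder_interior S Y p : (cylinder S Y)° p -> S° (xpart p).
Proof.
move=> /nbhs_rowP[e e0 eS]; apply/nbhs_rowP; exists e => // x xp.
have [] : cylinder S Y (pt x (ypart p)).
  apply: eS; rewrite -{2}(pt_parts p) ptB subrr.
  apply: le_lt_trans xp; by apply: norm_pt_le => //; rewrite normr0.
by rewrite xpart_pt.
Qed.

Lemma yweight_ge0 s p : 0 <= yweight s p. Proof. exact: powR_ge0. Qed.

Lemma yweight_measurable s : measurable_fun setT (@yweight R n s).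
Proof.
apply: (measurableT_comp (measurable_powR _)).
by apply: measurableT_comp => //; exact: measurable_row_coord.
Qed.

(** The exponent [1 - 2 * s] is greater than [-1]. *)
Lemma yweight_cylinder_fin s S Y : s < 1 -> 0 < Y -> bounded_set S ->
  measurable (cylinder S Y) ->
  (\int[lebesgue_row R n.+1]_(p in cylinder S Y) (yweight s p)%:E < +oo)%E.
Proof.
move=> s1 Y0 [N [_ SN]] mC.
have r0 : 0 < `|N| + 1 + Y + 1 by have := normr_ge0 N; lra.
have := @integral_powR_coord_fin R n.+1 ord_max (2 - 2 * s) Y (`|N| + 1 + Y + 1)
  (cylinder S Y).
rewrite (_ : 2 - 2 * s - 1 = 1 - 2 * s); last by ring.
apply => //; first lra.
- move=> p [Sp /andP[p0 pY]]; apply/cubeP => //.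
  apply: (@le_lt_trans _ _ (`|N| + 1 + Y)); last by rewrite ltrDl.
  apply: norm_parts; first by rewrite !addr_ge0// ltW.
    apply: (@le_trans _ _ (`|N| + 1)); last by rewrite lerDl ltW.
    by apply: SN => //; rewrite ltr_pwDr// ler_norm.
  by rewrite gtr0_norm//; apply: le_trans (ltW pY) _; rewrite lerDr addr_ge0.
- by move=> p [].
Qed.

End cylinder_geometry.

Section weighted.
Context {R : realType} {m : nat}.
Local Notation mu := (lebesgue_row R m).
Variables (om : 'rV[R]_m -> R) (D : set 'rV[R]_m).
Hypothesis mom : measurable_fun setT om.
Hypothesis om0 : forall x, 0 <= om x.
Hypothesis oD : open D.
Hypothesis omfin : (\int[mu]_(x in D) (om x)%:E < +oo)%E.

Lemma enorm_sqr (x : 'rV[R]_m) : enorm x ^+ 2 = dotv x x.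
Proof. by rewrite sqr_sqrtr// dotv_ge0. Qed.

Lemma measurable_dotv (A : set 'rV[R]_m) (p q : 'rV[R]_m -> 'rV[R]_m) :
  (forall i, measurable_fun A (fun x => p x ord0 i)) ->
  (forall i, measurable_fun A (fun x => q x ord0 i)) ->
  measurable_fun A (fun x => dotv (p x) (q x)).
Proof. by move=> mp mq; apply: measurable_sum => i; exact: measurable_funM. Qed.

Let mD : measurable D := open_row_measurable oD.
Let intD : D° = D.
Proof. by apply/seteqP; split; [exact: interior_subset|rewrite -open_subsetE]. Qed.

Lemma L2_ae_bounded (w : 'rV[R]_m -> R) (M : R) : measurable_fun D w ->
  {ae mu, forall x, D x -> `|w x| <= M} -> L2 om D w.
Proof.
move=> mw wM; split => //.
have momD : measurable_fun D om by exact: measurable_funTS.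
apply: (@le_lt_trans _ _ ((M ^+ 2)%:E * \int[mu]_(x in D) (om x)%:E)%E); last first.
  by rewrite lte_mul_pinfty// lee_fin sqr_ge0.
rewrite -ge0_integralZl//; last 3 first.
- exact/measurable_EFinP.
- by move=> x _; rewrite lee_fin.
- by rewrite lee_fin sqr_ge0.
apply: ae_ge0_le_integral => //.
- by move=> x _; rewrite lee_fin mulr_ge0// sqr_ge0.
- by apply/measurable_EFinP; apply: measurable_funM => //; exact: measurable_funX.
- by move=> x _; rewrite lee_fin mulr_ge0// sqr_ge0.
- by apply/measurable_EFinP; apply: measurable_funM.
apply: filterS wM => x wM Dx; rewrite -EFinM lee_fin mulrC ler_wpM2r//.
rewrite -real_normK ?num_real// ler_pXn2r ?nnegrE//; first exact: wM.
exact: le_trans (wM Dx).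
Qed.

(** The weight is integrable, so that bounded functions are square integrable. *)
Lemma H1_bounded (w : 'rV[R]_m -> R) (M : R) : measurable_fun D w ->
  (forall x, D x -> `|w x| <= M) ->
  (forall i, exists L, exists g : 'rV[R]_m -> R,
    [/\ measurable_fun setT g, forall x, `|g x| <= L & is_weak_partial D w i g]) ->
  H1 om D w.
Proof.
move=> mw wM wg; split; first by apply: (@L2_ae_bounded _ M) => //; exact: aeW.
move=> i; have [L [g [mg gL pg]]] := wg i; split; first by exists g.
have [_ [mwp _] _] := weak_partialP pg.
apply: (@L2_ae_bounded _ L) => //.
have := weak_partial_aeE mD pg; rewrite intD; apply: filterS => x h Dx.
by rewrite h.
Qed.

Lemma H1norm0 : H1norm om D (fun=> 0) = 0.
Proof.
have g0 i := weak_partial_aeE mD (is_weak_partial0 i mD).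
have mg i : measurable_fun D (weak_partial D (fun=> 0) i).
  by have [_ []] := weak_partialP (is_weak_partial0 i mD).
have momD : measurable_fun D om by exact: measurable_funTS.
rewrite /H1norm (_ : L2dot _ _ _ _ = 0); last first.
  rewrite /L2dot; under eq_Rintegral do rewrite !mulr0.
  by rewrite Rintegral_cst// mul0r.
rewrite (_ : L2vnorm _ _ _ = 0) ?expr0n ?addr0 ?sqrtr0//.
rewrite /L2vnorm (_ : Rintegral _ _ _ = 0) ?sqrtr0//.
under eq_Rintegral do rewrite enorm_sqr.
rewrite (@ae_Rintegral _ _ D _ (fun=> 0)) ?Rintegral_cst ?mul0r//.
  apply: measurable_funM => //.
  by apply: measurable_dotv => i; under eq_fun do rewrite mxE; exact: mg.
have : {ae mu, forall x (i : 'I_m), D x -> weak_partial D (fun=> 0) i x = 0}.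
  apply: (@ae_finite R m 'I_m (fun i x => D x -> weak_partial D (fun=> 0) i x = 0)) => i.
  by have := g0 i; rewrite intD.
apply: filterS => x hx Dx; rewrite /dotv big1 ?mulr0// => i _.
by rewrite mxE hx// mul0r.
Qed.

End weighted.

(** * Extension by zero from a star cylinder *)

(** The inverse image of a closed half line is closed in a closed set. *)
Lemma within_closed_measurable (R : realType) m (A : set 'rV[R]_m)
    (w : 'rV[R]_m -> R) : closed A -> {within A, continuous w} -> measurable_fun A w.
Proof.
move=> cA cw; apply: (measurability _ (RGenCInfty.measurableE R)).
move=> _ [_ [a [-> <-]]]; apply: closed_row_measurable => x Bx.
have Ax : A x by apply: cA; apply: closure_subset Bx => y [].
split => //=; rewrite in_itv /= andbT leNgt; apply/negP => wxa.
have : nbhs (w x) `]-oo, a[%classic.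
  by apply: open_nbhs_nbhs; split; [exact: interval_open|rewrite /= in_itv].
move=> /(cw x); rewrite /nbhs /= -nbhs_subspace_in// => wa.
have [y [[Ay]]] := Bx _ wa; rewrite /= !in_itv /= andbT => ya /(_ Ay).
by rewrite ltNge ya.
Qed.

Section zero_extension.
Context {R : realType} {n : nat}.
Variables (Omega S : set 'rV[R]_n) (Y : R) (W : 'rV[R]_n.+1 -> R).
Hypothesis oO : open Omega.
Hypothesis cS : closed S.
Hypothesis SO : S `<=` closure Omega.
Hypothesis intO : (closure Omega)° = Omega.
Hypothesis Y0 : 0 < Y.
Local Notation CS := (cylinder S Y).
Local Notation CY := (cylinder Omega Y).
Hypothesis cW : {within closure CS, continuous W}.
Hypothesis W0 : forall p, (frontier CS `\` slice Omega 0) p -> W p = 0.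
Local Notation ext := (zero_extension (closure CS) W).

Lemma star_interior_sub : CS° `<=` CY.
Proof.
move=> p Sp; have [_ yp] := interior_subset Sp; split => //.
by rewrite -intO; apply: (interiorS SO); exact: cylinder_interior Sp.
Qed.

Lemma star_interior_closure : CS° `<=` closure CS.
Proof. by move=> p /interior_subset; exact: subset_closure. Qed.

Lemma ext_closure p : closure CS p -> ext p = W p.
Proof. by move=> Cp; rewrite /zero_extension mem_set. Qed.

Lemma ext_outside p : ~ closure CS p -> ext p = 0.
Proof. by move=> Cp; rewrite /zero_extension memNset. Qed.

Lemma ext_frontier p : ~ CS° p -> ~ slice Omega 0 p -> ext p = 0.
Proof.
move=> Ip sp; have [Cp|Cp] := pselect (closure CS p); last exact: ext_outside.
by rewrite ext_closure//; apply: W0.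
Qed.

Lemma ext_zero_part p : zero_part Omega Y p -> ext p = 0.
Proof.
move=> zp; apply: ext_frontier.
  move=> /[dup] /star_interior_sub[Op yp] Ip.
  case: zp => [[[_ N] _]|[_ /= py]]; first exact: N (open_nbhs_nbhs (conj oO Op)).
  by move: yp; rewrite py ltxx andbF.
move=> [Op p0]; case: zp => [[_ /=]|[_ /=]]; rewrite p0 ?ltxx// => /esym Y0'.
by move: Y0; rewrite Y0' ltxx.
Qed.

(** On the bottom of the cylinder the data of [W] do not prescribe zero values
    at the lateral edge of the star: there they are limits from above. *)
Lemma ext_limit_zero p : closure (CY `\` closure CS) p -> ext p = 0.
Proof.
move=> Bp; have [Cp|Cp] := pselect (closure CS p); last exact: ext_outside.
have Ip : ~ CS° p.
  move=> Ip; have [q [[_ Nq] Iq]] := Bp _ (open_nbhs_nbhs (conj (@open_interior _ CS) Ip)).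
  exact: Nq (star_interior_closure Iq).
have [[Op p0]|] := pselect (slice Omega 0 p); last exact: ext_frontier.
have [Sp _] := (closure_cylinder p cS Y0).1 Cp.
have NSp : ~ S° (xpart p).
  move=> Isp.
  have : nbhs p ((@xpart R n) @^-1` S° `&` (@ypart R n) @^-1` `]-oo, Y[%classic).
    apply: filterI.
      by apply: xpart_continuous; apply: open_nbhs_nbhs; split => //; exact: open_interior.
    apply: ypart_continuous; apply: open_nbhs_nbhs; split; first exact: interval_open.
    by rewrite /= in_itv /= p0.
  move=> /Bp[q [[[Oq yq] Nq] [/= Sq _]]]; apply: Nq; apply: subset_closure.
  by split => //; exact: interior_subset.
rewrite ext_closure//; apply: contrapT => /eqP Wp.
have : nbhs (W p) [set t : R | t != 0].
  by apply: open_nbhs_nbhs; split => //; exact: open_neq.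
move=> /(@cW p); rewrite /nbhs /= -nbhs_subspace_in// => /nbhs_rowP[e e0 eW].
pose y := Num.min (e / 2) (Y / 2).
have y0 : 0 < y by rewrite lt_min !divr_gt0.
have ye : y <= e / 2 by rewrite /y ge_min lexx.
have yY : y <= Y / 2 by rewrite /y ge_min lexx orbT.
clearbody y.
have Cq : closure CS (pt (xpart p) y).
  by apply/closure_cylinder => //; rewrite xpart_pt ypart_pt; split => //; apply/andP; split; lra.
have qp : `|pt (xpart p) y - p| < e.
  by rewrite -{2}(pt_parts p); apply: pt_near; rewrite p0 subr0 gtr0_norm//; lra.
have /eqP := eW _ qp Cq; apply; apply: W0; split.
  by split => // /cylinder_interior; rewrite xpart_pt.
by move=> [_ /=]; rewrite ypart_pt => yy; move: y0; rewrite yy ltxx.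
Qed.

(** The extension is [W] on one closed set and zero on another, and the two
    cover the closed cylinder. *)
Lemma ext_continuous : {within closure CY, continuous ext}.
Proof.
have sub : closure CY `<=` closure CS `|` closure (CY `\` closure CS).
  apply: (@subset_trans _ (closure (closure CS `|` (CY `\` closure CS)))).
    by apply: closure_subset => p CYp; have [|] := pselect (closure CS p); [left|right].
  by rewrite closureU -((closure_id (closure CS)).1 (@closed_closure _ CS)).
apply: (continuous_subspaceW sub).
apply: withinU_continuous; [exact: closed_closure|exact: closed_closure| |].
  apply: subspace_eq_continuous cW => p /set_mem Cp; exact/esym/ext_closure.
apply: (@subspace_eq_continuous _ _ _ (fun=> 0)); last by move=> p; exact: cst_continuous.
by move=> p /set_mem Bp; exact/esym/ext_limit_zero.
Qed.

End zero_extension.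

(** * The energy comparison *)

Section energy.
Context {R : realType} {m : nat}.
Local Notation mu := (lebesgue_row R m).
Variables (om : 'rV[R]_m -> R) (D : set 'rV[R]_m).
Hypothesis mom : measurable_fun setT om.
Hypothesis om0 : forall x, 0 <= om x.
Hypothesis mD : measurable D.
Implicit Types (w : 'rV[R]_m -> R) (a b p q r : 'rV[R]_m -> 'rV[R]_m).

Definition vL2 a := forall i, L2 om D (fun x => a x ord0 i).

Let momD : measurable_fun D om. Proof. exact: measurable_funTS. Qed.

Lemma L2_integrable w : L2 om D w -> mu.-integrable D (fun x => (om x * w x ^+ 2)%:E).
Proof.
move=> [mw fw]; apply/integrableP; split.
  by apply/measurable_EFinP; apply: measurable_funM => //; exact: measurable_funX.
rewrite (eq_integral (fun x => (om x * w x ^+ 2)%:E))// => x _.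
by rewrite gee0_abs// lee_fin mulr_ge0// sqr_ge0.
Qed.

(** By [2 * |a * b| <= a ^ 2 + b ^ 2]. *)
Lemma L2_integrableM w1 w2 : L2 om D w1 -> L2 om D w2 ->
  mu.-integrable D (fun x => (om x * (w1 x * w2 x))%:E).
Proof.
move=> l1 l2; have [mw1 _] := l1; have [mw2 _] := l2.
have := integrableD mD (L2_integrable l1) (L2_integrable l2).
apply: le_integrable => //.
  by apply/measurable_EFinP; apply: measurable_funM => //; exact: measurable_funM.
move=> x _; rewrite -EFinD /= lee_fin normrM (ger0_norm (om0 x)) -mulrDr.
rewrite [leRHS]ger0_norm ?mulr_ge0 ?addr_ge0 ?sqr_ge0// ler_wpM2l// normrM.
have h1 := sqr_ge0 (`|w1 x| - `|w2 x|).
rewrite -[w1 x ^+ 2]real_normK ?num_real// -[w2 x ^+ 2]real_normK ?num_real//.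
by have h2 := mulr_ge0 (normr_ge0 (w1 x)) (normr_ge0 (w2 x)); nra.
Qed.

Lemma vL2_integrable a b : vL2 a -> vL2 b ->
  mu.-integrable D (fun x => (om x * dotv (a x) (b x))%:E).
Proof.
move=> la lb.
have := @integrable_sum _ _ _ mu D mD _ (index_enum 'I_m) xpredT
  (fun i x => (om x * (a x ord0 i * b x ord0 i))%:E)
  (fun i _ => L2_integrableM (la i) (lb i)).
by apply: eq_integrable => // x _; rewrite sumEFin /dotv mulr_sumr.
Qed.

Lemma L2B w1 w2 : L2 om D w1 -> L2 om D w2 -> L2 om D (fun x => w1 x - w2 x).
Proof.
move=> l1 l2; have [mw1 _] := l1; have [mw2 _] := l2.
have mB : measurable_fun D (fun x => w1 x - w2 x) by exact: measurable_funB.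
split => //.
have i1 := integrableD mD (L2_integrable l1) (L2_integrable l2).
have i2 := integrableB mD i1 (integrableD mD (L2_integrableM l1 l2) (L2_integrableM l1 l2)).
have /integrableP[_] := i2; apply: le_lt_trans.
rewrite le_eqVlt; apply/orP; left; apply/eqP; apply: eq_integral => x _.
rewrite -!EFinD /=.
have -> : om x * w1 x ^+ 2 + om x * w2 x ^+ 2 - (om x * (w1 x * w2 x) + om x * (w1 x * w2 x)) =
  om x * (w1 x - w2 x) ^+ 2 by ring.
by rewrite ger0_norm// mulr_ge0// sqr_ge0.
Qed.

Lemma vL2B a b : vL2 a -> vL2 b -> vL2 (fun x => a x - b x).
Proof.
move=> la lb i; have := L2B (la i) (lb i).
by congr (L2 om D _); apply/funext => x; rewrite !mxE.
Qed.

(** Galerkin orthogonality makes [e] the projection of [p - q] on its own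
    direction: the square of [p - q - e] is nonnegative and its cross term is
    twice the energy of [e]. *)
Lemma energy_le p q e : vL2 p -> vL2 q -> vL2 e ->
  L2vdot om D e e = L2vdot om D p e - L2vdot om D q e ->
  L2vdot om D e e <= L2vdot om D (fun x => p x - q x) (fun x => p x - q x).
Proof.
move=> lp lq le ortho.
have lr := vL2B lp lq.
have ipe := vL2_integrable lp le; have iqe := vL2_integrable lq le.
have irr := vL2_integrable lr lr; have iee := vL2_integrable le le.
have ire := vL2_integrable lr le.
have re : L2vdot om D (fun x => p x - q x) e = L2vdot om D e e.
  rewrite ortho /L2vdot -RintegralB//; apply: eq_Rintegral => x _.
  by rewrite dotvDl -scaleN1r dotvZl; ring.
have : 0 <= \int[mu]_(x in D) (om x * dotv (p x - q x - e x) (p x - q x - e x)).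
  by apply: Rintegral_ge0 => x _; rewrite mulr_ge0// dotv_ge0.
have -> : \int[mu]_(x in D) (om x * dotv (p x - q x - e x) (p x - q x - e x)) =
    \int[mu]_(x in D) (om x * dotv (p x - q x) (p x - q x) - om x * dotv (p x - q x) (e x) -
       (om x * dotv (p x - q x) (e x) - om x * dotv (e x) (e x))).
  apply: eq_Rintegral => x _; move: (p x - q x) (e x) => r u.
  by rewrite -scaleN1r !dotvDl !dotvDr !dotvZl !dotvZr (dotvC u r); ring.
rewrite !RintegralB//; [|exact: (integrableB mD irr ire)|exact: (integrableB mD ire iee)].
by move: re; rewrite /L2vdot => ->; lra.
Qed.

Lemma L2vnormE p : L2vnorm om D p = Num.sqrt (L2vdot om D p p).
Proof.
by rewrite /L2vnorm /L2vdot; congr Num.sqrt; apply: eq_Rintegral => x _; rewrite enorm_sqr.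
Qed.

End energy.

(** * Stars of a mesh *)

Section meshes.
Context {R : realType} {n : nat}.
Implicit Types (T : mesh R n) (z : 'rV[R]_n).

Lemma cell_set_closed (K : cell R n) : isoparametric K -> closed (cell_set K).
Proof.
move=> [FP _]; apply: compact_row_closed; apply: continuous_compact.
  apply: continuous_subspaceT; apply: smooth_map_continuous => i.
  exact: ref_P1_smooth (FP i).
apply: bounded_closed_compact; last exact: ref_element_closed.
exists 1; split => [|M M1 x /ref_element_bounded]; first exact: num_real.
by move=> /le_trans; apply; exact: ltW.
Qed.

Lemma star_closed T z : (forall i : 'I_(ncells T), isoparametric (cells i)) ->
  closed (star T z).
Proof.
move=> iso; rewrite (_ : star T z = \bigcup_(i in [set i | elt (T := T) i z]) elt (T := T) i).
  by apply: closed_bigcup => [|i _]; [exact: finite_finset|exact: cell_set_closed].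
by apply/seteqP; split => x [i]; exists i.
Qed.

Lemma ygrid0 (gam Y : R) T : gam != 0 -> ygrid gam Y T 0 = 0.
Proof. by move=> g0; rewrite /ygrid mul0r powR0// mul0r. Qed.

Lemma ygridM (gam Y : R) T : (0 < nlayers T)%N -> ygrid gam Y T (nlayers T) = Y.
Proof. by move=> M0; rewrite /ygrid divff ?powR1 ?mul1r// pnatr_eq0 -lt0n. Qed.

Lemma ygrid_itv (gam Y : R) T k : 0 < gam -> 0 < Y -> (k <= nlayers T)%N ->
  0 <= ygrid gam Y T k <= Y.
Proof.
move=> g0 Y0 kM; rewrite mulr_ge0 ?powR_ge0 ?(ltW Y0)//= ler_piMl ?(ltW Y0)//.
have kM1 : k%:R / (nlayers T)%:R <= 1 :> R.
  have [->|M0] := posnP (nlayers T); first by rewrite invr0 mulr0.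
  by rewrite ler_pdivrMr ?ltr0n// mul1r ler_nat.
apply: (le_trans (ge0_ler_powR _ _ _ kM1)); rewrite ?nnegrE ?divr_ge0//; first exact: ltW.
by rewrite powR1.
Qed.

Lemma layer_cover (gam Y : R) T y : gam != 0 -> (0 < nlayers T)%N -> 0 <= y <= Y ->
  exists k : 'I_(nlayers T), layer gam Y T k y.
Proof.
move=> g0 M0 yY; have [|k kM yk] := @grid_cover _ (ygrid gam Y T) (nlayers T) y M0.
  by rewrite ygrid0// ygridM.
by exists (Ordinal kM); rewrite /layer /= in_itv.
Qed.

End meshes.

(** * Finite element functions in the weighted space *)

Section finite_elements.
Context {R : realType} {n : nat}.

Lemma closure_cylinder_compact (S : set 'rV[R]_n) Y : bounded_set S ->
  compact (closure (cylinder S Y)).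
Proof.
move=> [N [_ SN]]; pose c := `|N| + 1 + `|Y|.
have cB : closed [set p : 'rV[R]_n.+1 | `|p| <= c].
  rewrite (_ : mkset _ = (fun p : 'rV[R]_n.+1 => `|p|) @^-1` `]-oo, c]%classic).
    by apply: preimage_closed (interval_closed _ _) => // p _; exact: norm_continuous.
  by apply/seteqP; split => p /=; rewrite in_itv.
have sub : closure (cylinder S Y) `<=` [set p : 'rV[R]_n.+1 | `|p| <= c].
  apply: (@subset_trans _ (closure [set p : 'rV[R]_n.+1 | `|p| <= c])); last exact: cB.
  apply: closure_subset => p [Sp /andP[p0 pY]] /=.
  apply: norm_parts; first by rewrite !addr_ge0.
    apply: (@le_trans _ _ (`|N| + 1)); last by rewrite lerDl.
    by apply: SN => //; rewrite ltr_pwDr// ler_norm.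
  rewrite gtr0_norm//; apply: le_trans (ltW pY) _.
  by apply: le_trans (ler_norm _) _; rewrite lerDr addr_ge0.
apply: bounded_closed_compact; last exact: closed_closure.
by exists c; split => [|M cM p /sub /= /le_trans]; [exact: num_real|apply; exact: ltW].
Qed.

Variables (Omega : set 'rV[R]_n) (s Y gam : R) (T : mesh R n).
Hypothesis n0 : (0 < n)%N.
Hypothesis oO : open Omega.
Hypothesis bO : bounded_set Omega.
Hypothesis intO : (closure Omega)° = Omega.
Hypothesis s1 : s < 1.
Hypothesis Y0 : 0 < Y.
Hypothesis g0 : 0 < gam.
Hypothesis M0 : (0 < nlayers T)%N.
Hypothesis cov : closure Omega = \bigcup_i elt (T := T) i.
Hypothesis iso : forall i : 'I_(ncells T), isoparametric (cells i).
Local Notation mu := (lebesgue_row R n.+1).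
Local Notation CY := (cylinder Omega Y).
Local Notation om := (yweight s).
Local Notation yk := (ygrid gam Y T).

Let oCY : open CY := cylinder_open (Y := Y) oO.
Let mCY : measurable CY := open_row_measurable oCY.
Let omfin : (\int[mu]_(p in CY) (om p)%:E < +oo)%E.
Proof. exact: yweight_cylinder_fin. Qed.
Let gN0 : gam != 0. Proof. by rewrite gt_eqF. Qed.

Lemma prism_cover (i : 'I_(ncells T)) p : elt i (xpart p) -> 0 <= ypart p <= Y ->
  exists k : 'I_(nlayers T), prism (cells i) (yk k) (yk k.+1) p.
Proof.
move=> ip yp; have [k] := layer_cover gN0 M0 yp; rewrite /layer /= in_itv /= => pk.
by exists k; apply/prismP.
Qed.

Lemma closure_bounded (w : 'rV[R]_n.+1 -> R) : {within closure CY, continuous w} ->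
  exists M, forall p, CY p -> `|w p| <= M.
Proof.
move=> cw; have /compact_bounded[M [_ MP]] : compact (w @` closure CY).
  by apply: continuous_compact => //; exact: closure_cylinder_compact.
exists (`|M| + 1) => p CYp; apply: MP; last by exists p => //; exact: subset_closure.
by apply: le_lt_trans (ler_norm _) _; rewrite ltrDl.
Qed.

(** Discrete functions are continuous and polynomial in the charts of the mesh
    prisms. *)
Lemma VT_H1 V : VT gam Y Omega T V -> H1 om CY V.
Proof.
move=> [cV VU _]; have [M MP] := closure_bounded cV.
apply: (H1_bounded (@yweight_measurable _ _ s) (@yweight_ge0 _ _ s) oCY omfin (M := M)) => //.
  by apply: within_continuous_measurable cV => //; exact: subset_closure.
move=> j; pose I := ('I_(ncells T) * 'I_(nlayers T))%type.
have ex (ik : I) : exists U : 'rV[R]_n.+1 -> R, smooth U /\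
    forall q, ref_prism (cells ik.1) (yk ik.2) (yk ik.2.+1) q ->
      V (prism_map (cells ik.1) q) = U q.
  have [u uP uV] := VU ik.1 ik.2; exists (fun p => u (xpart p) (ypart p)); split.
    by apply: tensor_poly_smooth uP => f; exact: ref_P1_smooth.
  by move=> q [Eq yq]; apply: uV => //; rewrite /layer /= in_itv.
have [U UP] := choice ex.
apply: (@piecewise_weak_partial R n CY V I (fun ik => cells ik.1) (fun ik => yk ik.2)
  (fun ik => yk ik.2.+1) U set0 set0) => //.
- by apply: within_continuous_measurable cV => //; exact: subset_closure.
- by move=> ik; have [] := UP ik.
- by move=> ik; have [] := UP ik.
- exact: closed0.
move=> p [Op /andP[/ltW p0 /ltW pY]]; left.
have [i _ ip] : (\bigcup_i elt (T := T) i) (xpart p) by rewrite -cov; exact: subset_closure.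
have [k pk] := prism_cover ip (introT andP (conj p0 pY)).
by exists (i, k).
Qed.

Variables (b : 'I_(ncells T) -> 'rV[R]_n -> R) (z : 'rV[R]_n).
Hypothesis bP : forall i, cell_shape (cells i) = Simplex -> is_bubble (b i).
Local Notation S := (star T z).
Local Notation CS := (cylinder S Y).

Let cS : closed S. Proof. exact: star_closed. Qed.
Let SO : S `<=` closure Omega.
Proof. by move=> x [i _ ix]; rewrite cov; exists i. Qed.

Let mCS : measurable CS. Proof. exact: cylinder_measurable. Qed.

Lemma star_prism_cover p : closure CS p -> exists i : 'I_(ncells T), elt i z /\
  exists k : 'I_(nlayers T), prism (cells i) (yk k) (yk k.+1) p.
Proof.
by move=> /(closure_cylinder p cS Y0)[[i iz ip] yp]; exists i; split => //; exact: prism_cover.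
Qed.

(** The core of a prism is an open part of the star cylinder, and the boundaries
    of the prisms are null. *)
Lemma star_boundary_null : mu.-negligible (CS `\` CS°).
Proof.
have null : mu.-negligible (\bigcup_(ik : 'I_(ncells T) * 'I_(nlayers T))
    (prism (cells ik.1) (yk ik.2) (yk ik.2.+1) `\`
     prism_core (cells ik.1) (yk ik.2) (yk ik.2.+1))).
  by apply: negligible_finite => ik; exact: prism_boundary_null.
apply: negligibleS null => p [CSp NIp].
have [i [iz [k pk]]] := star_prism_cover (subset_closure CSp).
exists (i, k) => //; split => // pc; apply: NIp.
have op : open (prism_core (cells i) (yk k) (yk k.+1)).
  have [c c0 cP] := prism_map_lower_lipschitz (yk k) (yk k.+1) (iso i).
  apply: (regular_image_open (c := c)) => //.
  - exact: prism_map_smooth.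
  - exact: ref_prism_core_open.
  - by move=> q q' Cq Cq'; apply: cP; exact: ref_prism_core_sub.
apply: (@interiorS _ (prism_core (cells i) (yk k) (yk k.+1))).
  move=> q /prism_core_sub[iq /andP[q0 qY]]; split; first by exists i.
  have /andP[h _] : 0 <= yk k <= Y by apply: ygrid_itv => //; exact: ltnW.
  have /andP[_ h'] : 0 <= yk k.+1 <= Y by exact: ygrid_itv.
  by rewrite (le_lt_trans h q0) (lt_le_trans qY h').
exact: open_nbhs_nbhs.
Qed.

Section star_function.
Variable W : 'rV[R]_n.+1 -> R.
Hypothesis WP : Wz gam Y Omega b z W.
Local Notation ext := (zero_extension (closure CS) W).

Let cW : {within closure CS, continuous W}. Proof. by case: WP. Qed.
Let W0 : forall p, (frontier CS `\` slice Omega 0) p -> W p = 0. Proof. by case: WP. Qed.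
Let cext : {within closure CY, continuous ext}. Proof. exact: ext_continuous. Qed.

(** Above the cells of the star the extension is a polynomial in the charts; in
    the open cylinder [CY] it vanishes off the open set [CS°]. *)
Lemma ext_weak_partial j : exists L, exists g : 'rV[R]_n.+1 -> R,
  [/\ measurable_fun setT g, forall x, `|g x| <= L & is_weak_partial CY ext j g].
Proof.
have [_ WU _] := WP.
pose I := ({i : 'I_(ncells T) | `[< elt i z >]} * 'I_(nlayers T))%type.
have ex (ik : I) : exists U : 'rV[R]_n.+1 -> R, smooth U /\
    forall q, ref_prism (cells (val ik.1)) (yk ik.2) (yk ik.2.+1) q ->
      ext (prism_map (cells (val ik.1)) q) = U q.
  have iz : elt (val ik.1) z by apply/asboolP; exact: (valP ik.1).
  have [u uP uW] := WU (val ik.1) ik.2 iz; exists (fun p => u (xpart p) (ypart p)); split.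
    by apply: tensor_poly_smooth uP => h; exact: (ref_P2_smooth (@bP (val ik.1))).
  move=> q [Eq yq]; rewrite ext_closure.
    by apply: uW => //; rewrite /layer /= in_itv.
  apply/(closure_cylinder _ cS Y0); rewrite xpart_pt ypart_pt; split.
    by exists (val ik.1) => //; exists (xpart q).
  have /andP[h _] : 0 <= yk ik.2 <= Y by apply: ygrid_itv => //; exact: ltnW.
  have /andP[_ h'] : 0 <= yk ik.2.+1 <= Y by exact: ygrid_itv.
  by have /andP[q0 q1] := yq; rewrite (le_trans h q0) (le_trans q1 h').
have [U UP] := choice ex.
apply: (@piecewise_weak_partial R n CY ext I (fun ik => cells (val ik.1)) (fun ik => yk ik.2)
  (fun ik => yk ik.2.+1) U (~` CS°) (~` closure CS)) => //.
- by apply: within_continuous_measurable cext => //; exact: subset_closure.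
- by move=> ik; have [] := UP ik.
- by move=> ik; have [] := UP ik.
- by apply: open_closedC; exact: open_interior.
- by apply: closed_openC; exact: closed_closure.
- by apply: subsetC; exact: star_interior_closure.
- move=> p [_ /andP[p0 _]] Ip; apply: (ext_frontier W0) => //.
  by move=> [_ /= pe]; rewrite pe ltxx in p0.
move=> p CYp; have [Cp|] := pselect (closure CS p); last by right.
have [i [/asboolP iz [k pk]]] := star_prism_cover Cp.
by left; exists (exist _ i iz, k).
Qed.

(** The extension is itself continuous up to the boundary with the required
    zero values, so that a constant sequence approximates it. *)
Lemma ext_H1L : H1L Omega s Y ext.
Proof.
have h1 : H1 om CY ext.
  have [M MP] := closure_bounded cext.
  apply: (H1_bounded (@yweight_measurable _ _ s) (@yweight_ge0 _ _ s) oCY omfin (M := M)) => //.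
    by apply: within_continuous_measurable cext => //; exact: subset_closure.
  exact: ext_weak_partial.
split => //; exists (fun=> ext) => [k|].
  by split => // p; exact: ext_zero_part.
rewrite (_ : (fun k => _) = (fun=> 0)); first exact: cvg_cst.
apply/funext => k; rewrite (_ : ext \- ext = fun=> 0).
  exact: H1norm0 (@yweight_measurable _ _ s) oCY.
by apply/funext => x /=; rewrite subrr.
Qed.

(** Both gradients are arbitrary choices up to null sets, possibly different ones
    on the two domains; a common bounded representative allows their comparison.
    Outside the star the gradient of the extension vanishes almost everywhere by
    uniqueness of weak derivatives on the open complement. *)
Lemma ext_grad : exists g : 'rV[R]_n.+1 -> 'rV[R]_n.+1,
  [/\ exists L, forall p i, `|g p ord0 i| <= L,
      forall i, measurable_fun setT (fun p => g p ord0 i),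
      forall i, measurable_fun CS (fun p => grad CS W p ord0 i),
      {ae mu, forall p, CS° p -> grad CS W p = g p} &
      {ae mu, forall p, CY p -> grad CY ext p = (if `[< CS° p >] then g p else 0)}].
Proof.
have [L LP] := choice ext_weak_partial; have [g gP] := choice LP.
have pCS i : is_weak_partial CS W i (g i).
  have [mg _ pg] := gP i; apply: is_weak_partial_restrict pg => //.
  - exact: star_interior_sub.
  - by move=> p Ip; rewrite ext_closure//; exact: star_interior_closure.
  - apply: measurable_funS (within_closed_measurable (@closed_closure _ CS) cW).
      by apply: closed_row_measurable; exact: closed_closure.
    exact: subset_closure.
exists (fun p => \row_i g i p); split.
- exists (\sum_i L i) => p i; rewrite mxE.
  have [_ gL _] := gP i; apply: (le_trans (gL p)).
  rewrite (bigD1 i)//= lerDl; apply: sumr_ge0 => k _.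
  by have [_ gk _] := gP k; exact: le_trans (gk p).
- move=> i; under eq_fun do rewrite mxE; by have [] := gP i.
- by move=> i; under eq_fun do rewrite mxE; have [_ []] := weak_partialP (pCS i).
- have : {ae mu, forall p i, CS° p -> weak_partial CS W i p = g i p}.
    apply: (@ae_finite R n.+1 'I_n.+1 (fun i p => CS° p -> weak_partial CS W i p = g i p)) => i.
    exact: weak_partial_aeE.
  by apply: filterS => p + Ip => pE; apply/rowP => i; rewrite !mxE pE.
have intCY : CY° = CY by apply/seteqP; split; [exact: interior_subset|rewrite -open_subsetE].
pose D' := CY `&` ~` closure CS.
have oD' : open D' by apply: openI => //; apply: closed_openC; exact: closed_closure.
have intD' : D'° = D' by apply/seteqP; split; [exact: interior_subset|rewrite -open_subsetE].
have mD' := open_row_measurable oD'.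
have a1 : {ae mu, forall p i, CY p -> weak_partial CY ext i p = g i p}.
  apply: (@ae_finite R n.+1 'I_n.+1 (fun i p => CY p -> weak_partial CY ext i p = g i p)) => i.
  have [_ _ pg] := gP i; by have := weak_partial_aeE mCY pg; rewrite intCY.
have a2 : {ae mu, forall p i, D' p -> g i p = 0}.
  apply: (@ae_finite R n.+1 'I_n.+1 (fun i p => D' p -> g i p = 0)) => i.
  have [mg _ pg] := gP i.
  have pD' : is_weak_partial D' (fun=> 0) i (g i).
    apply: is_weak_partial_restrict pg => //; rewrite intD' => p [] //.
    by move=> _ Np; rewrite ext_outside.
  by have := weak_partial_ae_eq mD' pD' (is_weak_partial0 i mD'); rewrite intD'.
have a3 : {ae mu, forall p, CS p -> CS° p}.
  apply: negligibleS star_boundary_null => p /= Np; split; apply: contrapT => h; apply: Np => //.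
  by move=> _; apply: contrapT => ?; apply: h.
apply: filterS3 a1 a2 a3 => p a1 a2 a3 CYp; apply/rowP => i; rewrite mxE a1//.
case: ifPn => [_|/asboolPn NIp]; first by rewrite mxE.
rewrite mxE a2//; split => // Cp; apply: NIp; apply: a3.
have [Sp _] := (closure_cylinder p cS Y0).1 Cp; have [_ yp] := CYp.
by split.
Qed.

End star_function.

End finite_elements.

(** * The local energy estimate *)

Section restriction.
Context {R : realType} {m : nat}.
Local Notation mu := (lebesgue_row R m).
Variable om : 'rV[R]_m -> R.
Hypothesis mom : measurable_fun setT om.
Hypothesis om0 : forall x, 0 <= om x.
Implicit Types (D C : set 'rV[R]_m) (a c : 'rV[R]_m -> 'rV[R]_m).

Definition vmeasurable D a := forall i, measurable_fun D (fun x => a x ord0 i).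

Lemma L2_subset D C w : measurable D -> measurable C -> D `<=` C ->
  L2 om C w -> L2 om D w.
Proof.
move=> mD mC DC [mw fw]; split; first exact: measurable_funS mw.
apply: le_lt_trans fw; apply: ge0_subset_integral => //.
- by apply/measurable_EFinP; apply: measurable_funM; [exact: measurable_funTS|exact: measurable_funX].
- by move=> x _; rewrite lee_fin mulr_ge0// sqr_ge0.
Qed.

Lemma measurable_density D a c : vmeasurable D a -> vmeasurable D c ->
  measurable_fun D (fun x => om x * dotv (a x) (c x)).
Proof. by move=> ma mc; apply: measurable_funM; [exact: measurable_funTS|exact: measurable_dotv]. Qed.

Lemma L2vdot_ae D a c a' c' : measurable D ->
  vmeasurable D a -> vmeasurable D c -> vmeasurable D a' -> vmeasurable D c' ->
  {ae mu, forall x, D x -> a x = a' x} -> {ae mu, forall x, D x -> c x = c' x} ->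
  L2vdot om D a c = L2vdot om D a' c'.
Proof.
move=> mD ma mc ma' mc' aa' cc'; apply: ae_Rintegral => //; [exact: measurable_density..|].
by apply: filterS2 aa' cc' => x aE cE Dx; rewrite aE// cE.
Qed.

(** On a null set the fields may be anything, even non-measurable. *)
Lemma L2vdot_null_ext D C a c : measurable D -> D `<=` C -> mu.-negligible (C `\` D) ->
  vmeasurable D a -> vmeasurable D c -> L2vdot om C a c = L2vdot om D a c.
Proof. by move=> mD DC nDC ma mc; apply: Rintegral_null_ext => //; exact: measurable_density. Qed.

Lemma L2vdot_support D C a c : D `<=` C ->
  L2vdot om C a (fun x => if `[< D x >] then c x else 0) = L2vdot om D a c.
Proof.
move=> DC; rewrite /L2vdot /Rintegral [in LHS]integral_mkcond [in RHS]integral_mkcond.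
congr fine; apply: eq_integral => x _; rewrite !patchE.
case: asboolP => Dx; first by rewrite !mem_set//; exact: DC.
rewrite [in RHS]memNset//; case: ifP => // _.
by rewrite /dotv big1 ?mulr0// => i _; rewrite mxE mulr0.
Qed.

End restriction.

Theorem theorem5p25
  (R : realType) (n : nat) (n_gt0 : (0 < n)%N)
  (Omega : set 'rV[R]_n) (OmegaP : polyhedral_domain Omega)
  (s : R) (s01 : 0 < s < 1)
  (lam : nat -> R) (phi : nat -> 'rV[R]_n -> R)
  (eigP : dirichlet_eigenpairs Omega lam phi)
  (Y : R) (Y_gt0 : 0 < Y) (gam : R) (gamP : 3 / (2 * s) < gam)
  (sigma sigmaY CT : R) (sigma_gt0 : 0 < sigma) (sigmaY_gt0 : 0 < sigmaY)
  (CT_gt0 : 0 < CT)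
  (T : mesh R n) (TP : mesh_family gam Y Omega sigma sigmaY CT T)
  (b : 'I_(ncells T) -> 'rV[R]_n -> R)
  (bP : forall i, cell_shape (cells i) = Simplex -> is_bubble (b i))
  (f : ('rV[R]_n -> R) -> R) (fP : Hs_dual Omega s lam phi f)
  (v : 'rV[R]_n.+1 -> R) (vP : H1L Omega s Y v)
  (v_sol : forall w, H1L Omega s Y w ->
     L2vdot (yweight s) (cylinder Omega Y)
       (grad (cylinder Omega Y) v) (grad (cylinder Omega Y) w)
     = d_s s * f (tr Omega s Y w))
  (V : 'rV[R]_n.+1 -> R) (VP : VT gam Y Omega T V)
  (V_sol : forall W, VT gam Y Omega T W ->
     L2vdot (yweight s) (cylinder Omega Y)
       (grad (cylinder Omega Y) V) (grad (cylinder Omega Y) W)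
     = d_s s * f (tr Omega s Y W))
  (eta : 'rV[R]_n -> 'rV[R]_n.+1 -> R)
  (etaP : forall z, is_node T z -> Wz gam Y Omega b z (eta z))
  (eta_sol : forall z, is_node T z -> forall W, Wz gam Y Omega b z W ->
     L2vdot (yweight s) (cylinder (star T z) Y)
       (grad (cylinder (star T z) Y) (eta z))
       (grad (cylinder (star T z) Y) W)
     = d_s s * f (tr Omega s Y
         (zero_extension (closure (cylinder (star T z) Y)) W))
       - L2vdot (yweight s) (cylinder (star T z) Y)
           (grad (cylinder Omega Y) V) (grad (cylinder (star T z) Y) W)) :
  forall z, is_node T z ->
    L2vnorm (yweight s) (cylinder (star T z) Y)
      (grad (cylinder (star T z) Y) (eta z))
    <= L2vnorm (yweight s) (cylinder (star T z) Y)
         (grad (cylinder Omega Y) (v \- V)).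
Proof.
move=> z zN; have WP := etaP z zN.
have [_ oO bO _ [_ intO]] := OmegaP; have [M0 [cov _ _] [iso _] _ _] := TP.
have [s0 s1] := andP s01.
have g0 : 0 < gam by apply: lt_trans gamP; rewrite divr_gt0// mulr_gt0.
set CY := cylinder Omega Y; set CS := cylinder (star T z) Y.
pose mu := lebesgue_row R n.+1; pose om := @yweight R n s.
have mom : measurable_fun setT om by exact: yweight_measurable.
have om0 p : 0 <= om p by exact: yweight_ge0.
have oCY : open CY by exact: cylinder_open.
have mCY := open_row_measurable oCY.
have intCY : CY° = CY by apply/seteqP; split; [exact: interior_subset|rewrite -open_subsetE].
have mI : measurable CS° by apply: open_row_measurable; exact: open_interior.
have ICS : CS° `<=` CS by exact: interior_subset.
have SO : star T z `<=` closure Omega by move=> x [i _ ix]; rewrite cov; exists i.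
have ICY : CS° `<=` CY by exact: star_interior_sub.
have nI : mu.-negligible (CS `\` CS°) by exact: (star_boundary_null _ _ g0).
have hext := ext_H1L n_gt0 oO bO intO s1 Y_gt0 g0 M0 cov iso bP WP.
have hV := VT_H1 n_gt0 oO bO s1 Y_gt0 g0 M0 cov iso VP.
have [g [[L gL] mg mW gW gE]] := ext_grad n_gt0 oO intO Y_gt0 g0 M0 cov iso bP WP.
set ext := zero_extension _ _ in hext gE.
have mH1 w : H1 om CY w -> vmeasurable CY (grad CY w).
  by move=> [_ hw] i; under eq_fun do rewrite mxE; have [_ []] := hw i.
have lH1 w : H1 om CY w -> vL2 om CS° (grad CY w).
  move=> [_ hw] i; rewrite (_ : (fun x => _) = weak_partial CY w i); last first.
    by apply/funext => x; rewrite mxE.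
  by apply: (L2_subset mom om0 mI mCY ICY); have [] := hw i.
have sub A B (a : 'rV[R]_n.+1 -> 'rV[R]_n.+1) : measurable B -> A `<=` B -> vmeasurable B a -> vmeasurable A a.
  by move=> mB AB ma i; exact: measurable_funS (ma i).
have [hv _] := vP.
have mgI : vmeasurable CS° g by move=> i; exact: measurable_funTS.
have mWI : vmeasurable CS° (grad CS (eta z)).
  move=> i; apply: measurable_funS (mW i) => //.
  by apply: cylinder_measurable; exact: star_closed.
have mpI := sub _ _ _ mCY ICY (mH1 _ hv).
have mqI := sub _ _ _ mCY ICY (mH1 _ hV).
(* the equation for v is tested with the extension, that for the indicator
   with itself; all the terms become integrals over the open set CS° *)
have e1 : L2vdot om CY (grad CY v) (grad CY ext) = L2vdot om CS° (grad CY v) g.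
  rewrite -(L2vdot_support om (grad CY v) g ICY); apply: L2vdot_ae => //.
  - exact: mH1.
  - by apply: mH1; have [] := hext.
  - exact: mH1.
  - move=> i; rewrite (_ : (fun x => _) = (fun x => g x ord0 i) \_ CS°).
      by apply: measurable_funTS; exact/(measurable_restrictT _ mI).
    apply/funext => x; rewrite patchE; case: asboolP => Dx; first by rewrite mem_set.
    by rewrite memNset// mxE.
  - exact: filterE.
have e2 : L2vdot om CS (grad CS (eta z)) (grad CS (eta z)) = L2vdot om CS° g g.
  by rewrite (L2vdot_null_ext mom mI ICS nI mWI mWI); exact: L2vdot_ae.
have e3 : L2vdot om CS (grad CY V) (grad CS (eta z)) = L2vdot om CS° (grad CY V) g.
  by rewrite (L2vdot_null_ext mom mI ICS nI mqI mWI); apply: L2vdot_ae => //; exact: filterE.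
(* the load terms of the two equations cancel *)
have ortho : L2vdot om CS° g g = L2vdot om CS° (grad CY v) g - L2vdot om CS° (grad CY V) g.
  by rewrite -e1 -e2 -e3 v_sol// (eta_sol z zN _ WP).
have pr i : is_weak_partial CY (v \- V) i (weak_partial CY v i \- weak_partial CY V i).
  have [_ /(_ i)[[gv /weak_partialP pv] _]] := hv.
  have [_ /(_ i)[[gV /weak_partialP pV] _]] := hV.
  exact: is_weak_partialB.
have mrI : vmeasurable CS° (grad CY (v \- V)).
  apply: (sub _ _ _ mCY ICY) => i; under eq_fun do rewrite mxE.
  by have [_ []] := weak_partialP (pr i).
have rE : {ae mu, forall p, CS° p -> grad CY (v \- V) p = grad CY v p - grad CY V p}.
  have : {ae mu, forall p i, CY p ->
      weak_partial CY (v \- V) i p = weak_partial CY v i p - weak_partial CY V i p}.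
    apply: (@ae_finite R n.+1 'I_n.+1 (fun i p => CY p ->
      weak_partial CY (v \- V) i p = weak_partial CY v i p - weak_partial CY V i p)) => i.
    by have := weak_partial_aeE mCY (pr i); rewrite intCY.
  apply: filterS => p + /ICY CYp => pE; apply/rowP => i; rewrite !mxE; exact: pE.
have mdI : vmeasurable CS° (fun p => grad CY v p - grad CY V p).
  move=> i; rewrite (_ : (fun x => _) =
      (fun x => grad CY v x ord0 i) \- (fun x => grad CY V x ord0 i)).
    exact: measurable_funB.
  by apply/funext => x; rewrite /= !mxE.
have e4 : L2vdot om CS (grad CY (v \- V)) (grad CY (v \- V)) =
    L2vdot om CS° (fun p => grad CY v p - grad CY V p) (fun p => grad CY v p - grad CY V p).
  by rewrite (L2vdot_null_ext mom mI ICS nI mrI mrI); exact: L2vdot_ae.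
have lg : vL2 om CS° g.
  move=> i; apply: (L2_ae_bounded mom om0 (@open_interior _ CS) _ (M := L)) => //; last first.
    by apply: aeW => p _.
  apply: (@le_lt_trans _ _ (\int[mu]_(p in CY) (om p)%:E)%E); last exact: yweight_cylinder_fin.
  apply: ge0_subset_integral => //; first by apply/measurable_EFinP; exact: measurable_funTS.
  by move=> p _; rewrite lee_fin.
rewrite !L2vnormE e2 e4; apply: ler_wsqrtr.
exact: energy_le (lH1 _ hv) (lH1 _ hV) lg ortho.
Qed.
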